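(* Let $\psi$ be such that for all $t\in[0,T]$ the linear operator $$\mathcal{G}_\psi:X\subset L_2(\mathbb{R}^N)\to L_2(\mathbb{R}^N),\qquad v\mapsto\mathcal{G}_\psi(v):=\mathcal{F}^{-1}\big(\psi'(t)\,\mathcal{F}(v)\big)$$ is well-defined and bounded, where $X$ is a closed subspace of $L_2(\mathbb{R}^N)$, and let $\mathcal{F}^{-1}(e^{i\psi(t)}u)\in X$ for all $t\in[0,T]$. Assume that for some $Z_1,Z_2\subseteq L_2(\mathbb{R}^N)$ there exist real-valued operators $\mathcal{L}_\psi:Z_1\times Z_2\to L_2(\mathbb{R}^N)$ and $\mathcal{S}_\psi:Z_1\times Z_2\to L_2(\mathbb{R}^N)$ such that for all $a\in Z_1$ and $\phi\in Z_2$ there holds $$i\,\mathcal{G}_\psi\big(a\,e^{i\phi}\big)(x)=e^{i\phi(x)}\big(\mathcal{L}_\psi(a,\phi)(x)+i\,\mathcal{S}_\psi(a,\phi)(x)\big).$$ If $A(\cdot,t)\in Z_1$ and $\varphi(\cdot,t)\in Z_2$ for all $t\in[0,T]$, then $$\frac{\partial}{\partial t}I(x,t)=2\,A(x,t)\,\mathcal{L}_\psi(A(\cdot,t),\varphi(\cdot,t))(x),$$ and furthermore, if $A(x,t)$ and $\varphi(x,t)$ are also differentiable with respect to $t$, then $$2\,I(x,t)\,\frac{\partial}{\partial t}\varphi(x,t)=2\,A(x,t)\,\mathcal{S}_\psi(A(\cdot,t),\varphi(\cdot,t))(x).$$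
   Context: The Fourier transform is normalized as $(\mathcal{F}u)(\xi)=\int_{\mathbb{R}^N} e^{-2\pi i \xi\cdot x}u(x)\,dx$, $(\mathcal{F}^{-1}u)(x)=\int_{\mathbb{R}^N} e^{2\pi i x\cdot\xi}u(\xi)\,d\xi$. Standing assumptions: for some $T>0$, $u:\mathbb{R}^N\to\mathbb{C}$ and $\varphi,\psi,A:\mathbb{R}^N\times[0,T]\to\mathbb{R}$ satisfy $u\in L_2(\mathbb{R}^N)$, $\varphi(\cdot,t),A(\cdot,t)\in L_2(\mathbb{R}^N)$ for each $t\in[0,T]$, and $\psi(\xi,\cdot)\in C^1([0,T])$. One writes $\psi(t)=\psi(\xi,t)$, $\psi'(t)=\frac{\partial}{\partial t}\psi(\xi,t)$; the operators $\mathcal{G}_\psi,\mathcal{L}_\psi,\mathcal{S}_\psi$ depend on $t$ and are evaluated at the same $t$ in each identity. $Z_1,Z_2$ consist of real-valued functions, and ''real-valued operator'' means an operator whose values are real-valued functions. The intensity is $I(x,t):=|\mathcal{F}^{-1}(e^{i\psi(t)}u)(x)|^2$, and amplitude $A$ and phase $\varphi$ are given by the polar form $\mathcal{F}^{-1}(e^{i\psi(t)}u)(x)=A(x,t)e^{i\varphi(x,t)}$ with $A(x,t)=\sqrt{I(x,t)}$.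
   Formalization: The bound on G_ψ is assumed uniform in t (with a bound only for each t the claim fails). ∂I/∂t is asserted as a derivative in the weak topology of L_1 for every t and, for a.e. x, pointwise wherever it exists; the phase identity also holds for a.e. x. *)

(* Defs.v *)
From HB Require Import structures.
From mathcomp Require Import all_boot all_order all_algebra.
From mathcomp Require Import all_classical all_reals all_analysis.
From mathcomp Require Export complex.

Set Implicit Arguments.
Unset Strict Implicit.
Unset Printing Implicit Defensive.
Import Order.TTheory GRing.Theory Num.Theory.
Import numFieldNormedType.Exports.
Import ComplexField.Normc.

Local Open Scope classical_set_scope.
Local Open Scope ring_scope.
Local Open Scope complex_scope.

Section product_measure_cons.
Context d {T : measurableType d} {R : realType} {n : nat}.
Variable m1 : {sigma_finite_measure set T -> \bar R}.
Variable m : {sigma_finite_measure set (n.-tuple T) -> \bar R}.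

Definition cons_pair (p : T * n.-tuple T) : n.+1.-tuple T := [tuple of p.1 :: p.2].

Lemma measurable_cons_pair : measurable_fun [set: T * n.-tuple T] cons_pair.
Proof. by apply: measurable_cons; [exact: measurable_fst|exact: measurable_snd]. Qed.

Definition product_cons : set (n.+1.-tuple T) -> \bar R :=
  pushforward (m1 \x m)%E cons_pair.

HB.instance Definition _ := Measure.copy product_cons
  (measure_function_pushforward__canonical__measure_function_Measure
     (m1 \x m)%E measurable_cons_pair).

Lemma sigma_finite_product_cons : sigma_finite [set: n.+1.-tuple T] product_cons.
Proof.
have /sigma_finiteP[F [TF ndF Foo]] := sigma_finiteT m1.
have /sigma_finiteP[G [TG ndG Goo]] := sigma_finiteT m.
pose uncons (x : n.+1.-tuple T) : T * n.-tuple T :=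
  (thead x, [tuple of behead x]).
have consK : cancel cons_pair uncons by case=> a x; congr pair; apply/val_inj.
have muncons : measurable_fun [set: n.+1.-tuple T] uncons.
  by apply: measurable_fun_pair; [exact: measurable_tnth|exact: measurable_behead].
exists (fun k => uncons @^-1` (F k `*` G k)).
  rewrite -preimage_bigcup (_ : \bigcup_k (F k `*` G k) = setT) ?preimage_setT//.
  rewrite -subTset => -[x y] _.
  have [k _ Fkx] : (\bigcup_k F k) x by rewrite -TF.
  have [l _ Gly] : (\bigcup_k G k) y by rewrite -TG.
  exists (maxn k l) => //; split.
    by move: x Fkx; exact/subsetPset/ndF/leq_maxl.
  by move: y Gly; exact/subsetPset/ndG/leq_maxr.
move=> k; have [mF Fk] := Foo k; have [mG Gk] := Goo k.
split; first by rewrite -[X in measurable X]setTI; apply: muncons => //; exact: measurableX.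
rewrite /product_cons /pushforward (_ : _ @^-1` _ = F k `*` G k); last first.
  by rewrite -comp_preimage (_ : _ \o _ = id)//; exact/funext/consK.
by rewrite product_measure1E// lte_mul_pinfty// ge0_fin_numE.
Qed.

HB.instance Definition _ := Measure_isSigmaFinite.Build _ _ _ product_cons
  sigma_finite_product_cons.
End product_measure_cons.

Fixpoint product_power d (T : measurableType d) (R : realType)
    (m : {sigma_finite_measure set T -> \bar R}) (n : nat) :
    {sigma_finite_measure set (n.-tuple T) -> \bar R} :=
  if n is k.+1 then product_cons m (product_power m k) else \d_([tuple] : 0.-tuple T).

Notation Rn R N := (N.-tuple (measurableTypeR R)).

Definition lebesgueN (R : realType) (N : nat) :
    {sigma_finite_measure set (Rn R N) -> \bar R} :=
  product_power (@lebesgue_measure R) N.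

Section L2.
Context {R : realType} {N : nat}.
Local Notation V := (Rn R N).
Local Notation C := R[i].
Local Notation mu := (lebesgueN R N).

Definition cmeasurable (f : V -> C) :=
  measurable_fun [set: V] (fun x => complex.Re (f x)) /\
  measurable_fun [set: V] (fun x => complex.Im (f x)).

Definition L2norm (f : V -> C) : \bar R :=
  'N[mu]_2%:E[EFin \o (@normc R \o f)]%E.

(* The sigma-algebra on [V] is the Borel one; asking for a Borel version makes
   the a.e. class of [f], hence any Lebesgue measurable [f], eligible. *)
Definition L2 (f : V -> C) :=
  exists g : V -> C,
    [/\ cmeasurable g, (L2norm g < +oo)%E & \forall x \ae mu, f x = g x].

Definition L1 (f : V -> R) :=
  exists2 g : V -> R, mu.-integrable [set: V] (EFin \o g) &
    \forall x \ae mu, f x = g x.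

Definition realL2 (a : V -> R) := L2 (fun x => (a x)%:C).

Definition L2_cvg (v_ : nat -> V -> C) (v : V -> C) :=
  L2norm (fun x => v_ n x - v x) @[n --> \oo] --> 0%E.

Definition closed_subspace (X : set (V -> C)) :=
  [/\ X `<=` L2,
      X (fun _ => 0),
      (forall (a : C) (v w : V -> C), X v -> X w -> X (fun x => a * v x + w x)) &
      (forall (v_ : nat -> V -> C) (v : V -> C),
        (forall n, X (v_ n)) -> L2 v -> L2_cvg v_ v -> X v)].

Definition expi (a : R) : C := cos a +i* sin a.

Definition dot (x y : V) : R := \sum_(i < N) tnth x i * tnth y i.

Definition cintegral (f : V -> C) : C :=
  Rintegral mu setT (fun x => complex.Re (f x)) +i*
  Rintegral mu setT (fun x => complex.Im (f x)).

Definition cintegrable (f : V -> C) :=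
  mu.-integrable [set: V] (fun x => (complex.Re (f x))%:E) /\
  mu.-integrable [set: V] (fun x => (complex.Im (f x))%:E).

Definition fourier_int (u : V -> C) (xi : V) : C :=
  cintegral (fun x => expi (- (2 * pi * dot xi x)) * u x).

Definition ifourier_int (u : V -> C) (x : V) : C :=
  cintegral (fun xi => expi (2 * pi * dot x xi) * u xi).

(* [K], given by an integral on L1 `&` L2, is extended to L2 by continuity:
   the graph of the extension is the closure of the graph of [K] in L2 * L2. *)
Definition L2_extension (K : (V -> C) -> V -> C) (u w : V -> C) :=
  [/\ L2 u, L2 w & exists u_ : nat -> V -> C,
    [/\ (forall n, cintegrable (u_ n) /\ L2 (u_ n)),
        L2_cvg u_ u & L2_cvg (fun n => K (u_ n)) w]].

(* [is_fourier u w]: the function [w] is a version of the (Plancherel)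
   Fourier transform of [u]; similarly for the inverse transform. *)
Definition is_fourier := L2_extension fourier_int.
Definition is_ifourier := L2_extension ifourier_int.

(* [is_multiplier m v g]: [g] is a version of F^-1 (m * F v). *)
Definition is_multiplier (m : V -> R) (v g : V -> C) :=
  exists2 w : V -> C, is_fourier v w & is_ifourier (fun xi => (m xi)%:C * w xi) g.

Definition polar (a phi : V -> R) (x : V) : C := (a x)%:C * expi (phi x).

End L2.

(* Derivatives on [0, T] are one-sided at the end points. *)
Section time_derivative.
Context {R : realType}.
Variable T : R.

Definition difference_quotient (f : R -> R) (t s : R) := (f s - f t) / (s - t).

Definition derivable_in (f : R -> R) (t : R) :=
  cvg (difference_quotient f t s @[s --> within `[0, T] t^']).

Definition derive_in (f : R -> R) (t : R) : R :=
  lim (difference_quotient f t s @[s --> within `[0, T] t^']).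

Definition C1_in (f : R -> R) :=
  (forall t : R, t \in `[0, T] -> derivable_in f t) /\
  {within `[0, T], continuous (derive_in f)}.
End time_derivative.

(* At time [t], the difference quotients of [s |-> h ^~ s] converge to [k] in
   the weak topology of L1: the test functions range over the dual Loo. *)
Definition is_weak_derive_in {R : realType} {N : nat} (T : R)
    (h : Rn R N -> R -> R) (t : R) (k : Rn R N -> R) :=
  [/\ (forall s : R, s \in `[0, T] -> L1 (h ^~ s)), L1 k &
    forall theta : Rn R N -> R, measurable_fun [set: Rn R N] theta ->
      (exists M, forall x, `|theta x| <= M) ->
      let p s := Rintegral (lebesgueN R N) setT (fun x => h x s * theta x) in
      derivable_in T p t /\
      derive_in T p t = Rintegral (lebesgueN R N) setT (fun x => k x * theta x)].

Section intensity.
Context {R : realType} {N : nat}.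
Variable f : Rn R N -> R -> R[i].
Definition intensity (x : Rn R N) (t : R) : R := normc (f x t) ^+ 2.
Definition amplitude (x : Rn R N) (t : R) : R := Num.sqrt (intensity x t).
End intensity.

(* Main.v *)
(* Only the extension of the two integral transforms to L2 and Fourier inversion
   are needed from Fourier analysis. Weighting |F v|^2 by exp(- a sum |xi_i|),
   whose transform is a product of Poisson kernels P_a of mass one, gives
   int |F v|^2 exp(- a sum |xi_i|) = <v, P_a * v> <= |v|^2, so that F is a
   contraction on L1 `&` L2. For the indicator of a box P_a * v can be computed,
   and letting a tend to 0 shows that F preserves its norm; a contraction that
   preserves the norm of g preserves the inner products with g, and the g with
   this property form a closed subspace containing the indicators of boxes, hence
   all of L1 `&` L2.

   Put v_s = e^(i psi(s)) u, f_s = F^-1 v_s and d_s = psi'(s) v_s. By inversion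
   F^-1 d_s is G_s f_s, so |d_s| <= K |u| uniformly in s. The quotients
   (v_s - v_t) / (s - t) converge to i d_t pointwise, and their norms are at most
   K |u| since those of psi are limits of averages of psi'; hence they converge
   weakly in L2, and (f_s - f_t) / (s - t) converges weakly to
   i G_t f_t = e^(i phi) (L + i S). As |f_s|^2 - |f_t|^2 =
   2 Re ((f_s - f_t) conj(f_t)) + |f_s - f_t|^2, the weak derivative of the
   intensity is 2 Re ((i G_t f_t) conj(f_t)) = 2 A L. A pointwise limit must agree
   with a weak one, which identifies the pointwise derivatives of I and of
   A e^(i phi). *)
Require Import Defs.
From mathcomp Require Import all_boot all_order all_algebra finmap.
From mathcomp Require Import all_classical all_reals all_analysis.
From mathcomp Require Import measurable_realfun ring lra.

Set Implicit Arguments.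
Unset Strict Implicit.
Unset Printing Implicit Defensive.
Import Order.TTheory GRing.Theory Num.Theory.
Import numFieldNormedType.Exports.
Import ComplexField.Normc.
Local Open Scope classical_set_scope.
Local Open Scope ring_scope.
Local Open Scope complex_scope.

(** The hypotheses see functions only up to null sets, and a function they admit need not be Borel.
    Borel versions are therefore chosen for every time, and integrals are shown not to depend on the
    choice. The factor [psi'] may be unbounded in [xi], so the difference quotients need not be
    dominated. The uniform operator bound [K] replaces domination and gives weak convergence; it
    also makes the quadratic term [(s - t) |Q|^2] vanish, where [Q] is the quotient of [f]. The
    weight [exp(- a sum |xi_i|)] is a product, which reduces its transform to one variable, where
    all antiderivatives are elementary (exponential times sine and cosine, arctangent); that
    transform is positive and has mass one. *)

Local Notation Re := complex.Re.
Local Notation Im := complex.Im.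

(** * Square integrable functions *)

Section complex_parts.
Context {R : realType}.
Implicit Types z w : R[i].

Lemma cReD z w : Re (z + w) = Re z + Re w. Proof. by case: z; case: w. Qed.
Lemma cImD z w : Im (z + w) = Im z + Im w. Proof. by case: z; case: w. Qed.
Lemma cReM z w : Re (z * w) = Re z * Re w - Im z * Im w.
Proof. by case: z; case: w. Qed.
Lemma cImM z w : Im (z * w) = Re z * Im w + Im z * Re w.
Proof. by case: z; case: w. Qed.
Lemma cReN z : Re (- z) = - Re z. Proof. by case: z. Qed.
Lemma cImN z : Im (- z) = - Im z. Proof. by case: z. Qed.
Definition RIE := (cReD, cImD, cReM, cImM, cReN, cImN).

Lemma sqr_normc z : normc z ^+ 2 = Re z ^+ 2 + Im z ^+ 2.
Proof. by case: z => a b /=; rewrite sqr_sqrtr// addr_ge0// sqr_ge0. Qed.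

Lemma normc_ge0 z : 0 <= normc z.
Proof. by case: z => a b /=; exact: sqrtr_ge0. Qed.

Lemma sqr_normcM z w : normc (z * w) ^+ 2 = normc z ^+ 2 * normc w ^+ 2.
Proof. by rewrite !sqr_normc !RIE; ring. Qed.

Lemma sqr_normc_expi (a : R) : normc (expi a) ^+ 2 = 1.
Proof. by rewrite sqr_normc /= cos2Dsin2. Qed.

Lemma sqr_normcR (a : R) : normc a%:C ^+ 2 = a ^+ 2.
Proof. by rewrite sqr_normc /= expr0n addr0. Qed.

End complex_parts.

Section square_integrable.
Context d (T : measurableType d) (R : realType).
Variable mu : {measure set T -> \bar R}.
Implicit Types f g h : T -> R[i].

Definition cmeas f := measurable_fun [set: T] (fun x => Re (f x)) /\
  measurable_fun [set: T] (fun x => Im (f x)).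

Definition sqint f : \bar R := (\int[mu]_x ((normc (f x) ^+ 2)%:E))%E.

Definition sqi f := cmeas f /\ (sqint f < +oo)%E.

(* The real part of [f * conj g]; replacing [f] by ['i * f] recovers the imaginary
   part, so that real inner products suffice. *)
Definition rdot f g (x : T) : R := Re (f x) * Re (g x) + Im (f x) * Im (g x).

Definition ip f g : R := Rintegral mu [set: T] (rdot f g).

Lemma cmeasD f g : cmeas f -> cmeas g -> cmeas (fun x => f x + g x).
Proof.
move=> [f1 f2] [g1 g2]; split; under eq_fun do rewrite RIE;
  exact: measurable_funD.
Qed.

Lemma cmeasM f g : cmeas f -> cmeas g -> cmeas (fun x => f x * g x).
Proof.
move=> [f1 f2] [g1 g2]; split; under eq_fun do rewrite RIE.
  by apply: measurable_funB; exact: measurable_funM.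
by apply: measurable_funD; exact: measurable_funM.
Qed.

Lemma cmeas_cst z : cmeas (fun=> z).
Proof. by split; exact: measurable_cst. Qed.

Lemma cmeasR (a : T -> R) : measurable_fun [set: T] a ->
  cmeas (fun x => (a x)%:C).
Proof. by move=> ma; split=> //=; exact: measurable_cst. Qed.

Lemma measurable_sqr_normc f : cmeas f ->
  measurable_fun [set: T] (fun x => normc (f x) ^+ 2).
Proof.
move=> [f1 f2]; under eq_fun do rewrite sqr_normc.
by apply: measurable_funD; apply: measurable_funX.
Qed.

Lemma measurable_rdot f g : cmeas f -> cmeas g ->
  measurable_fun [set: T] (rdot f g).
Proof.
by move=> [f1 f2] [g1 g2]; apply: measurable_funD; exact: measurable_funM.
Qed.

Lemma sqint_ge0 f : (0 <= sqint f)%E.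
Proof. by apply: integral_ge0 => x _; rewrite lee_fin sqr_ge0. Qed.

Lemma le_sqint f g (c : R) : 0 <= c -> cmeas f -> cmeas g ->
  (forall x, normc (f x) ^+ 2 <= c * normc (g x) ^+ 2) ->
  (sqint f <= c%:E * sqint g)%E.
Proof.
move=> c0 mf mg fg.
have mn h : cmeas h -> measurable_fun [set: T] (fun x => (normc (h x) ^+ 2)%:E).
  by move=> mh; apply/measurable_EFinP; exact: measurable_sqr_normc.
have n0 h (x : T) : [set: T] x -> (0 <= (normc (h x) ^+ 2)%:E)%E.
  by move=> _; rewrite lee_fin sqr_ge0.
rewrite /sqint -(ge0_integralZl mu measurableT (mn _ mg) (n0 g)) ?lee_fin//.
apply: ge0_le_integral => //; [exact: n0|exact: mn|..|].
- by apply: measurable_funeM; exact: mn.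
- by move=> x _; rewrite -EFinM lee_fin.
Qed.

Lemma sqi_le f g (c : R) : 0 <= c -> cmeas f -> sqi g ->
  (forall x, normc (f x) ^+ 2 <= c * normc (g x) ^+ 2) -> sqi f.
Proof.
move=> c0 mf [mg gfin] fg; split => //.
by apply: le_lt_trans (le_sqint c0 mf mg fg) _; rewrite lte_mul_pinfty.
Qed.

Lemma sqi_integrable f : sqi f ->
  mu.-integrable [set: T] (fun x => (normc (f x) ^+ 2)%:E).
Proof.
move=> [mf ffin]; apply/integrableP; split.
  by apply/measurable_EFinP; exact: measurable_sqr_normc.
rewrite (le_lt_trans _ ffin)// le_eqVlt; apply/orP; left; apply/eqP.
by apply: eq_integral => x _; rewrite /= ger0_norm// sqr_ge0.
Qed.

Lemma integrable_rdot f g : sqi f -> sqi g ->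
  mu.-integrable [set: T] (EFin \o rdot f g).
Proof.
move=> sf sg.
have := integrableD measurableT (sqi_integrable sf) (sqi_integrable sg).
apply: le_integrable => //.
  by apply/measurable_EFinP; exact: measurable_rdot sf.1 sg.1.
move=> x _ /=; rewrite lee_fin [leRHS]ger0_norm ?addr_ge0 ?sqr_ge0//.
rewrite /rdot !sqr_normc ler_norml; apply/andP; split;
  move: (Re (f x)) (Im (f x)) (Re (g x)) (Im (g x)) => a b c e;
  have := sqr_ge0 (a + c); have := sqr_ge0 (b + e);
  have := sqr_ge0 (a - c); have := sqr_ge0 (b - e); nra.
Qed.

Lemma sqiD f g : sqi f -> sqi g -> sqi (fun x => f x + g x).
Proof.
move=> sf sg; split; first exact: cmeasD sf.1 sg.1.
have : mu.-integrable [set: T]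
    (fun x => (2 * (normc (f x) ^+ 2 + normc (g x) ^+ 2))%:E).
  exact: (integrableZl measurableT 2 (integrableD measurableT
    (sqi_integrable sf) (sqi_integrable sg))).
move=> /integrableP[_]; apply: le_lt_trans; apply: ge0_le_integral => //.
- by move=> x _; rewrite lee_fin sqr_ge0.
- apply/measurable_EFinP; apply: measurable_sqr_normc.
  exact: cmeasD sf.1 sg.1.
- by apply: measurableT_comp => //; apply/measurable_EFinP;
    apply: measurable_funM => //; apply: measurable_funD;
    [exact: measurable_sqr_normc sf.1|exact: measurable_sqr_normc sg.1].
move=> x _; rewrite lee_fin ger0_norm; last first.
  by rewrite mulr_ge0// addr_ge0// sqr_ge0.
rewrite !sqr_normc !RIE.
move: (Re (f x)) (Im (f x)) (Re (g x)) (Im (g x)) => a b c e.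
by have := sqr_ge0 (a - c); have := sqr_ge0 (b - e); nra.
Qed.

Lemma sqiM (m : T -> R[i]) (c : R) f : cmeas m ->
  (forall x, normc (m x) ^+ 2 <= c) -> sqi f -> sqi (fun x => m x * f x).
Proof.
move=> mm mc sf; apply: (@sqi_le _ f `|c|) => //.
  exact: cmeasM sf.1.
move=> x; rewrite sqr_normcM ler_wpM2r ?sqr_ge0//.
by rewrite (le_trans (mc x))// ler_norm.
Qed.

Lemma sqiZ z f : sqi f -> sqi (fun x => z * f x).
Proof.
by apply: (@sqiM (fun=> z) (normc z ^+ 2)) => //; exact: cmeas_cst.
Qed.

Lemma sqiB f g : sqi f -> sqi g -> sqi (fun x => f x - g x).
Proof.
move=> sf /(sqiZ (-1)) sg; have := sqiD sf sg.
by under eq_fun do rewrite mulN1r.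
Qed.

Lemma sqi0 : sqi (fun=> 0).
Proof.
split; first exact: cmeas_cst.
rewrite /sqint; under eq_integral do rewrite sqr_normc /= expr0n addr0.
by rewrite integral0.
Qed.

Lemma sqintE f : sqi f -> sqint f = (ip f f)%:E.
Proof.
move=> sf; rewrite /ip /Rintegral fineK; last first.
  exact: (integrable_fin_num measurableT (integrable_rdot sf sf)).
by apply: eq_integral => x _; rewrite /= sqr_normc !expr2.
Qed.

Lemma ip_ge0 f : 0 <= ip f f.
Proof.
by apply: Rintegral_ge0 => x _; rewrite /rdot -!expr2 addr_ge0// sqr_ge0.
Qed.

Lemma ipC f g : ip f g = ip g f.
Proof.
by apply: eq_Rintegral => x _; rewrite /rdot [X in X + _]mulrC [X in _ + X]mulrC.
Qed.

Lemma ipDl f g h : sqi f -> sqi g -> sqi h ->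
  ip (fun x => f x + g x) h = ip f h + ip g h.
Proof.
move=> sf sg sh; rewrite /ip -RintegralD//; try exact: integrable_rdot.
by apply: eq_Rintegral => x _; rewrite /rdot !RIE; ring.
Qed.

Lemma ipZl (c : R) f h : sqi f -> sqi h ->
  ip (fun x => c%:C * f x) h = c * ip f h.
Proof.
move=> sf sh; rewrite /ip -RintegralZl//; last exact: integrable_rdot.
by apply: eq_Rintegral => x _; rewrite /rdot !RIE /=; ring.
Qed.

Lemma ipBl f g h : sqi f -> sqi g -> sqi h ->
  ip (fun x => f x - g x) h = ip f h - ip g h.
Proof.
move=> sf sg sh; rewrite /ip -RintegralB//; try exact: integrable_rdot.
by apply: eq_Rintegral => x _; rewrite /rdot !RIE; ring.
Qed.

Lemma ipDr f g h : sqi f -> sqi g -> sqi h ->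
  ip h (fun x => f x + g x) = ip h f + ip h g.
Proof. by move=> *; rewrite ipC ipDl// !(ipC h). Qed.

Lemma ipBr f g h : sqi f -> sqi g -> sqi h ->
  ip h (fun x => f x - g x) = ip h f - ip h g.
Proof. by move=> *; rewrite ipC ipBl// !(ipC h). Qed.

Lemma ipZr (c : R) f h : sqi f -> sqi h ->
  ip h (fun x => c%:C * f x) = c * ip h f.
Proof. by move=> *; rewrite ipC ipZl// ipC. Qed.

Lemma ip_comb f g (s : R) : sqi f -> sqi g ->
  ip (fun x => f x + s%:C * g x) (fun x => f x + s%:C * g x) =
  ip f f + 2 * s * ip f g + s ^+ 2 * ip g g.
Proof.
move=> sf sg; have sg' := sqiZ s%:C sg.
rewrite ipDl ?ipDr//; try exact: sqiD.
by rewrite !ipZl// !ipZr// (ipC g f); ring.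
Qed.

Lemma cauchy_schwarz f g : sqi f -> sqi g ->
  ip f g ^+ 2 <= ip f f * ip g g.
Proof.
move=> sf sg.
have [g0|g0] := eqVneq (ip g g) 0.
  have H s := ip_ge0 (fun x => f x + s%:C * g x).
  have [->|n0] := eqVneq (ip f g) 0; first by rewrite expr0n g0 mulr0.
  (* With [ip g g = 0] the quadratic is affine in [s], and this [s] would give it the value -1. *)
  have := H (- (ip f f + 1) / (2 * ip f g)); rewrite ip_comb// g0 mulr0 addr0.
  suff -> : 2 * (- (ip f f + 1) / (2 * ip f g)) * ip f g = - (ip f f + 1) by lra.
  by field.
(* This value of [s] minimizes the quadratic. *)
have := ip_ge0 (fun x => f x + (- ip f g / ip g g)%:C * g x).
rewrite ip_comb//; have gp : 0 < ip g g by rewrite lt_neqAle eq_sym g0 ip_ge0.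
have -> : ip f f + 2 * (- ip f g / ip g g) * ip f g + (- ip f g / ip g g) ^+ 2 * ip g g =
  (ip f f * ip g g - ip f g ^+ 2) / ip g g by field.
by rewrite pmulr_lge0 ?invr_gt0// subr_ge0.
Qed.

Definition nrm f : R := Num.sqrt (ip f f).

Lemma nrm_ge0 f : 0 <= nrm f. Proof. exact: sqrtr_ge0. Qed.

Lemma sqr_nrm f : nrm f ^+ 2 = ip f f. Proof. by rewrite sqr_sqrtr// ip_ge0. Qed.

Lemma ler_ip f g : sqi f -> sqi g -> `|ip f g| <= nrm f * nrm g.
Proof.
move=> sf sg; rewrite -(@ler_pXn2r _ 2) ?nnegrE ?mulr_ge0 ?nrm_ge0//.
by rewrite exprMn !sqr_nrm real_normK ?num_real//; exact: cauchy_schwarz.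
Qed.

Lemma nrmD f g : sqi f -> sqi g -> nrm (fun x => f x + g x) <= nrm f + nrm g.
Proof.
move=> sf sg; rewrite -(@ler_pXn2r _ 2) ?nnegrE ?addr_ge0 ?nrm_ge0//.
rewrite sqr_nrm ipDl ?ipDr//; try exact: sqiD.
rewrite sqrrD !sqr_nrm (ipC g f).
by have := ler_ip sf sg; have := ler_norm (ip f g); nra.
Qed.

Lemma nrmB f g : nrm (fun x => f x - g x) = nrm (fun x => g x - f x).
Proof.
by congr Num.sqrt; apply: eq_Rintegral => x _; rewrite /rdot !RIE; ring.
Qed.

End square_integrable.

Lemma cvg_bound_dist (R : realType) (U : Type) (F : set_system U)
    {FF : Filter F} (f e : U -> R) (l : R) :
  (\forall n \near F, `|f n - l| <= e n) -> e n @[n --> F] --> 0 ->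
  f n @[n --> F] --> l.
Proof.
move=> fe e0; apply/cvgrPdist_le => eps eps0.
move/cvgrPdist_le : e0 => /(_ _ eps0); apply: filterS2 fe => n fe.
rewrite sub0r normrN distrC => ee; apply: le_trans fe _.
by apply: le_trans ee; exact: ler_norm.
Qed.

(** * Independence of integrals from the choice of version *)

Section version.
Context d (T : measurableType d) (R : realType).
Variable mu : {measure set T -> \bar R}.
Local Open Scope ereal_scope.
Import HBNNSimple.

(* No measurability is needed: the integral of a nonnegative function is the
   supremum of the integrals of the simple functions below it. *)
Lemma ge0_le_integral_nomeas (f g : T -> \bar R) :
  (forall x, 0 <= f x) -> (forall x, f x <= g x) ->
  \int[mu]_x f x <= \int[mu]_x g x.
Proof.
move=> f0 fg; have g0 x : 0 <= g x by exact: le_trans (f0 x) (fg x).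
rewrite !ge0_integralTE//; apply: ge_ereal_sup => _ [h hf <-].
by apply: ereal_sup_ubound; exists h => // x; exact: le_trans (hf x) (fg x).
Qed.

(** A possibly non-measurable [f] is squeezed between two measurable functions that equal [g] off a
    measurable null set [N]: [lo] is 0 on [N] and [hi] is [+oo] there, and both have the integral of
    [g]. *)
Lemma ge0_integral_version (f g : T -> \bar R) :
  measurable_fun [set: T] g -> (forall x, 0 <= f x) -> (forall x, 0 <= g x) ->
  (\forall x \ae mu, f x = g x) -> \int[mu]_x f x = \int[mu]_x g x.
Proof.
move=> mg f0 g0 [N [mN N0 subN]].
pose lo x := if x \in N then 0 else g x.
pose hi x := if x \in N then +oo else g x.
have mN' : measurable_fun [set: T] (fun x => x \in N).
  apply: (measurable_fun_bool true); rewrite setTI (_ : _ @^-1` _ = N)//.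
    by apply/seteqP; split => x /=; [exact: set_mem|exact: mem_set].
have fgN x : x \notin N -> f x = g x.
  by move=> xN; apply: contrapT => h; move: xN; rewrite notin_setE; apply; exact: subN.
have aeN (h : T -> \bar R) : (forall x, x \notin N -> h x = g x) ->
    ae_eq mu [set: T] h g.
  move=> hN; exists N; split => // x /= h'; apply: contrapT => xN.
  by apply: h' => _; apply: hN; rewrite notin_setE.
have mlo : measurable_fun [set: T] lo by apply: measurable_fun_ifT.
have mhi : measurable_fun [set: T] hi by apply: measurable_fun_ifT.
have lo0 x : 0 <= lo x by rewrite /lo; case: ifP.
have hi0 x : 0 <= hi x by rewrite /hi; case: ifP; rewrite ?leey.
have glo : \int[mu]_x g x = \int[mu]_x lo x.
  apply/esym/ge0_ae_eq_integral => //; apply: aeN => x xN.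
  by rewrite /lo (negbTE xN).
have ghi : \int[mu]_x g x = \int[mu]_x hi x.
  apply/esym/ge0_ae_eq_integral => //; apply: aeN => x xN.
  by rewrite /hi (negbTE xN).
apply/eqP; rewrite eq_le; apply/andP; split.
  rewrite ghi; apply: ge0_le_integral_nomeas => // x.
  by rewrite /hi; case: ifPn => [_|/fgN ->//]; rewrite leey.
rewrite glo; apply: ge0_le_integral_nomeas => // x.
by rewrite /lo; case: ifPn => // /fgN ->.
Qed.

Lemma integral_version (f g : T -> \bar R) : measurable_fun [set: T] g ->
  (\forall x \ae mu, f x = g x) -> \int[mu]_x f x = \int[mu]_x g x.
Proof.
move=> mg fg; rewrite integralE [RHS]integralE; congr (_ - _).
  apply: ge0_integral_version => //; first exact: measurable_funepos.
  by apply: filterS fg => x; rewrite !funeposE => ->.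
apply: ge0_integral_version => //; first exact: measurable_funeneg.
by apply: filterS fg => x; rewrite !funenegE => ->.
Qed.

Lemma Rintegral_version (f g : T -> R) : measurable_fun [set: T] g ->
  (\forall x \ae mu, f x = g x) ->
  Rintegral mu [set: T] f = Rintegral mu [set: T] g.
Proof.
move=> mg fg; congr fine; apply: integral_version.
  by apply/measurable_EFinP.
by apply: filterS fg => x ->.
Qed.

Lemma sqint_version (f g : T -> R[i]) : cmeas g ->
  (\forall x \ae mu, f x = g x) -> sqint mu f = sqint mu g.
Proof.
move=> mg fg; apply: integral_version.
  by apply/measurable_EFinP; exact: measurable_sqr_normc.
by apply: filterS fg => x ->.
Qed.

Lemma ip_version (f f' g g' : T -> R[i]) :
  (\forall x \ae mu, f x = f' x) -> (\forall x \ae mu, g x = g' x) ->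
  cmeas f' -> cmeas g' -> ip mu f g = ip mu f' g'.
Proof.
move=> ff gg mf mg; apply: Rintegral_version; first exact: measurable_rdot.
by apply: filterS2 ff gg => x; rewrite /rdot => -> ->.
Qed.

Lemma nrm_version (f g : T -> R[i]) : cmeas g ->
  (\forall x \ae mu, f x = g x) -> nrm mu f = nrm mu g.
Proof. by move=> mg fg; congr Num.sqrt; exact: ip_version. Qed.

End version.

Section nrm_limits.
Context d (T : measurableType d) (R : realType).
Variable mu : {measure set T -> \bar R}.
Implicit Types f g h : T -> R[i].

Lemma sqi_version f g : cmeas f -> sqi mu g -> (\forall x \ae mu, f x = g x) ->
  sqi mu f.
Proof. by move=> mf [mg gfin] fg; split; rewrite // (sqint_version mg fg). Qed.

Lemma nrm_eq0 f : sqi mu f -> nrm mu f = 0 -> \forall x \ae mu, f x = 0.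
Proof.
move=> sf f0; have ipf : ip mu f f = 0 by rewrite -sqr_nrm f0 expr0n.
have := sqintE sf; rewrite ipf /sqint => H.
have mf : measurable_fun [set: T] (fun x => (normc (f x) ^+ 2)%:E).
  by apply/measurable_EFinP; exact: measurable_sqr_normc sf.1.
have : ae_eq mu [set: T] (fun x => (normc (f x) ^+ 2)%:E) (cst 0%E).
  apply/(ae_eq_integral_abs mu measurableT mf); rewrite -[RHS]H.
  by apply: eq_integral => x _; rewrite gee0_abs// lee_fin sqr_ge0.
apply: filterS => x /(_ I) /= [] /eqP; rewrite sqrf_eq0 => /eqP.
exact: eq0_normc.
Qed.

Lemma nrm_dominated (h : nat -> T -> R[i]) g : (forall n, cmeas (h n)) ->
  sqi mu g -> (forall n x, normc (h n x) ^+ 2 <= normc (g x) ^+ 2) ->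
  (\forall x \ae mu, (fun n => normc (h n x) ^+ 2) @ \oo --> 0) ->
  (fun n => nrm mu (h n)) @ \oo --> 0.
Proof.
move=> mh sg hg h0.
have sh n : sqi mu (h n).
  by apply: (@sqi_le _ _ _ mu _ g 1) => // x; rewrite mul1r.
have m1 n : measurable_fun [set: T] (fun x => (normc (h n x) ^+ 2)%:E).
  by apply/measurable_EFinP; exact: measurable_sqr_normc.
have m2 : {ae mu, forall x, [set: T] x ->
    (fun n => (normc (h n x) ^+ 2)%:E) @ \oo --> 0%E}.
  by apply: filterS h0 => x h0 _; apply: cvg_EFin => //; exact: nearW.
have m3 : {ae mu, forall x n, [set: T] x ->
    (`|(normc (h n x) ^+ 2)%:E| <= (normc (g x) ^+ 2)%:E)%E}.
  by apply: nearW => x n _; rewrite gee0_abs ?lee_fin// sqr_ge0.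
have [_ _] := dominated_convergence measurableT m1 (measurable_cst _) m2
  (sqi_integrable sg) m3.
rewrite integral0 => H.
have {}H : (fun n => ip mu (h n) (h n)) @ \oo --> 0.
  apply: (@fine_cvg _ _ _ _ (fun n => (ip mu (h n) (h n))%:E) 0).
  by under eq_fun do rewrite -(sqintE (sh _)).
rewrite -sqrtr0; apply: (cvg_comp _ _ H); exact: sqrt_continuous.
Qed.

Lemma ip_cvg (f_ : nat -> T -> R[i]) f g : (forall n, sqi mu (f_ n)) ->
  sqi mu f -> sqi mu g -> (fun n => nrm mu (fun x => f_ n x - f x)) @ \oo --> 0 ->
  (fun n => ip mu (f_ n) g) @ \oo --> ip mu f g.
Proof.
move=> sf_ sf sg H.
apply: (@cvg_bound_dist _ _ _ _ _
  (fun n => nrm mu (fun x => f_ n x - f x) * nrm mu g)).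
  apply: nearW => n; rewrite -ipBl//; apply: ler_ip => //; exact: sqiB.
by rewrite -(mul0r (nrm mu g)); exact: cvgMl.
Qed.

Lemma nrm_cvg (f_ : nat -> T -> R[i]) f : (forall n, sqi mu (f_ n)) ->
  sqi mu f -> (fun n => nrm mu (fun x => f_ n x - f x)) @ \oo --> 0 ->
  (fun n => nrm mu (f_ n)) @ \oo --> nrm mu f.
Proof.
move=> sf_ sf H; apply: (cvg_bound_dist _ H); apply: nearW => n.
have h1 := nrmD (sqiB (sf_ n) sf) sf; have h2 := nrmD (sqiB sf (sf_ n)) (sf_ n).
have fK (u v : T -> R[i]) : (fun x => u x - v x + v x) = u.
  by apply/funext => x; rewrite subrK.
rewrite !fK (nrmB _ f) in h1 h2.
by rewrite ler_distl; apply/andP; split; lra.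
Qed.

End nrm_limits.

(** * Restriction to sets, and functions in both L1 and L2 *)

Section restriction.
Context d (T : measurableType d) (R : realType).
Variable mu : {measure set T -> \bar R}.
Implicit Types (f g h : T -> R[i]) (E : set T).

Definition restr E f (x : T) : R[i] := (\1_E x)%:C * f x.

Lemma measurable_cindic E : measurable E -> cmeas (fun x => (\1_E x : R)%:C).
Proof. by move=> mE; apply: cmeasR; exact: measurable_indic. Qed.

Lemma cindic_le1 E (x : T) : normc (\1_E x : R)%:C ^+ 2 <= 1.
Proof.
by rewrite sqr_normcR indicE; case: (_ \in _); rewrite ?expr1n ?expr0n ?ler01.
Qed.

Lemma sqi_restr E f : measurable E -> sqi mu f -> sqi mu (restr E f).
Proof. by move=> mE; apply: sqiM (cindic_le1 E); exact: measurable_cindic. Qed.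

Lemma ip_restrl E f g : ip mu (restr E f) g = ip mu f (restr E g).
Proof.
by apply: eq_Rintegral => x _; rewrite /rdot /restr !RIE /=; ring.
Qed.

Lemma restrK E f : restr E (restr E f) = restr E f.
Proof.
apply/funext => x; rewrite /restr indicE; case: (_ \in _); by rewrite ?mul1r ?mul0r.
Qed.

(** Dominated convergence with bound [g]. Points where [g] vanishes are exempted: for sets defined
    by a comparison with [g] itself, such points may never leave. *)
Lemma nrm_restr_cvg0 (E : nat -> set T) g : (forall n, measurable (E n)) ->
  sqi mu g -> (\forall x \ae mu, g x != 0 -> \forall n \near \oo, ~ E n x) ->
  (fun n => nrm mu (restr (E n) g)) @ \oo --> 0.
Proof.
move=> mE sg H; apply: (nrm_dominated (g := g)) => //.
- by move=> n; apply: (sqi_restr (mE n) sg).1.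
- move=> n x; rewrite sqr_normcM -[leRHS]mul1r ler_wpM2r ?sqr_ge0//.
  exact: cindic_le1.
apply: filterS H => x; have [gx _|gx /(_ isT) H] := eqVneq (g x) 0.
  rewrite (_ : (fun n => _) = cst 0); first exact: cvg_cst.
  by apply/funext => n; rewrite /restr gx mulr0 sqr_normcR expr0n.
apply: (cvg_near_cst (0 : R^o)).
apply: filterS H => n nE; rewrite /restr indicE memNset// mul0r.
by rewrite sqr_normcR expr0n.
Qed.

Lemma nrm_restrC_cvg0 (E : nat -> set T) g : (forall n, measurable (E n)) ->
  sqi mu g -> (\forall x \ae mu, g x != 0 -> \forall n \near \oo, E n x) ->
  (fun n => nrm mu (fun x => restr (E n) g x - g x)) @ \oo --> 0.
Proof.
move=> mE sg H; have := @nrm_restr_cvg0 (fun n => ~` E n) g _ sg _.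
have e n : (fun x => restr (E n) g x - g x) =
    (fun x => (-1) * restr (~` E n) g x).
  apply/funext => x; rewrite /restr !indicE in_setC; case: (_ \in _) => /=.
    by rewrite mul1r mul0r mulr0 subrr.
  by rewrite mul1r mul0r mulN1r sub0r.
under [in X in _ -> X]eq_fun => n.
  rewrite e (_ : nrm _ _ = nrm mu (restr (~` E n) g)); last first.
    by congr Num.sqrt; apply: eq_Rintegral => x _; rewrite /rdot !RIE /=; ring.
  over.
apply; first by move=> n; exact: measurableC.
by apply: filterS H => x H /H; apply: filterS => n En; exact.
Qed.

Definition cint1 f :=
  mu.-integrable [set: T] (fun x => (Re (f x))%:E) /\
  mu.-integrable [set: T] (fun x => (Im (f x))%:E).

Definition L12 f := sqi mu f /\ cint1 f.

Lemma integrable_indic_fin E : measurable E -> (mu E < +oo)%E ->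
  mu.-integrable [set: T] (fun x => (\1_E x : R)%:E).
Proof.
move=> mE Efin; apply/integrableP; split.
  by apply/measurable_EFinP; exact: measurable_indic.
under eq_integral do rewrite gee0_abs ?lee_fin//.
by rewrite integral_indic// setIT.
Qed.

(** On a set of finite measure square integrability implies integrability, since [|b| <= b^2 + 1]
    and the indicator is integrable. *)
Lemma cint1_restr E f : measurable E -> (mu E < +oo)%E -> sqi mu f ->
  cint1 (restr E f).
Proof.
move=> mE Efin sf; have [mr mi] := (sqi_restr mE sf).1.
have iE : mu.-integrable [set: T] (fun x => (\1_E x : R)%:E).
  exact: integrable_indic_fin.
have iD := integrableD measurableT (sqi_integrable sf) iE.
have le01 (r b : R) : `|b| <= r ^+ 2 + b ^+ 2 + 1 by rewrite ler_norml; nra.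
split; apply: le_integrable iD => //; try by apply/measurable_EFinP.
- move=> x _ /=; rewrite lee_fin [leRHS]ger0_norm ?addr_ge0 ?sqr_ge0 ?indicE//.
  rewrite /restr indicE cReM /= mul0r subr0; case: (_ \in _).
    by rewrite mul1r sqr_normc [X in _ <= X + _]addrC; apply: le01.
  by rewrite mul0r normr0 addr0 sqr_ge0.
- move=> x _ /=; rewrite lee_fin [leRHS]ger0_norm ?addr_ge0 ?sqr_ge0 ?indicE//.
  rewrite /restr indicE cImM /= mul0r addr0; case: (_ \in _).
    by rewrite mul1r sqr_normc; apply: le01.
  by rewrite mul0r normr0 addr0 sqr_ge0.
Qed.

Lemma L12_restr E f : measurable E -> (mu E < +oo)%E -> sqi mu f -> L12 (restr E f).
Proof.
by move=> mE Efin sf; split; [exact: sqi_restr|exact: cint1_restr].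
Qed.

End restriction.

Section plancherel_defs.
Context {R : realType} {N : nat}.
Local Notation V := (Rn R N).
Local Notation mu := (lebesgueN R N).
Implicit Types f g : V -> R[i].

Lemma L2normE f : L2norm f = (sqint mu f `^ 2^-1)%E.
Proof.
rewrite /L2norm unlock; congr (_ `^ _)%E; apply: eq_integral => x _ /=.
by rewrite powR_mulrn// ger0_norm// normc_ge0.
Qed.

Lemma L2norm_sqi f : sqi mu f -> L2norm f = (nrm mu f)%:E.
Proof.
by move=> sf; rewrite L2normE (sqintE sf) poweR_EFin powR12_sqrt// ip_ge0.
Qed.

Lemma L2norm_version f g : cmeas g -> (\forall x \ae mu, f x = g x) ->
  L2norm f = L2norm g.
Proof. by move=> mg fg; rewrite !L2normE (sqint_version mg fg). Qed.

Lemma L2_version f : L2 f -> exists2 g, sqi mu g & \forall x \ae mu, f x = g x.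
Proof.
move=> [g [mg gfin fg]]; exists g => //; split => //.
move: gfin; rewrite L2normE ltNge leye_eq.
case: (sqint _ _) (sqint_ge0 mu g) => [r _ _|_|//]; first by rewrite ltry.
by rewrite poweRyr ?invr_eq0// eqxx.
Qed.

Lemma L2_cvg_version (u_ : nat -> V -> R[i]) f g : (forall n, sqi mu (u_ n)) -> sqi mu g ->
  (\forall x \ae mu, f x = g x) -> L2_cvg u_ f ->
  (fun n => nrm mu (fun x => u_ n x - g x)) @ \oo --> 0.
Proof.
move=> su sg fg; rewrite /L2_cvg => H.
apply: (@fine_cvg _ _ _ _ (fun n => (nrm mu (fun x => u_ n x - g x))%:E) 0).
apply: cvg_trans H; apply: near_eq_cvg; apply: nearW => n /=.
rewrite -L2norm_sqi; last exact: sqiB.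
apply: L2norm_version; first exact: (sqiB (su n) sg).1.
by apply: filterS fg => x ->.
Qed.

End plancherel_defs.

(** * Exponential weights and Poisson kernels *)

Section one_dimensional_integrals.
Context {R : realType}.
Local Notation leb := (@lebesgue_measure R).
Implicit Types (a b x y : R) (f : R -> R).

Lemma ge0_integralT_split f : (forall x, 0 <= f x) -> continuous f ->
  (\int[leb]_x (f x)%:E = \int[leb]_(x in `[0%R, +oo[) (f x)%:E +
    \int[leb]_(x in `[0%R, +oo[) (f (- x))%:E)%E.
Proof.
move=> f0 cf.
have mf : measurable_fun [set: R] f by exact: continuous_measurable_fun.
have -> : [set: R] = `[(0 : R), +oo[%classic `|` `]-oo, (0 : R)[%classic.
  by apply/seteqP; split => x //= _; rewrite !in_itv/= andbT; case: leP; [left|right].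
rewrite ge0_integral_setU//=; last 3 first.
- by apply/measurable_EFinP; exact: measurable_funTS.
- by move=> x _; rewrite lee_fin.
- by apply/disj_setPS => x /= []; rewrite !in_itv/= andbT leNgt => /negP.
congr (_ + _)%E; rewrite integral_itv_bndo_bndc.
  rewrite -{1}oppr0 ge0_integration_by_substitutionNy//.
  exact: continuous_subspaceT.
by apply/measurable_EFinP; exact: measurable_funTS.
Qed.

Lemma ge0_FTC_half f (F : R -> R) (l : R) : (forall x, 0 <= f x) ->
  continuous f -> (forall x : R, is_derive x 1 F (f x)) ->
  F x @[x --> +oo] --> l ->
  (\int[leb]_(x in `[0%R, +oo[) (f x)%:E = (l - F 0)%:E)%E.
Proof.
move=> f0 cf dF Fl; rewrite (@ge0_continuous_FTC2y _ _ F 0 l)//.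
- exact: continuous_subspaceT.
- apply: cvg_at_right_filter; apply: differentiable_continuous.
  by apply/derivable1_diffP; case: (dF 0).
- by move=> x _; rewrite derive1E; case: (dF x).
Qed.

Lemma cvgy_expNM a : 0 < a -> expR (- (a * x)) @[x --> +oo] --> 0.
Proof.
move=> a0; apply: (@cvg_comp _ _ _ (fun x => a * x) (fun x => expR (- x)) _ +oo).
  exact: gt0_cvgMry.
exact: cvgr_expR.
Qed.

Lemma continuous_expNM a : continuous (fun x => expR (- (a * x))).
Proof.
move=> x; apply: (@continuous_comp _ _ _ (fun x => - (a * x)) expR).
  by apply: continuousN; apply: mulrl_continuous.
exact: continuous_expR.
Qed.

Lemma continuous_expNM_norm a : continuous (fun x => expR (- (a * `|x|))).
Proof.
move=> x; apply: (@continuous_comp R R R (fun y : R => `|y|) (fun y => expR (- (a * y)))).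
  exact: norm_continuous.
exact: continuous_expNM.
Qed.

Lemma continuous_cosM b : continuous (fun x => cos (b * x)).
Proof.
move=> x; apply: (@continuous_comp _ _ _ (fun x => b * x) cos).
  exact: mulrl_continuous.
exact: continuous_cos.
Qed.

Lemma continuous_sinM b : continuous (fun x => sin (b * x)).
Proof.
move=> x; apply: (@continuous_comp _ _ _ (fun x => b * x) sin).
  exact: mulrl_continuous.
exact: continuous_sin.
Qed.

(** The summand 1 keeps the integrand nonnegative, as the fundamental theorem on a half-line is
    applied to nonnegative functions; its contribution [a^-1] is subtracted afterwards. [F] is the
    antiderivative that vanishes at infinity. *)
Lemma integral_half_exp_cos a b : 0 < a ->
  (\int[leb]_(x in `[0%R, +oo[) (expR (- (a * x)) * (1 + cos (b * x)))%:E =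
   (a^-1 + a / (a ^+ 2 + b ^+ 2))%:E)%E.
Proof.
move=> a0; have ab0 : a ^+ 2 + b ^+ 2 != 0.
  by rewrite gt_eqF// ltr_pwDl ?exprn_gt0// sqr_ge0.
pose F x := expR (- (a * x)) *
  ((b * sin (b * x) - a * cos (b * x)) / (a ^+ 2 + b ^+ 2) - a^-1).
rewrite (_ : a^-1 + _ = 0 - F 0); last first.
  rewrite /F !mulr0 oppr0 expR0 sin0 cos0.
  by field; rewrite ab0 gt_eqF.
apply: (@ge0_FTC_half _ F).
- by move=> x; rewrite mulr_ge0 ?expR_ge0// -lerBlDl sub0r cos_geN1.
- move=> x; apply: cvgM; first exact: continuous_expNM.
  by apply: cvgD; [exact: cvg_cst|exact: continuous_cosM].
- move=> x.
  have h1 : is_derive x (1:R) (fun x : R => - (a * x)) (- a).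
    by apply: is_derive_eq; rewrite ?scaler0 ?addr0 /GRing.scale/= mulr1.
  have h2 := @is_derive1_comp _ expR (fun x : R => - (a * x)) x _ _
    (is_derive_expR _) h1.
  rewrite /F; apply: is_derive_eq.
  rewrite /GRing.scale /=; field; rewrite ab0 gt_eqF//.
- apply: (@cvg_bound_dist _ _ _ _ _
    (fun x => expR (- (a * x)) * ((`|b| + `|a|) / (a ^+ 2 + b ^+ 2) + a^-1))).
    apply: nearW => x; rewrite subr0 normrM ger0_norm ?expR_ge0//.
    rewrite ler_wpM2l ?expR_ge0// (le_trans (ler_normB _ _))//.
    apply: lerD; last by rewrite ger0_norm ?invr_ge0// ltW.
    rewrite normrM [X in _ * X]ger0_norm ?invr_ge0 ?addr_ge0 ?sqr_ge0//.
    rewrite ler_wpM2r ?invr_ge0 ?addr_ge0 ?sqr_ge0//.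
    rewrite (le_trans (ler_normB _ _))// !normrM lerD// ler_piMr//.
      by rewrite ler_norml sin_geN1 sin_le1.
    by rewrite ler_norml cos_geN1 cos_le1.
  by rewrite -[X in _ --> X](mul0r ((`|b| + `|a|) / (a ^+ 2 + b ^+ 2) + a^-1));
    apply: cvgMl; exact: cvgy_expNM.
Qed.

Lemma integral_half_exp a : 0 < a ->
  (\int[leb]_(x in `[0%R, +oo[) (expR (- (a * x)))%:E = (a^-1)%:E)%E.
Proof.
move=> a0.
pose F x := - (a^-1 * expR (- (a * x))).
rewrite (_ : a^-1 = 0 - F 0); last first.
  by rewrite /F mulr0 oppr0 expR0 mulr1 sub0r opprK.
apply: (@ge0_FTC_half _ F).
- by move=> x; exact: expR_ge0.
- exact: continuous_expNM.
- move=> x.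
  have h1 : is_derive x (1:R) (fun x : R => - (a * x)) (- a).
    by apply: is_derive_eq; rewrite ?scaler0 ?addr0 /GRing.scale/= mulr1.
  have h2 := @is_derive1_comp _ expR (fun x : R => - (a * x)) x _ _
    (is_derive_expR _) h1.
  rewrite /F; apply: is_derive_eq.
  by rewrite /GRing.scale /=; field; rewrite gt_eqF.
- rewrite -oppr0; apply: cvgN; rewrite -[X in _ --> X](mulr0 a^-1).
  by apply: cvgMr; exact: cvgy_expNM.
Qed.

Definition phi1 a x := expR (- (a * `|x|)).

Lemma integrable_ge0 f (r : R) : continuous f -> (forall x, 0 <= f x) ->
  (\int[leb]_x (f x)%:E = r%:E)%E -> leb.-integrable setT (EFin \o f).
Proof.
move=> cf f0 fr; apply/integrableP; split.
  by apply/measurable_EFinP; exact: continuous_measurable_fun.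
under eq_integral do rewrite /= ger0_norm//.
by rewrite fr ltry.
Qed.

Lemma integral_phi1 a : 0 < a -> (\int[leb]_x (phi1 a x)%:E = (2 / a)%:E)%E.
Proof.
move=> a0; rewrite ge0_integralT_split; last 2 first.
- by move=> x; exact: expR_ge0.
- exact: continuous_expNM_norm.
have e : (\int[leb]_(x in `[0%R, +oo[) (phi1 a x)%:E = (a^-1)%:E)%E.
  rewrite -integral_half_exp//; apply: eq_integral => x.
  by rewrite inE/= in_itv/= andbT => x0; rewrite /phi1 ger0_norm.
under [in X in (_ + X)%E]eq_integral do rewrite /phi1 normrN.
by rewrite e -EFinD; congr EFin; field; rewrite gt_eqF.
Qed.

Lemma integrable_phi1 a : 0 < a -> leb.-integrable setT (EFin \o phi1 a).
Proof.
move=> a0; apply: (integrable_ge0 _ _ (integral_phi1 a0)).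
  exact: continuous_expNM_norm.
by move=> x; exact: expR_ge0.
Qed.

Lemma integral_phi1_cos a b : 0 < a ->
  (\int[leb]_x (phi1 a x * (1 + cos (b * x)))%:E =
    (2 / a + 2 * a / (a ^+ 2 + b ^+ 2))%:E)%E.
Proof.
move=> a0; have ab0 : a ^+ 2 + b ^+ 2 != 0.
  by rewrite gt_eqF// ltr_pwDl ?exprn_gt0// sqr_ge0.
rewrite (@ge0_integralT_split (fun x => phi1 a x * (1 + cos (b * x)))).
- under [in X in (_ + X)%E]eq_integral do rewrite /phi1 normrN mulrN cosN.
  have e : (\int[leb]_(x in `[0%R, +oo[) (phi1 a x * (1 + cos (b * x)))%:E =
      (a^-1 + a / (a ^+ 2 + b ^+ 2))%:E)%E.
    rewrite -integral_half_exp_cos//; apply: eq_integral => x.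
    by rewrite inE/= in_itv/= andbT => x0; rewrite /phi1 ger0_norm.
  by rewrite e -EFinD; congr EFin; field; rewrite ab0 gt_eqF.
- by move=> x; rewrite mulr_ge0 ?expR_ge0// -lerBlDl sub0r cos_geN1.
- move=> x; apply: cvgM; first exact: continuous_expNM_norm.
  by apply: cvgD; [exact: cvg_cst|exact: continuous_cosM].
Qed.

(** Folding the negative half-line onto the positive one cancels the sines, so that only the plain
    exponential has to be integrated. *)
Lemma integral_phi1_sin a b : 0 < a ->
  (\int[leb]_x (phi1 a x * (1 + sin (b * x)))%:E = (2 / a)%:E)%E.
Proof.
move=> a0.
have g0 (s : R) x : 0 <= expR (- (a * x)) * (1 + sin (s * x)).
  by rewrite mulr_ge0 ?expR_ge0// -lerBlDl sub0r sin_geN1.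
have cg (s : R) : continuous (fun x => expR (- (a * x)) * (1 + sin (s * x))).
  move=> x; apply: cvgM; first exact: continuous_expNM.
  by apply: cvgD; [exact: cvg_cst|exact: continuous_sinM].
have mg (s : R) (D : set R) : measurable_fun D
    (fun x => (expR (- (a * x)) * (1 + sin (s * x)))%:E).
  apply/measurable_EFinP; apply: measurable_funTS.
  by apply: continuous_measurable_fun; exact: cg.
have e (s : R) : (\int[leb]_(x in `[0%R, +oo[) (phi1 a x * (1 + sin (s * x)))%:E =
    \int[leb]_(x in `[0%R, +oo[) (expR (- (a * x)) * (1 + sin (s * x)))%:E)%E.
  apply: eq_integral => x.
  by rewrite inE/= in_itv/= andbT => x0; rewrite /phi1 ger0_norm.
rewrite (@ge0_integralT_split (fun x => phi1 a x * (1 + sin (b * x)))).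
- under [in X in (_ + X)%E]eq_integral do rewrite /phi1 normrN mulrN -mulNr.
  rewrite !e -ge0_integralD//.
  + transitivity (\int[leb]_(x in `[0%R, +oo[) (2%:E * (expR (- (a * x)))%:E))%E.
      by apply: eq_integral => x _; rewrite -EFinD -EFinM mulNr sinN; congr EFin; ring.
    rewrite ge0_integralZl//; first by rewrite integral_half_exp.
      apply/measurable_EFinP; apply: measurable_funTS.
      by apply: continuous_measurable_fun; exact: continuous_expNM.
  + exact: mg.
  + exact: mg.
- by move=> x; rewrite mulr_ge0 ?expR_ge0// -lerBlDl sub0r sin_geN1.
- move=> x; apply: cvgM; first exact: continuous_expNM_norm.
  by apply: cvgD; [exact: cvg_cst|exact: continuous_sinM].
Qed.

(** The summand 1 is removed here: [2 / a] is the integral of [phi1 a]. *)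
Lemma Rintegral_phi1_sub f (r : R) a : 0 < a -> continuous f ->
  (forall x, -1 <= f x) ->
  (\int[leb]_x (phi1 a x * (1 + f x))%:E = r%:E)%E ->
  Rintegral leb setT (fun x => phi1 a x * f x) = r - 2 / a.
Proof.
move=> a0 cf f1 fr.
have i : leb.-integrable setT (EFin \o (fun x => phi1 a x * (1 + f x))).
  apply: (integrable_ge0 _ _ fr) => x.
    apply: cvgM; first exact: continuous_expNM_norm.
    by apply: cvgD; [exact: cvg_cst|exact: cf].
  by rewrite mulr_ge0 ?expR_ge0// -lerBlDl sub0r.
rewrite (_ : 2 / a = Rintegral leb setT (phi1 a)); last first.
  by rewrite /Rintegral integral_phi1.
rewrite (_ : r = Rintegral leb setT (fun x => phi1 a x * (1 + f x))); last first.
  by rewrite /Rintegral fr.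
rewrite -RintegralB//; last exact: integrable_phi1.
by apply: eq_Rintegral => x _; rewrite mulrDr mulr1 addrAC subrr add0r.
Qed.

Lemma Rintegral_phi1_cos a b : 0 < a ->
  Rintegral leb setT (fun x => phi1 a x * cos (b * x)) =
  2 * a / (a ^+ 2 + b ^+ 2).
Proof.
move=> a0; rewrite (Rintegral_phi1_sub a0 _ _ (integral_phi1_cos b a0)).
- by rewrite addrAC subrr add0r.
- exact: continuous_cosM.
- by move=> x; exact: cos_geN1.
Qed.

Lemma Rintegral_phi1_sin a b : 0 < a ->
  Rintegral leb setT (fun x => phi1 a x * sin (b * x)) = 0.
Proof.
move=> a0; rewrite (Rintegral_phi1_sub a0 _ _ (integral_phi1_sin b a0)).
- by rewrite subrr.
- exact: continuous_sinM.
- by move=> x; exact: sin_geN1.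
Qed.

(* The Fourier transform of [phi1 a]. *)
Definition pois1 a x := 2 * a / (a ^+ 2 + (2 * pi * x) ^+ 2).

Lemma pois1_den_gt0 a x : 0 < a -> 0 < a ^+ 2 + (2 * pi * x) ^+ 2.
Proof. by move=> a0; rewrite ltr_pwDl ?exprn_gt0// sqr_ge0. Qed.

Lemma pois1_ge0 a x : 0 < a -> 0 <= pois1 a x.
Proof.
by move=> a0; rewrite /pois1 mulr_ge0 ?invr_ge0 1?ltW// ?pois1_den_gt0// mulr_gt0.
Qed.

Lemma is_derive_pois1 a x y : 0 < a ->
  is_derive y 1 (fun y => pi^-1 * atan (2 * pi / a * (y - x))) (pois1 a (x - y)).
Proof.
move=> a0.
have h1 : is_derive y (1:R) (fun y : R => 2 * pi / a * (y - x)) (2 * pi / a).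
  by apply: is_derive_eq; rewrite ?scaler0 ?addr0 /GRing.scale/= subr0 mulr1.
have h2 := @is_derive1_comp _ atan (fun y : R => 2 * pi / a * (y - x)) y _ _
    (is_derive1_atan _) h1.
apply: is_derive_eq; rewrite /GRing.scale /= /pois1.
have /lt0r_neq0 h0 := @pois1_den_gt0 a (x - y) a0.
have p0 : pi != 0 :> R by rewrite gt_eqF// pi_gt0.
move: {h1 h2} h0 p0; move: pi => p h0 p0.
by field; rewrite h0 p0 gt_eqF.
Qed.

Lemma continuous_pois1 a : 0 < a -> continuous (pois1 a).
Proof.
move=> a0 x; apply: cvgM; first exact: cvg_cst.
apply: cvgV; first by rewrite gt_eqF// pois1_den_gt0.
apply: cvgD; first exact: cvg_cst.
by rewrite expr2; under eq_fun do rewrite expr2; apply: cvgM; exact: mulrl_continuous.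
Qed.

Lemma continuous_pois1B a x : 0 < a -> continuous (fun y => pois1 a (x - y)).
Proof.
move=> a0 y; apply: (@continuous_comp R R R (fun y => x - y) (pois1 a)).
  by apply: cvgB; [exact: cvg_cst|exact: cvg_id].
exact: continuous_pois1.
Qed.

Lemma pois1N a x : pois1 a (- x) = pois1 a x.
Proof. by rewrite /pois1 mulrN sqrrN. Qed.

Lemma cvgy_poisF a x : 0 < a ->
  pi^-1 * atan (2 * pi / a * (y - x)) @[y --> +oo] --> (2^-1 : R).
Proof.
move=> a0.
rewrite [X in _ --> X](_ : _ = pi^-1 * (pi / 2)); last first.
  by rewrite mulrA mulVf ?mul1r// gt_eqF// pi_gt0.
apply: cvgMr; apply: cvg_comp; last exact: cvgy_atan.
apply: gt0_cvgMry; first by rewrite divr_gt0// mulr_gt0// pi_gt0.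
exact: cvg_addrr.
Qed.

(** The line is split at 0. Reflecting the negative half replaces the centre [x] by [- x], so the
    arctangents at the cut are opposite and each half leaves [1 / 2], the limit at infinity. *)
Lemma integral_pois1 a x : 0 < a -> (\int[leb]_y (pois1 a (x - y))%:E = 1)%E.
Proof.
move=> a0; rewrite (@ge0_integralT_split (fun y => pois1 a (x - y))); last 2 first.
- by move=> y; exact: pois1_ge0.
- exact: continuous_pois1B.
have H z : (\int[leb]_(y in `[0%R, +oo[) (pois1 a (z - y))%:E =
    (2^-1 - pi^-1 * atan (2 * pi / a * (0 - z)))%:E)%E.
  apply: (@ge0_FTC_half _ (fun y => pi^-1 * atan (2 * pi / a * (y - z)))).
  - by move=> y; exact: pois1_ge0.
  - exact: continuous_pois1B.
  - by move=> y; exact: is_derive_pois1.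
  - exact: cvgy_poisF.
rewrite H; have {}H := H (- x).
rewrite (_ : (\int[leb]_(y in `[0%R, +oo[) (pois1 a (x - - y))%:E)%E =
    (\int[leb]_(y in `[0%R, +oo[) (pois1 a (- x - y))%:E)%E); last first.
  by apply: eq_integral => y _; rewrite -pois1N opprB addrC.
rewrite H -EFinD !sub0r opprK mulrN atanN; congr EFin.
by rewrite mulrN opprK; move: (pi^-1 * _) => A; lra.
Qed.

Lemma integral_pois1_itv a x (l r : R) : 0 < a -> l < r ->
  (\int[leb]_(y in `]l, r[) (pois1 a (x - y))%:E =
   (pi^-1 * atan (2 * pi / a * (r - x)) - pi^-1 * atan (2 * pi / a * (l - x)))%:E)%E.
Proof.
move=> a0 lr.
have mp (D : set R) : measurable_fun D (fun y => (pois1 a (x - y))%:E).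
  apply/measurable_EFinP; apply: measurable_funTS.
  by apply: continuous_measurable_fun; exact: continuous_pois1B.
rewrite integral_itv_obnd_cbnd// integral_itv_bndo_bndc//.
rewrite (@continuous_FTC2 _ _ (fun y => pi^-1 * atan (2 * pi / a * (y - x))))//.
- by apply: continuous_subspaceT; exact: continuous_pois1B.
- have cF z : {for z, continuous (fun y => pi^-1 * atan (2 * pi / a * (y - x)))}.
    apply: differentiable_continuous; apply/derivable1_diffP.
    by case: (is_derive_pois1 x z a0).
  split.
  + by move=> z _; case: (is_derive_pois1 x z a0).
  + by apply: cvg_at_right_filter; exact: cF.
  + by apply: cvg_at_left_filter; exact: cF.
- by move=> y _; rewrite derive1E; case: (is_derive_pois1 x y a0).
Qed.

End one_dimensional_integrals.

(** * Iterated integrals and product functions *)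

Section fubini.
Context d1 d2 (T1 : measurableType d1) (T2 : measurableType d2) (R : realType).
Variables (m1 : {sigma_finite_measure set T1 -> \bar R})
  (m2 : {sigma_finite_measure set T2 -> \bar R}).
Implicit Types (h : T1 * T2 -> R) (p : T1 -> R) (q : T2 -> R).

(** No integrability is assumed: the integrals of the positive and negative parts are measurable by
    Tonelli, and so is [fine] of their difference. *)
Lemma measurable_Rintegral_section h : measurable_fun setT h ->
  measurable_fun setT (fun x => Rintegral m2 setT (fun y => h (x, y))).
Proof.
move=> mh; have mH : measurable_fun setT (EFin \o h) by apply/measurable_EFinP.
have -> : (fun x => Rintegral m2 setT (fun y => h (x, y))) =
    (fun x => fine (\int[m2]_y ((EFin \o h)^\+ (x, y)) -
                    \int[m2]_y ((EFin \o h)^\- (x, y)))%E).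
  apply/funext => x; rewrite /Rintegral integralE.
  by congr (fine (_ - _)%E); apply: eq_integral => y _; rewrite ?funeposE ?funenegE.
apply: (measurableT_comp (fine_measurable measurableT)).
apply: emeasurable_funB.
  apply: (@measurable_fun_fubini_tonelli_F _ _ _ _ _ m2 (EFin \o h)^\+%E) => //.
  exact: measurable_funepos.
apply: (@measurable_fun_fubini_tonelli_F _ _ _ _ _ m2 (EFin \o h)^\-%E) => //.
exact: measurable_funeneg.
Qed.

(** Integrability is asked of every section, not of almost every one, so that all inner integrals
    are finite and [fine] can be taken inside. *)
Lemma Rintegral_Fubini h :
  (m1 \x m2)%E.-integrable setT (EFin \o h) ->
  (forall x, m2.-integrable setT (fun y => (h (x, y))%:E)) ->
  (forall y, m1.-integrable setT (fun x => (h (x, y))%:E)) ->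
  Rintegral m1 setT (fun x => Rintegral m2 setT (fun y => h (x, y))) =
  Rintegral m2 setT (fun y => Rintegral m1 setT (fun x => h (x, y))).
Proof.
move=> ih i2 i1; congr fine.
transitivity (\int[m1]_x \int[m2]_y (h (x, y))%:E)%E.
  apply: eq_integral => x _; rewrite /Rintegral fineK//.
  exact: (integrable_fin_num measurableT (i2 x)).
rewrite (Fubini ih); apply: eq_integral => y _; rewrite /Rintegral fineK//.
exact: (integrable_fin_num measurableT (i1 y)).
Qed.

Lemma integrable_tensor p q : m1.-integrable setT (EFin \o p) ->
  m2.-integrable setT (EFin \o q) ->
  (m1 \x m2)%E.-integrable setT (fun z => (p z.1 * q z.2)%:E).
Proof.
move=> ip1 iq; have /measurable_EFinP mp := measurable_int _ ip1.
have /measurable_EFinP mq := measurable_int _ iq.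
apply/integrable12ltyP.
  apply/measurable_EFinP; apply: measurable_funM.
    exact: measurableT_comp.
  exact: measurableT_comp.
rewrite (eq_integral (fun x => (`|(p x)%:E| * \int[m2]_y `|(q y)%:E|)%E)).
  rewrite ge0_integralZr//.
  - case/integrableP : ip1 => _ ip1; case/integrableP : iq => _ iq.
    rewrite lte_mul_pinfty// ?integral_ge0//.
    by rewrite ge0_fin_numE// integral_ge0.
  - by do 2 apply: measurableT_comp => //.
  - by rewrite integral_ge0.
move=> x _; rewrite -ge0_integralZl//; last by do 2 apply: measurableT_comp => //.
by apply: eq_integral => y _; rewrite /= normrM EFinM.
Qed.

End fubini.

Section lebesgueN_cons.
Context {R : realType} (n : nat).
Local Notation leb := (@lebesgue_measure R).
Local Notation mu := (lebesgueN R n).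
Local Notation muS := (lebesgueN R n.+1).

Lemma ge0_integral_lebesgueNS (f : Rn R n.+1 -> \bar R) :
  measurable_fun setT f -> (forall x, (0 <= f x)%E) ->
  (\int[muS]_x f x = \int[leb]_t \int[mu]_y f (cons_pair (t, y)))%E.
Proof.
move=> mf f0.
have mc := @measurable_cons_pair _ (measurableTypeR R) n.
rewrite (_ : (\int[muS]_x f x)%E = (\int[(leb \x mu)]_z f (cons_pair z))%E).
  rewrite fubini_tonelli1//.
  exact: measurableT_comp.
rewrite (@ge0_integral_pushforward _ _ _ _ _ _ mc (leb \x mu)%E setT f)//.
Qed.

Lemma Rintegral_lebesgueNS (f : Rn R n.+1 -> R) :
  muS.-integrable setT (EFin \o f) ->
  (forall t, mu.-integrable setT (fun y => (f (cons_pair (t, y)))%:E)) ->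
  Rintegral muS setT f =
  Rintegral leb setT (fun t => Rintegral mu setT (fun y => f (cons_pair (t, y)))).
Proof.
move=> ifS it; have mc := @measurable_cons_pair _ (measurableTypeR R) n.
have mf := measurable_int _ ifS.
have ic : (leb \x mu)%E.-integrable setT (fun z => (f (cons_pair z))%:E).
  apply/integrableP; split; first exact: (measurableT_comp mf mc).
  case/integrableP : ifS => _; apply: le_lt_trans.
  have mabs : measurable_fun setT (fun x => `|(EFin \o f) x|%E).
    exact: measurableT_comp.
  rewrite (ge0_integral_lebesgueNS mabs)// fubini_tonelli1//.
  exact: (measurableT_comp mabs mc).
congr fine; transitivity (\int[(leb \x mu)]_z (f (cons_pair z))%:E)%E.
  exact: (@integral_pushforward _ _ _ _ _ _ mc (leb \x mu)%E setT (EFin \o f)).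
rewrite -(integral12_prod_meas1 ic); apply: eq_integral => t _.
rewrite /fubini_F /Rintegral fineK//.
exact: (integrable_fin_num measurableT (it t)).
Qed.

End lebesgueN_cons.

Section tensor.
Context {R : realType}.
Local Notation leb := (@lebesgue_measure R).
Implicit Types n : nat.

Lemma measurable_tensor n (F : 'I_n -> R -> R) :
  (forall i, measurable_fun setT (F i)) ->
  measurable_fun setT (fun x : Rn R n => \prod_(i < n) F i (tnth x i)).
Proof.
move=> mF; apply: measurable_prod => i _.
by apply: (measurableT_comp (mF i)); exact: measurable_tnth.
Qed.

Lemma prod_tnth_cons n (F : 'I_n.+1 -> R -> R) t (y : Rn R n) :
  \prod_(i < n.+1) F i (tnth (cons_pair (t, y)) i) =
  F ord0 t * \prod_(i < n) F (lift ord0 i) (tnth y i).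
Proof.
rewrite big_ord_recl; congr (F ord0 _ * _).
by apply: eq_bigr => i _; rewrite tnthS.
Qed.

Lemma Rintegral_lebesgueN0 (f : Rn R 0 -> R) : measurable_fun setT f ->
  Rintegral (lebesgueN R 0) setT f = f [tuple].
Proof.
move=> mf; rewrite /Rintegral /lebesgueN /= integral_dirac//=; last first.
  exact/measurable_EFinP.
by rewrite indicT mul1r.
Qed.

Lemma integral_tensor n (F : 'I_n -> R -> R) (c : 'I_n -> R) :
  (forall i, measurable_fun setT (F i)) -> (forall i x, 0 <= F i x) ->
  (forall i, \int[leb]_x (F i x)%:E = (c i)%:E)%E ->
  (\int[lebesgueN R n]_x (\prod_(i < n) F i (tnth x i))%:E =
   (\prod_(i < n) c i)%:E)%E.
Proof.
elim: n F c => [|n IH] F c mF F0 Fc.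
  rewrite big_ord0; under eq_integral do rewrite big_ord0.
  by rewrite /lebesgueN /= integral_dirac//= diracT mul1e.
rewrite ge0_integral_lebesgueNS; last 2 first.
- by apply/measurable_EFinP; exact: measurable_tensor.
- by move=> x; rewrite lee_fin prodr_ge0.
transitivity (\int[leb]_t ((F ord0 t)%:E *
    (\prod_(i < n) c (lift ord0 i))%:E))%E.
  apply: eq_integral => t _; under eq_integral do rewrite prod_tnth_cons EFinM.
  rewrite ge0_integralZl//.
  - by rewrite (IH (fun i => F (lift ord0 i)) (fun i => c (lift ord0 i))).
  - apply/measurable_EFinP.
    by apply: (@measurable_tensor _ (fun i => F (lift ord0 i))).
  - by move=> x _; rewrite lee_fin prodr_ge0.
  - by rewrite lee_fin.
rewrite ge0_integralZr//.
- by rewrite Fc big_ord_recl.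
- by apply/measurable_EFinP; exact: mF.
- by move=> x _; rewrite lee_fin.
- rewrite lee_fin prodr_ge0// => i _.
  by rewrite -lee_fin -Fc integral_ge0// => x _; rewrite lee_fin.
Qed.

End tensor.

Section gauge.
Context {R : realType}.
Local Notation leb := (@lebesgue_measure R).
Implicit Types (n : nat) (a c : R).

Definition phiN n a (x : Rn R n) : R := \prod_(i < n) phi1 a (tnth x i).

(** The argument is a family of coordinates rather than a tuple: it is used with differences
    [x_i - y_i] and, in inductions, with the tail of a family. *)
Definition poisN n a (z : 'I_n -> R) : R := \prod_(i < n) pois1 a (z i).

Lemma phi1_ge0 a x : 0 <= phi1 a x. Proof. exact: expR_ge0. Qed.

Lemma phi1_le1 a x : 0 <= a -> phi1 a x <= 1.
Proof. by move=> a0; rewrite -expR0 ler_expR oppr_le0 mulr_ge0. Qed.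

Lemma measurable_phi1 a : measurable_fun setT (phi1 a).
Proof. by apply: continuous_measurable_fun; exact: continuous_expNM_norm. Qed.

Lemma phiN_ge0 n a (x : Rn R n) : 0 <= phiN a x.
Proof. by apply: prodr_ge0 => i _; exact: phi1_ge0. Qed.

Lemma phiN_le1 n a (x : Rn R n) : 0 <= a -> phiN a x <= 1.
Proof.
by move=> a0; rewrite /phiN; apply: prodr_ile1 => i _; rewrite phi1_ge0 phi1_le1.
Qed.

Lemma measurable_phiN n a : measurable_fun setT (@phiN n a).
Proof.
by apply: (@measurable_tensor _ _ (fun=> phi1 a)) => i; exact: measurable_phi1.
Qed.

Lemma integrable_phiN n a : 0 < a ->
  (lebesgueN R n).-integrable setT (EFin \o @phiN n a).
Proof.
move=> a0; apply/integrableP; split.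
  by apply/measurable_EFinP; exact: measurable_phiN.
under eq_integral do rewrite /= ger0_norm ?phiN_ge0//.
rewrite /phiN (@integral_tensor _ _ (fun=> phi1 a) (fun=> 2 / a)) ?ltry//.
- by move=> _; exact: measurable_phi1.
- by move=> _; exact: phi1_ge0.
- by move=> _; exact: integral_phi1.
Qed.

Lemma integrable_phiN_bounded n a (g : Rn R n -> R) : 0 < a ->
  measurable_fun setT g -> (forall x, `|g x| <= 1) ->
  (lebesgueN R n).-integrable setT (fun x => (phiN a x * g x)%:E).
Proof.
move=> a0 mg g1; apply: le_integrable (integrable_phiN n a0) => //.
  by apply/measurable_EFinP; apply: measurable_funM => //; exact: measurable_phiN.
by move=> x _; rewrite lee_fin normrM ler_piMr.
Qed.

Lemma measurable_phase n c (z : 'I_n -> R) :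
  measurable_fun setT (fun y : Rn R n => c * \sum_(i < n) z i * tnth y i).
Proof.
apply: measurable_funM => //; apply: measurable_sum => i.
by apply: measurable_funM => //; exact: measurable_tnth.
Qed.

Lemma measurable_cos : measurable_fun setT (@cos R).
Proof. by apply: continuous_measurable_fun; exact: continuous_cos. Qed.

Lemma measurable_sin : measurable_fun setT (@sin R).
Proof. by apply: continuous_measurable_fun; exact: continuous_sin. Qed.

Lemma cos_norm_le1 (x : R) : `|cos x| <= 1.
Proof. by rewrite ler_norml cos_geN1 cos_le1. Qed.

Lemma sin_norm_le1 (x : R) : `|sin x| <= 1.
Proof. by rewrite ler_norml sin_geN1 sin_le1. Qed.

(** Both integrals are computed in one induction because the addition formulas mix them. Only
    [c ^+ 2] matters, as [pois1] depends on the square of the frequency; hence the direct and the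
    inverse transform are treated together. *)
Lemma Rintegral_phiN_trig n a c (z : 'I_n -> R) : 0 < a ->
  c ^+ 2 = (2 * pi) ^+ 2 ->
  Rintegral (lebesgueN R n) setT
    (fun y => phiN a y * cos (c * \sum_(i < n) z i * tnth y i)) = poisN a z /\
  Rintegral (lebesgueN R n) setT
    (fun y => phiN a y * sin (c * \sum_(i < n) z i * tnth y i)) = 0.
Proof.
move=> a0 c2.
have icos m (w : 'I_m -> R) : (lebesgueN R m).-integrable setT
    (fun y => (phiN a y * cos (c * \sum_(i < m) w i * tnth y i))%:E).
  apply: integrable_phiN_bounded => //.
    by apply: measurableT_comp; [exact: measurable_cos|exact: measurable_phase].
  by move=> x; exact: cos_norm_le1.
have isin m (w : 'I_m -> R) : (lebesgueN R m).-integrable setT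
    (fun y => (phiN a y * sin (c * \sum_(i < m) w i * tnth y i))%:E).
  apply: integrable_phiN_bounded => //.
    by apply: measurableT_comp; [exact: measurable_sin|exact: measurable_phase].
  by move=> x; exact: sin_norm_le1.
elim: n z => [|n IH] z.
  rewrite !Rintegral_lebesgueN0; last 2 first.
  - by apply/measurable_EFinP; exact: measurable_int (isin _ _).
  - by apply/measurable_EFinP; exact: measurable_int (icos _ _).
  by rewrite /phiN /poisN !big_ord0 mulr0 cos0 sin0 mulr0 mul1r.
have [IHc IHs] := IH (fun i => z (lift ord0 i)).
set tail := fun y : Rn R n => c * \sum_(i < n) z (lift ord0 i) * tnth y i.
have phase t y : c * (\sum_(i < n.+1) z i * tnth (cons_pair (t, y)) i) =
    c * z ord0 * t + tail y.
  rewrite big_ord_recl mulrDr mulrA; congr (_ * _ + c * _).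
  by apply: eq_bigr => i _; rewrite tnthS.
have phiS t (y : Rn R n) : phiN a (cons_pair (t, y)) = phi1 a t * phiN a y.
  by rewrite /phiN (prod_tnth_cons (fun=> phi1 a)).
have mtail : measurable_fun setT tail by exact: measurable_phase.
have itc : (lebesgueN R n).-integrable setT (fun y => (phiN a y * cos (tail y))%:E).
  exact: icos.
have its : (lebesgueN R n).-integrable setT (fun y => (phiN a y * sin (tail y))%:E).
  exact: isin.
have Jc (k : R) : (lebesgueN R n).-integrable setT
    (EFin \o (fun y => k * (phiN a y * cos (tail y)))).
  exact: (integrableZl measurableT k itc).
have Js (k : R) : (lebesgueN R n).-integrable setT
    (EFin \o (fun y => k * (phiN a y * sin (tail y)))).
  exact: (integrableZl measurableT k its).
have b2 : (c * z ord0) ^+ 2 = (2 * pi * z ord0) ^+ 2 by rewrite !exprMn c2 exprMn.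
have i1c : leb.-integrable setT (EFin \o (fun t => phi1 a t * cos (c * z ord0 * t))).
  apply: le_integrable (integrable_phi1 a0) => //.
    apply/measurable_EFinP; apply: measurable_funM; first exact: measurable_phi1.
    by apply: continuous_measurable_fun; exact: continuous_cosM.
  move=> t _; rewrite lee_fin normrM ler_piMr//; exact: cos_norm_le1.
have i1s : leb.-integrable setT (EFin \o (fun t => phi1 a t * sin (c * z ord0 * t))).
  apply: le_integrable (integrable_phi1 a0) => //.
    apply/measurable_EFinP; apply: measurable_funM; first exact: measurable_phi1.
    by apply: continuous_measurable_fun; exact: continuous_sinM.
  move=> t _; rewrite lee_fin normrM ler_piMr//; exact: sin_norm_le1.
have sc t : (lebesgueN R n).-integrable setT (fun y => (phiN a (cons_pair (t, y)) *
    cos (c * \sum_(i < n.+1) z i * tnth (cons_pair (t, y)) i))%:E).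
  pose f y := phi1 a t * cos (c * z ord0 * t) * (phiN a y * cos (tail y)) -
    phi1 a t * sin (c * z ord0 * t) * (phiN a y * sin (tail y)).
  rewrite (_ : (fun _ => _) = EFin \o f); last first.
    by apply/funext => y; rewrite phase phiS cosD /f /=; congr EFin; ring.
  exact: (integrableB measurableT
    (integrableZl measurableT (phi1 a t * cos (c * z ord0 * t)) itc)
    (integrableZl measurableT (phi1 a t * sin (c * z ord0 * t)) its)).
have ss t : (lebesgueN R n).-integrable setT (fun y => (phiN a (cons_pair (t, y)) *
    sin (c * \sum_(i < n.+1) z i * tnth (cons_pair (t, y)) i))%:E).
  pose f y := phi1 a t * sin (c * z ord0 * t) * (phiN a y * cos (tail y)) +
    phi1 a t * cos (c * z ord0 * t) * (phiN a y * sin (tail y)).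
  rewrite (_ : (fun _ => _) = EFin \o f); last first.
    by apply/funext => y; rewrite phase phiS sinD /f /=; congr EFin; ring.
  exact: (integrableD measurableT
    (integrableZl measurableT (phi1 a t * sin (c * z ord0 * t)) itc)
    (integrableZl measurableT (phi1 a t * cos (c * z ord0 * t)) its)).
rewrite (Rintegral_lebesgueNS (icos _ _) sc) (Rintegral_lebesgueNS (isin _ _) ss).
split.
- transitivity (Rintegral leb setT (fun t => poisN a (fun i => z (lift ord0 i)) *
    (phi1 a t * cos (c * z ord0 * t)))).
    apply: eq_Rintegral => t _; rewrite -IHc mulrC -RintegralZl//.
    (* A multiple of the sine integral of the tail, zero by induction, is inserted so that the
       right-hand side becomes the addition formula for the cosine. *)
    rewrite -[RHS]subr0 -[X in _ - X](mulr0 (phi1 a t * sin (c * z ord0 * t))).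
    rewrite -[X in _ - _ * X]IHs.
    rewrite -RintegralZl// -RintegralB//.
    apply: eq_Rintegral => y _; rewrite phase phiS cosD -/(tail _) /=; ring.
  rewrite RintegralZl// Rintegral_phi1_cos// b2 /poisN big_ord_recl mulrC.
  by [].
- transitivity (Rintegral leb setT (fun t => poisN a (fun i => z (lift ord0 i)) *
    (phi1 a t * sin (c * z ord0 * t)))).
    apply: eq_Rintegral => t _; rewrite -IHc mulrC -RintegralZl//.
    rewrite -[RHS]addr0 -[X in _ = _ + X](mulr0 (phi1 a t * cos (c * z ord0 * t))).
    rewrite -[X in _ = _ + _ * X]IHs.
    rewrite -RintegralZl// -RintegralD//.
    apply: eq_Rintegral => y _; rewrite phase phiS sinD -/(tail _) /=; ring.
  by rewrite RintegralZl// Rintegral_phi1_sin// mulr0.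
Qed.

End gauge.

(** * Plancherel theorem *)

Section integrable_complex.
Context d (T : measurableType d) (R : realType).
Variable mu : {measure set T -> \bar R}.
Implicit Types v w m : T -> R[i].

(** The l1 norm on the plane, equivalent to [normc] but without a square root: its integral is the
    sum of those of the two parts. *)
Definition abs1 (z : R[i]) : R := `|Re z| + `|Im z|.

Lemma abs1_ge0 z : 0 <= abs1 z. Proof. by rewrite addr_ge0. Qed.

Lemma cint1_cmeas v : cint1 mu v -> cmeas v.
Proof.
by move=> [i1 i2]; split; apply/measurable_EFinP; [exact: measurable_int i1|
  exact: measurable_int i2].
Qed.

Lemma integrable_abs1 v : cint1 mu v ->
  mu.-integrable setT (EFin \o (fun x => abs1 (v x))).
Proof.
move=> [i1 i2].
exact: (integrableD measurableT (integrable_norm i1) (integrable_norm i2)).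
Qed.

Lemma abs1M_le (z w : R[i]) : `|Re (z * w)| <= abs1 z * abs1 w /\
  `|Im (z * w)| <= abs1 z * abs1 w.
Proof.
rewrite !RIE /abs1; move: (Re z) (Im z) (Re w) (Im w) => a b c e.
split.
  rewrite (le_trans (ler_normB _ _))// !normrM.
  by have := normr_ge0 a; have := normr_ge0 b; have := normr_ge0 c;
    have := normr_ge0 e; nra.
rewrite (le_trans (ler_normD _ _))// !normrM.
by have := normr_ge0 a; have := normr_ge0 b; have := normr_ge0 c;
  have := normr_ge0 e; nra.
Qed.

Lemma abs1M2_le (z w : R[i]) : abs1 (z * w) <= 2 * abs1 z * abs1 w.
Proof.
rewrite -mulrA mulr_natl mulr2n; have [h1 h2] := abs1M_le z w.
by apply: lerD.
Qed.

Lemma cint1M m v (B : R) : cmeas m -> (forall x, abs1 (m x) <= B) ->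
  cint1 mu v -> cint1 mu (fun x => m x * v x).
Proof.
move=> mm mB iv; have [m1 m2] := cmeasM mm (cint1_cmeas iv).
have iB := integrableZl measurableT B (integrable_abs1 iv).
have le (x : T) : abs1 (m x) * abs1 (v x) <= `|B * abs1 (v x)|.
  apply: le_trans (ler_norm _); apply: ler_wpM2r; [exact: abs1_ge0|exact: mB].
split; apply: le_integrable iB => //; try exact/measurable_EFinP.
- by move=> x _; rewrite lee_fin; apply: le_trans (le x); apply: (abs1M_le _ _).1.
- by move=> x _; rewrite lee_fin; apply: le_trans (le x); apply: (abs1M_le _ _).2.
Qed.

Lemma cint1D v w : cint1 mu v -> cint1 mu w -> cint1 mu (fun x => v x + w x).
Proof.
move=> [v1 v2] [w1 w2]; split; under eq_fun do rewrite RIE EFinD.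
  exact: integrableD.
exact: integrableD.
Qed.

Lemma abs1_expi (t : R) : abs1 (expi t) <= 2.
Proof. by rewrite /abs1 /= -[2]/(1 + 1) lerD// ?cos_norm_le1 ?sin_norm_le1. Qed.

Lemma Rintegral_rdot_cst v (z : R[i]) : cint1 mu v ->
  Rintegral mu setT (fun x => Re (v x) * Re z + Im (v x) * Im z) =
  Rintegral mu setT (fun x => Re (v x)) * Re z +
  Rintegral mu setT (fun x => Im (v x)) * Im z.
Proof.
move=> [i1 i2]; rewrite RintegralD//; last 2 first.
- exact: (integrableZr measurableT (Re z) i1).
- exact: (integrableZr measurableT (Im z) i2).
by rewrite !RintegralZr.
Qed.

Lemma rdot_abs1_le (z w : R[i]) :
  `|Re z * Re w + Im z * Im w| <= abs1 z * abs1 w.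
Proof.
rewrite /abs1; move: (Re z) (Im z) (Re w) (Im w) => a b c e.
rewrite (le_trans (ler_normD _ _))// !normrM.
by have := normr_ge0 a; have := normr_ge0 b; have := normr_ge0 c;
  have := normr_ge0 e; nra.
Qed.

End integrable_complex.

Section kernel.
Context {R : realType} {N : nat}.
Local Notation V := (Rn R N).
Local Notation mu := (lebesgueN R N).
Implicit Types (u v g : V -> R[i]) (c a : R).

Definition wave c (xi x : V) : R[i] := expi (c * dot xi x).

(* [F] is [ker (- (2 * pi))] and [F^-1] is [ker (2 * pi)]. *)
Definition ker c v (xi : V) : R[i] := cintegral (fun x => wave c xi x * v x).

Lemma fourier_intE v : fourier_int v = ker (- (2 * pi)) v.
Proof.
apply/funext => xi; rewrite /fourier_int /ker; congr cintegral.
by apply/funext => x; rewrite /wave mulNr.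
Qed.

Lemma dotC (x y : V) : dot x y = dot y x.
Proof. by apply: eq_bigr => i _; rewrite mulrC. Qed.

Lemma waveC c (x y : V) : wave c x y = wave c y x.
Proof. by rewrite /wave dotC. Qed.

Lemma measurable_dot : measurable_fun setT (fun z : V * V => dot z.1 z.2).
Proof.
apply: measurable_sum => i; apply: measurable_funM.
  exact: (measurableT_comp (measurable_tnth i) measurable_fst).
exact: (measurableT_comp (measurable_tnth i) measurable_snd).
Qed.

Lemma cmeas_wave2 c : cmeas (fun z : V * V => wave c z.1 z.2).
Proof.
have mp : measurable_fun setT (fun z : V * V => c * dot z.1 z.2).
  by apply: measurable_funM => //; exact: measurable_dot.
split.
  exact: (measurableT_comp measurable_cos mp).
exact: (measurableT_comp measurable_sin mp).
Qed.

Lemma cmeas_wave c xi : cmeas (wave c xi).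
Proof.
have [m1 m2] := cmeas_wave2 c.
by split; [exact: (measurableT_comp m1 (measurable_pair1 xi))|
  exact: (measurableT_comp m2 (measurable_pair1 xi))].
Qed.

Lemma cint1_wave c xi v : cint1 mu v -> cint1 mu (fun x => wave c xi x * v x).
Proof.
by apply: cint1M; [exact: cmeas_wave|move=> x; exact: abs1_expi].
Qed.

Lemma cmeas_ker c v : cmeas v -> cmeas (ker c v).
Proof.
move=> mv.
have [m1 m2] : cmeas (fun z : V * V => wave c z.1 z.2 * v z.2).
  apply: cmeasM; first exact: cmeas_wave2.
  by case: mv => r i; split; [exact: (measurableT_comp r measurable_snd)|
    exact: (measurableT_comp i measurable_snd)].
by split; [exact: (measurable_Rintegral_section mu m1)|
  exact: (measurable_Rintegral_section mu m2)].
Qed.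

Lemma kerD c u v : cint1 mu u -> cint1 mu v ->
  ker c (fun x => u x + v x) = (fun xi => ker c u xi + ker c v xi).
Proof.
move=> iu iv; apply/funext => xi; have [u1 u2] := cint1_wave c xi iu.
have [v1 v2] := cint1_wave c xi iv.
rewrite /ker /cintegral; congr (_ +i* _).
  by rewrite -RintegralD//; apply: eq_Rintegral => x _; rewrite mulrDr cReD.
by rewrite -RintegralD//; apply: eq_Rintegral => x _; rewrite mulrDr cImD.
Qed.

Lemma kerZ c (z : R[i]) v : cint1 mu v ->
  ker c (fun x => z * v x) = (fun xi => z * ker c v xi).
Proof.
move=> iv; apply/funext => xi; have [v1 v2] := cint1_wave c xi iv.
rewrite /ker /cintegral; case: z => a b; congr (_ +i* _).
- rewrite -!RintegralZl// -RintegralB//; last 2 first.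
  + exact: (integrableZl measurableT a v1).
  + exact: (integrableZl measurableT b v2).
  by apply: eq_Rintegral => x _; rewrite !RIE /=; ring.
- rewrite -!RintegralZl// -RintegralD//; last 2 first.
  + exact: (integrableZl measurableT a v2).
  + exact: (integrableZl measurableT b v1).
  by apply: eq_Rintegral => x _; rewrite !RIE /=; ring.
Qed.

(** The transform of an integrable function is bounded. The constant 4 arises from two parts, each
    with a wave of [abs1] at most 2. *)
Lemma abs1_ker c v : cint1 mu v -> exists B, forall xi, abs1 (ker c v xi) <= B.
Proof.
move=> iv; have iB := integrable_abs1 iv.
exists (4 * Rintegral mu setT (fun x => abs1 (v x))) => xi.
have [v1 v2] := cint1_wave c xi iv.
have iB2 := integrableZl measurableT 2 iB.
have le2 (x : V) : abs1 (wave c xi x) * abs1 (v x) <= 2 * abs1 (v x).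
  by apply: ler_wpM2r; [exact: abs1_ge0|exact: abs1_expi].
rewrite /abs1 [X in X <= _]/=.
rewrite (_ : 4 * _ = 2 * Rintegral mu setT (fun x => abs1 (v x)) +
  2 * Rintegral mu setT (fun x => abs1 (v x))); last by ring.
rewrite -!RintegralZl//; apply: lerD.
- apply: le_trans (le_normr_Rintegral _ v1) _ => //.
  apply: le_Rintegral => //; first exact: integrable_norm.
  by move=> x _; apply: le_trans (le2 x); apply: (abs1M_le _ _).1.
- apply: le_trans (le_normr_Rintegral _ v2) _ => //.
  apply: le_Rintegral => //; first exact: integrable_norm.
  by move=> x _; apply: le_trans (le2 x); apply: (abs1M_le _ _).2.
Qed.

(** Fubini for an absolutely integrable kernel. The adjoint has the conjugate kernel, and
    conjugating a wave changes the sign of [c]. *)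
Lemma ker_duality c u g : cint1 mu u -> cint1 mu g ->
  ip mu (ker c u) g = ip mu u (ker (- c) g).
Proof.
move=> iu ig.
pose h (z : V * V) := Re (wave c z.1 z.2 * u z.2) * Re (g z.1) +
  Im (wave c z.1 z.2 * u z.2) * Im (g z.1).
have hE xi x : h (xi, x) = Re (wave (- c) x xi * g xi) * Re (u x) +
    Im (wave (- c) x xi * g xi) * Im (u x).
  rewrite /h (waveC _ x xi) /wave mulNr !RIE /= cosN sinN; ring.
have le xi x : `|h (xi, x)| <= 4 * (abs1 (g xi) * abs1 (u x)).
  rewrite (le_trans (rdot_abs1_le _ _))// [abs1 (g xi) * _]mulrC mulrA.
  rewrite ler_wpM2r ?abs1_ge0// (le_trans (abs1M2_le _ _))//.
  rewrite ler_wpM2r ?abs1_ge0// (_ : 4 = 2 * 2); last by ring.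
  by rewrite ler_wpM2l// abs1_expi.
have mh : measurable_fun setT h.
  have [m1 m2] : cmeas (fun z : V * V => wave c z.1 z.2 * u z.2).
    apply: cmeasM; first exact: cmeas_wave2.
    by case: (cint1_cmeas iu) => r i;
      split; [exact: (measurableT_comp r measurable_snd)|
      exact: (measurableT_comp i measurable_snd)].
  have [g1 g2] := cint1_cmeas ig.
  apply: measurable_funD; apply: measurable_funM => //.
    exact: (measurableT_comp g1 measurable_fst).
  exact: (measurableT_comp g2 measurable_fst).
have ih : (mu \x mu)%E.-integrable setT (EFin \o h).
  have it := integrableZl measurableT 4
    (integrable_tensor (integrable_abs1 ig) (integrable_abs1 iu)).
  apply: le_integrable it => //; first exact/measurable_EFinP.
  move=> [xi x] _ /=; rewrite lee_fin (le_trans (le xi x))//=.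
  exact: ler_norm.
have i2 xi : mu.-integrable setT (fun x => (h (xi, x))%:E).
  have it := integrableZl measurableT (4 * abs1 (g xi)) (integrable_abs1 iu).
  apply: le_integrable it => //.
    by apply/measurable_EFinP; exact: (measurableT_comp mh (measurable_pair1 xi)).
  move=> x _; rewrite lee_fin (le_trans (le xi x))// mulrA.
  exact: ler_norm.
have i1 x : mu.-integrable setT (fun xi => (h (xi, x))%:E).
  have it := integrableZl measurableT (4 * abs1 (u x)) (integrable_abs1 ig).
  apply: le_integrable it => //.
    by apply/measurable_EFinP; exact: (measurableT_comp mh (measurable_pair2 x)).
  move=> xi _; rewrite lee_fin (le_trans (le xi x))//.
  by rewrite [abs1 (g xi) * _]mulrC mulrA; exact: ler_norm.
transitivity (Rintegral mu setT (fun xi => Rintegral mu setT (fun x => h (xi, x)))).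
  apply: eq_Rintegral => xi _.
  exact: (esym (Rintegral_rdot_cst (g xi) (cint1_wave c xi iu))).
rewrite (Rintegral_Fubini ih i2 i1) ipC; apply: eq_Rintegral => x _.
under eq_Rintegral do rewrite hE.
exact: (Rintegral_rdot_cst (u x) (cint1_wave (- c) x ig)).
Qed.

End kernel.

(** * Contraction property of the transform *)

Section contraction.
Context {R : realType} {N : nat}.
Local Notation V := (Rn R N).
Local Notation mu := (lebesgueN R N).
Implicit Types (u v g : V -> R[i]) (c a : R).

Definition pk a (x y : V) : R := poisN a (fun i => tnth x i - tnth y i).

Lemma pk_ge0 a x y : 0 < a -> 0 <= pk a x y.
Proof. by move=> a0; apply: prodr_ge0 => i _; exact: pois1_ge0. Qed.

Lemma pkC a x y : pk a x y = pk a y x.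
Proof. by apply: eq_bigr => i _; rewrite -pois1N opprB. Qed.

(** Each factor is largest at the origin, where it equals [2 / a]. The bound makes the product of
    the kernel with an integrable function integrable. *)
Lemma pk_le a x y : 0 < a -> pk a x y <= (2 / a) ^+ N.
Proof.
move=> a0; rewrite /pk /poisN -[X in _ ^+ X]card_ord -prodr_const.
apply: ler_prod => i _; rewrite pois1_ge0//=.
rewrite /pois1 ler_pdivrMr ?pois1_den_gt0//.
rewrite (_ : 2 * a = 2 / a * a ^+ 2); last by field; rewrite gt_eqF.
by apply: ler_wpM2l; [rewrite divr_ge0// ltW|rewrite lerDl sqr_ge0].
Qed.

Lemma measurable_pk2 a : 0 < a -> measurable_fun setT (fun z : V * V => pk a z.1 z.2).
Proof.
move=> a0; apply: measurable_prod => i _.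
apply: (@measurableT_comp _ _ _ _ _ _ (pois1 a)).
  by apply: continuous_measurable_fun; exact: continuous_pois1.
apply: measurable_funB.
  exact: (measurableT_comp (measurable_tnth i) measurable_fst).
exact: (measurableT_comp (measurable_tnth i) measurable_snd).
Qed.

Lemma measurable_pk a x : 0 < a -> measurable_fun setT (pk a x).
Proof.
by move=> a0; exact: (measurableT_comp (measurable_pk2 a0) (measurable_pair1 x)).
Qed.

Lemma integral_pk a x : 0 < a -> (\int[mu]_y (pk a x y)%:E = 1)%E.
Proof.
move=> a0; rewrite (@integral_tensor _ _ (fun i t => pois1 a (tnth x i - t))
  (fun=> 1)).
- by rewrite big1.
- by move=> i; apply: continuous_measurable_fun; exact: continuous_pois1B.
- by move=> i t; exact: pois1_ge0.
- by move=> i; exact: integral_pois1.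
Qed.

Lemma expiD (s t : R) : expi (s + t) = expi s * expi t.
Proof.
by rewrite /expi cosD sinD [X in _ +i* X]addrC.
Qed.

Definition gauged a (v : V -> R[i]) (xi : V) : R[i] := (phiN a xi)%:C * v xi.

Lemma cmeas_phiN a : cmeas (fun xi : V => (phiN a xi)%:C).
Proof. by apply: cmeasR; exact: measurable_phiN. Qed.

Lemma cint1_gauged a v (B : R) : 0 < a -> cmeas v -> (forall x, abs1 (v x) <= B) ->
  cint1 mu (gauged a v).
Proof.
move=> a0 mv vB.
rewrite (_ : gauged a v = (fun x => v x * (phiN a x)%:C)); last first.
  by apply/funext => x; rewrite /gauged mulrC.
apply: cint1M vB _ => //; split; first exact: integrable_phiN.
exact: integrable0.
Qed.

(** The product of the two waves is a wave with frequency [x - y], whose sine part integrates to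
    zero against the even weight. *)
Lemma ker_gauged_wave a c (x y : V) : 0 < a -> c ^+ 2 = (2 * pi) ^+ 2 ->
  ker (- c) (gauged a (wave c x)) y = (pk a x y)%:C.
Proof.
move=> a0 c2; have [hc hs] := Rintegral_phiN_trig
  (fun i => tnth x i - tnth y i) a0 c2.
have ph (xi : V) : - c * dot y xi + c * dot x xi =
    c * \sum_(i < N) (tnth x i - tnth y i) * tnth xi i.
  rewrite mulNr addrC -mulrBr; congr (_ * _); rewrite /dot -sumrB.
  by apply: eq_bigr => i _; rewrite mulrBl.
have wE (xi : V) : wave (- c) y xi * gauged a (wave c x) xi =
    (phiN a xi)%:C * expi (c * \sum_(i < N) (tnth x i - tnth y i) * tnth xi i).
  by rewrite /gauged mulrCA -expiD ph.
rewrite /ker /cintegral -[RHS]/(pk a x y +i* 0); congr (_ +i* _).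
  rewrite -[RHS]hc; apply: eq_Rintegral => xi _; rewrite wE cReM /=; ring.
rewrite -[RHS]hs; apply: eq_Rintegral => xi _; rewrite wE cImM /=; ring.
Qed.

Definition conv a (b : V -> R) (x : V) : R :=
  Rintegral mu setT (fun y => b y * pk a x y).

(** Evaluating a transform at [x] is a pairing with a wave, so duality moves the inner transform
    onto the gauged wave, where it is the Poisson kernel. The imaginary part is a pairing with ['i]
    times that wave. *)
Lemma ker_gauged_ker a c v (x : V) : 0 < a -> c ^+ 2 = (2 * pi) ^+ 2 ->
  cint1 mu v ->
  ker (- c) (gauged a (ker c v)) x =
  conv a (fun y => Re (v y)) x +i* conv a (fun y => Im (v y)) x.
Proof.
move=> a0 c2 iv.
have iw : cint1 mu (gauged a (wave c x)).
  by apply: (cint1_gauged a0 (cmeas_wave c x)) => xi; exact: abs1_expi.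
have iiw : cint1 mu (fun xi => 'i * gauged a (wave c x) xi).
  apply: (cint1M (cmeas_cst _ _) _ iw) => xi; exact: lexx.
rewrite /ker /cintegral; congr (_ +i* _).
- transitivity (ip mu (ker c v) (gauged a (wave c x))).
    apply: eq_Rintegral => xi _; rewrite /rdot /gauged /wave mulNr !RIE /=.
    rewrite cosN sinN; ring.
  rewrite ker_duality//; apply: eq_Rintegral => y _.
  by rewrite /rdot ker_gauged_wave//= mulr0 addr0.
- transitivity (ip mu (ker c v) (fun xi => 'i * gauged a (wave c x) xi)).
    apply: eq_Rintegral => xi _; rewrite /rdot /gauged /wave mulNr !RIE /=.
    rewrite cosN sinN; ring.
  rewrite ker_duality//; apply: eq_Rintegral => y _.
  rewrite /rdot kerZ// ker_gauged_wave// !RIE /=; ring.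
Qed.

Definition cross a v (x y : V) : R :=
  (Re (v x) * Re (v y) + Im (v x) * Im (v y)) * pk a x y.

Lemma energy a c v : 0 < a -> c ^+ 2 = (2 * pi) ^+ 2 -> cint1 mu v ->
  ip mu (ker c v) (gauged a (ker c v)) =
  Rintegral mu setT (fun x => Rintegral mu setT (cross a v x)).
Proof.
move=> a0 c2 iv; have [B vB] := abs1_ker c iv.
have ig : cint1 mu (gauged a (ker c v)).
  by apply: (cint1_gauged a0 _ vB); apply: cmeas_ker; exact: cint1_cmeas iv.
rewrite ker_duality//; apply: eq_Rintegral => x _.
rewrite /rdot ker_gauged_ker//= /conv.
have mb (b : V -> R) : mu.-integrable setT (EFin \o b) ->
    mu.-integrable setT (EFin \o (fun y => b y * pk a x y)).
  move=> ib; have /measurable_EFinP mb := measurable_int _ ib.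
  have iB := integrableZl measurableT ((2 / a) ^+ N) ib.
  apply: le_integrable iB => //.
    by apply/measurable_EFinP; apply: measurable_funM => //; exact: measurable_pk.
  move=> y _; rewrite lee_fin !normrM mulrC ler_wpM2r//.
  by rewrite (ger0_norm (pk_ge0 _ _ a0)) (le_trans (pk_le x y a0))// ler_norm.
have [i1 i2] := iv; have j1 := mb _ i1; have j2 := mb _ i2.
rewrite -!RintegralZl// -RintegralD//; last 2 first.
- exact: (integrableZl measurableT (Re (v x)) j1).
- exact: (integrableZl measurableT (Im (v x)) j2).
by apply: eq_Rintegral => y _; rewrite /cross mulrDl !mulrA.
Qed.

End contraction.

(** Integrability of [f] is not assumed. Its integral is finite or [-oo]; in the second case [fine]
    returns 0, which is at most [r] because [H] is nonnegative. *)
Lemma Rintegral_le_ub d (T : measurableType d) (R : realType)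
    (mu : {measure set T -> \bar R}) (f : T -> R) (H : T -> \bar R) (r : R) :
  measurable_fun setT f -> measurable_fun setT H -> (forall x, (0 <= H x)%E) ->
  (forall x, ((f x)%:E <= H x)%E) -> (\int[mu]_x H x <= r%:E)%E ->
  Rintegral mu setT f <= r.
Proof.
move=> mf mH H0 fH Hr.
have r0 : 0 <= r by rewrite -lee_fin; apply: le_trans Hr; exact: integral_ge0.
have : (\int[mu]_x (f x)%:E <= r%:E)%E.
  have mE : measurable_fun setT (EFin \o f) by apply/measurable_EFinP.
  rewrite integralE; apply: (@le_trans _ _ (\int[mu]_x ((EFin \o f)^\+ x))%E).
    rewrite -[leRHS]sube0 leeB//; apply: integral_ge0 => x _; exact: funeneg_ge0.
  apply: le_trans Hr; apply: ge0_le_integral => //.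
    exact: measurable_funepos.
  by move=> x _; rewrite funeposE ge_max fH H0.
by rewrite /Rintegral; case: (\int[mu]_x (f x)%:E)%E.
Qed.

Section plancherel_inequality.
Context {R : realType} {N : nat}.
Local Notation V := (Rn R N).
Local Notation mu := (lebesgueN R N).
Implicit Types (u v g : V -> R[i]) (c a : R).

Lemma measurable_cross a v : 0 < a -> cmeas v ->
  measurable_fun setT (fun z : V * V => cross a v z.1 z.2).
Proof.
move=> a0 [m1 m2]; apply: measurable_funM; last exact: measurable_pk2.
by apply: measurable_funD; apply: measurable_funM;
  (exact: (measurableT_comp m1 measurable_fst) ||
   exact: (measurableT_comp m1 measurable_snd) ||
   exact: (measurableT_comp m2 measurable_fst) ||
   exact: (measurableT_comp m2 measurable_snd)).
Qed.

(** Schur's test: the real part of [v x] times the conjugate of [v y] is at most half of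
    [|v x|^2 + |v y|^2], and the symmetric kernel has mass one in each variable. *)
Lemma energy_le a v : 0 < a -> sqi mu v ->
  Rintegral mu setT (fun x => Rintegral mu setT (cross a v x)) <= ip mu v v.
Proof.
move=> a0 sv; have mv := sv.1.
have mn := measurable_sqr_normc mv.
have mnE : measurable_fun setT (fun x => (normc (v x) ^+ 2)%:E).
  exact/measurable_EFinP.
pose W (z : V * V) : \bar R := (normc (v z.2) ^+ 2 * pk a z.1 z.2)%:E.
have mW : measurable_fun setT W.
  apply/measurable_EFinP; apply: measurable_funM; last exact: measurable_pk2.
  exact: (measurableT_comp mn measurable_snd).
have W0 z : (0 <= W z)%E by rewrite lee_fin mulr_ge0 ?sqr_ge0 ?pk_ge0.
have mF : measurable_fun setT (fun x => \int[mu]_y W (x, y))%E.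
  exact: (measurable_fun_fubini_tonelli_F (m2 := mu) W mW W0).
pose H x : \bar R := (2^-1%:E * ((normc (v x) ^+ 2)%:E + \int[mu]_y W (x, y)))%E.
have F0 x : (0 <= \int[mu]_y W (x, y))%E by apply: integral_ge0 => y _.
have H0 x : (0 <= H x)%E.
  by rewrite mule_ge0 ?lee_fin// adde_ge0// lee_fin sqr_ge0.
apply: (@Rintegral_le_ub _ _ _ mu _ H).
- exact: (measurable_Rintegral_section mu (measurable_cross a0 mv)).
- by apply: measurable_funeM; exact: emeasurable_funD.
- exact: H0.
(* Square integrability of [v] does not bound the inner integral at each single [x]; where [H x] is
   infinite the bound is trivial. *)
- move=> x; case HE : (H x) => [r| |]; last 2 first.
  + by rewrite leey.
  + by have := H0 x; rewrite HE.
  rewrite lee_fin; pose h y : \bar R :=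
    (2^-1 * (normc (v x) ^+ 2 * pk a x y + normc (v y) ^+ 2 * pk a x y))%:E.
  have h0 y : (0 <= h y)%E.
    by rewrite lee_fin mulr_ge0// addr_ge0// mulr_ge0 ?sqr_ge0 ?pk_ge0.
  have mp := measurable_pk x a0.
  apply: (@Rintegral_le_ub _ _ _ mu _ h) => //.
  + exact: (measurableT_comp (measurable_cross a0 mv) (measurable_pair1 x)).
  + apply/measurable_EFinP; apply: measurable_funM => //.
    by apply: measurable_funD; exact: measurable_funM.
  + move=> y; rewrite lee_fin -mulrDl mulrA /cross ler_wpM2r ?pk_ge0//.
    rewrite !sqr_normc; move: (Re (v x)) (Im (v x)) (Re (v y)) (Im (v y)).
    by move=> p q s t; have := sqr_ge0 (p - s); have := sqr_ge0 (q - t); nra.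
  + rewrite -HE /H /h.
    under eq_integral do rewrite EFinM EFinD.
    rewrite ge0_integralZl//; last 2 first.
    * by apply: emeasurable_funD; apply/measurable_EFinP; exact: measurable_funM.
    * move=> y _; rewrite -EFinD lee_fin.
      by rewrite addr_ge0// mulr_ge0 ?sqr_ge0 ?pk_ge0.
    rewrite ge0_integralD//; last 4 first.
    * by move=> y _; rewrite lee_fin mulr_ge0 ?sqr_ge0 ?pk_ge0.
    * by apply/measurable_EFinP; exact: measurable_funM.
    * by move=> y _; rewrite lee_fin mulr_ge0 ?sqr_ge0 ?pk_ge0.
    * by apply/measurable_EFinP; exact: measurable_funM.
    under eq_integral do rewrite EFinM.
    rewrite ge0_integralZl//; last 3 first.
    * exact/measurable_EFinP.
    * by move=> y _; rewrite lee_fin pk_ge0.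
    * by rewrite lee_fin sqr_ge0.
    by rewrite integral_pk// mule1.
- rewrite /H ge0_integralZl//; last 2 first.
  + exact: emeasurable_funD.
  + by move=> x _; rewrite adde_ge0// lee_fin sqr_ge0.
  rewrite ge0_integralD//; last by move=> x _; rewrite lee_fin sqr_ge0.
  have -> : (\int[mu]_x \int[mu]_y W (x, y) = sqint mu v)%E.
    rewrite (@fubini_tonelli _ _ _ _ _ mu mu W mW W0); apply: eq_integral => y _.
    rewrite /W /=; under eq_integral do rewrite EFinM.
    rewrite ge0_integralZl//; last 3 first.
    * apply/measurable_EFinP; under eq_fun do rewrite pkC; exact: measurable_pk.
    * by move=> x _; rewrite lee_fin pk_ge0.
    * by rewrite lee_fin sqr_ge0.
    under eq_integral do rewrite pkC.
    by rewrite integral_pk// mule1.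
  rewrite -/(sqint mu v) sqintE// -EFinD -EFinM lee_fin.
  by move: (ip mu v v) => r; lra.
Qed.

End plancherel_inequality.

(** Fatou's lemma with an asymptotic lower bound in place of convergence. This one-sided form is
    needed where the [f_ n] are only known to dominate a convergent sequence. *)
Lemma fatou_bound d (T : measurableType d) (R : realType)
    (mu : {measure set T -> \bar R}) (f_ : nat -> T -> R) (f : T -> R) (M : R) :
  (forall n, measurable_fun setT (f_ n)) -> (forall n x, 0 <= f_ n x) ->
  measurable_fun setT f -> (forall x, 0 <= f x) ->
  (\forall x \ae mu, forall e, 0 < e -> \forall n \near \oo, f x - e <= f_ n x) ->
  (forall n, (\int[mu]_x (f_ n x)%:E <= M%:E)%E) ->
  (\int[mu]_x (f x)%:E <= M%:E)%E.
Proof.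
move=> mf_ f_0 mf f0 ff fM.
have mE n : measurable_fun setT (EFin \o f_ n) by apply/measurable_EFinP.
have E0 n x : setT x -> (0 <= (EFin \o f_ n) x)%E by rewrite lee_fin.
apply: (@le_trans _ _ (\int[mu]_x limn_einf (fun n => (f_ n x)%:E))%E); last first.
  apply: le_trans (fatou mu measurableT mE E0) _.
  rewrite limn_einf_lim; apply: lime_le; first exact: is_cvg_einfs.
  apply: nearW => n; apply: le_trans (fM n).
  by apply: ereal_inf_lbound; exists n => /=.
apply: ae_ge0_le_integral => //.
- by move=> x _; rewrite lee_fin.
- exact/measurable_EFinP.
- move=> x _; rewrite limn_einf_lim; apply: lime_ge; first exact: is_cvg_einfs.
  apply: nearW => n; apply: le_ereal_inf_tmp => _ [k _ <-].
  by rewrite lee_fin.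
- rewrite (_ : (fun x => _) = (fun x => - limn_esup (fun n => (- f_ n x)%:E))%E)//.
  apply: measurableT_comp => //; apply: measurable_fun_limn_esup => n.
  by apply/measurable_EFinP; exact: measurableT_comp.
apply: filterS ff => x fx _; apply/lee_addgt0Pr => e e0.
rewrite -leeBlDr// limn_einf_lim; apply: lime_ge; first exact: is_cvg_einfs.
have [k _ kf] := fx _ e0; exists k => // n /= kn.
apply: le_ereal_inf_tmp => _ [j /= nj <-].
by rewrite -EFinB lee_fin; apply: kf => /=; exact: leq_trans nj.
Qed.

Section contraction.
Context {R : realType} {N : nat}.
Local Notation V := (Rn R N).
Local Notation mu := (lebesgueN R N).
Implicit Types (u v g z : V -> R[i]) (c a : R).

Lemma phiN_cvg1 (x : V) : phiN (n.+1%:R^-1) x @[n --> \oo] --> (1 : R).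
Proof.
rewrite (_ : (fun n => _) =
    (fun n => expR (- (n.+1%:R^-1 * \sum_(i < N) `|tnth x i|)))); last first.
  apply/funext => n; rewrite /phiN /phi1 -expR_sum; congr expR.
  by rewrite mulr_sumr -sumrN.
have h : n.+1%:R^-1 * (\sum_(i < N) `|tnth x i|) @[n --> \oo] --> (0 : R).
  rewrite -[X in _ --> X](mul0r (\sum_(i < N) `|tnth x i|)).
  by apply: cvgMl; exact: cvg_harmonic.
have h' : - (n.+1%:R^-1 * (\sum_(i < N) `|tnth x i|)) @[n --> \oo] --> (0 : R).
  by rewrite -[X in _ --> X]oppr0; exact: cvgN.
rewrite -[X in _ --> X](@expR0 R).
exact: (@cvg_comp _ _ _ _ expR _ _ _ h' (@continuous_expR R 0)).
Qed.

Lemma sqint_gauged_ker a c v : 0 < a -> c ^+ 2 = (2 * pi) ^+ 2 -> L12 mu v ->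
  (\int[mu]_x (phiN a x * normc (ker c v x) ^+ 2)%:E <= (ip mu v v)%:E)%E.
Proof.
move=> a0 c2 [sv iv]; have [B vB] := abs1_ker c iv.
have mk := cmeas_ker c sv.1.
have ig : cint1 mu (gauged a (ker c v)) by exact: (cint1_gauged a0 mk vB).
have ii : mu.-integrable setT (EFin \o rdot (ker c v) (gauged a (ker c v))).
  have iB := integrableZl measurableT B (integrable_abs1 ig).
  apply: le_integrable iB => //.
    by apply/measurable_EFinP; apply: measurable_rdot => //; exact: (cint1_cmeas ig).
  move=> x _; rewrite lee_fin (le_trans (rdot_abs1_le _ _))//.
  by rewrite (le_trans _ (ler_norm _))// ler_wpM2r// abs1_ge0.
rewrite (_ : (\int[mu]_x _)%E = (ip mu (ker c v) (gauged a (ker c v)))%:E).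
  by rewrite lee_fin energy// energy_le.
rewrite /ip /Rintegral fineK; last exact: (integrable_fin_num measurableT ii).
by apply: eq_integral => x _; congr EFin;
  rewrite sqr_normc /rdot /gauged !RIE /=; ring.
Qed.

(** Fatou's lemma with weights [a = 1 / (n + 1)] increasing to 1. That the transform is square
    integrable is part of the conclusion, as its weighted norms are bounded independently of [a]. *)
Lemma ker_contraction c v : c ^+ 2 = (2 * pi) ^+ 2 -> L12 mu v ->
  sqi mu (ker c v) /\ ip mu (ker c v) (ker c v) <= ip mu v v.
Proof.
move=> c2 lv; have mk := cmeas_ker c lv.1.1.
have mn := measurable_sqr_normc mk.
have H : (sqint mu (ker c v) <= (ip mu v v)%:E)%E.
  apply: (@fatou_bound _ _ _ mu
    (fun n x => phiN (n.+1%:R^-1) x * normc (ker c v x) ^+ 2)) => //.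
  - by move=> n; apply: measurable_funM => //; exact: measurable_phiN.
  - by move=> n x; rewrite mulr_ge0 ?phiN_ge0 ?sqr_ge0.
  - by move=> x; exact: sqr_ge0.
  - apply: nearW => x e e0.
    have : phiN (n.+1%:R^-1) x * normc (ker c v x) ^+ 2 @[n --> \oo] -->
        normc (ker c v x) ^+ 2.
      rewrite -[X in _ --> X]mul1r; apply: cvgMl; exact: phiN_cvg1.
    move/cvgrPdist_le => /(_ _ e0); apply: filterS => n.
    by rewrite ler_norml lerBlDl -lerBlDr => /andP[_].
  - by move=> n; apply: sqint_gauged_ker.
have sk : sqi mu (ker c v) by split=> //; rewrite (le_lt_trans H)// ltry.
by split=> //; rewrite -lee_fin -sqintE.
Qed.

End contraction.

(** * Isometry on indicators of boxes *)

Section boxes.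
Context {R : realType} {N : nat}.
Local Notation V := (Rn R N).
Local Notation mu := (lebesgueN R N).
Local Notation leb := (@lebesgue_measure R).
Implicit Types (l r : 'I_N -> R) (a c : R).

Definition box l r : set V := [set x | forall i, l i < tnth x i < r i].

Definition ind (E : set V) (x : V) : R[i] := (\1_E x)%:C.

Lemma indic_box l r (x : V) :
  \1_(box l r) x = \prod_(i < N) \1_(`]l i, r i[%classic : set R) (tnth x i) :> R.
Proof.
rewrite indicE; case: (boolP (x \in box l r)) => xB.
  rewrite big1// => i _; rewrite indicE mem_set//= in_itv/=.
  by move: xB; rewrite inE; apply.
have [i ni] : exists i, ~ (l i < tnth x i < r i).
  by apply/existsNP => h; move: xB; rewrite notin_setE.
rewrite (bigD1 i)//= indicE memNset ?mul0r//= in_itv/=.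
Qed.

Lemma measurable_box l r : measurable (box l r).
Proof.
rewrite (_ : box l r = \big[setI/setT]_(i < N)
    ((fun x : V => tnth x i) @^-1` `]l i, r i[%classic)).
  apply: bigsetI_measurable => i _; rewrite -[X in measurable X]setTI.
  by apply: measurable_tnth => //; exact: measurable_itv.
apply/seteqP; split => x.
  by move=> xB; rewrite -bigcap_seq => i _ /=; rewrite in_itv/=; exact: xB.
rewrite -bigcap_seq => h i; have := h i; rewrite /= in_itv/=; apply.
by rewrite mem_index_enum.
Qed.

Lemma box_setI l r l' r' : box l r `&` box l' r' =
  box (fun i => Num.max (l i) (l' i)) (fun i => Num.min (r i) (r' i)).
Proof.
apply/seteqP; split => x.
  move=> [h h'] i; move: (h i) (h' i) => /andP[h1 h2] /andP[h3 h4].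
  by rewrite gt_max lt_min h1 h2 h3 h4.
by move=> h; split => i; have := h i; rewrite gt_max lt_min;
  move=> /andP[/andP[h1 h2] /andP[h3 h4]]; rewrite ?h1 ?h2 ?h3 ?h4.
Qed.

Lemma integral_indic_itv_pois1 a (s p q : R) : 0 < a -> p < q ->
  (\int[leb]_y (\1_(`]p, q[%classic : set R) y * pois1 a (s - y))%:E =
   (pi^-1 * atan (2 * pi / a * (q - s)) - pi^-1 * atan (2 * pi / a * (p - s)))%:E)%E.
Proof.
move=> a0 pq; rewrite -integral_pois1_itv// [RHS]integral_mkcond.
apply: eq_integral => y _; rewrite patchE indicE; case: ifPn => _.
  by rewrite mul1r.
by rewrite mul0r.
Qed.

Lemma box_lty l r : (mu (box l r) < +oo)%E.
Proof.
rewrite -[box l r]setIT -integral_indic//; last exact: measurable_box.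
under eq_integral do rewrite indic_box.
pose m i := fine (leb `]l i, r i[%classic).
rewrite (@integral_tensor _ _ (fun i => \1_(`]l i, r i[%classic : set R)) m).
- by rewrite ltry.
- by move=> i; apply: measurable_indic; exact: measurable_itv.
- by [].
- move=> i; rewrite integral_indic//.
  by rewrite setIT /m fineK// lebesgue_measure_itv /=; case: ifP.
Qed.

Lemma L12_ind E : measurable E -> (mu E < +oo)%E -> L12 mu (ind E).
Proof.
move=> mE Efin; have iE := integrable_indic_fin mE Efin.
split; last by split => //=; exact: integrable0.
split; first exact: measurable_cindic.
rewrite /sqint; case/integrableP : iE => _; apply: le_lt_trans.
rewrite le_eqVlt; apply/orP; left; apply/eqP; apply: eq_integral => x _.
rewrite sqr_normcR gee0_abs ?lee_fin// indicE.
by case: (_ \in _); rewrite ?expr1n ?expr0n.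
Qed.

Lemma ip_ind E : measurable E -> ip mu (ind E) (ind E) = Rintegral mu setT \1_E.
Proof.
move=> mE; apply: eq_Rintegral => x _; rewrite /rdot /ind /= mulr0 addr0 indicE.
by case: (_ \in _); rewrite ?mulr1 ?mulr0.
Qed.

(* At a point of the box all the arctangents tend to [pi / 2] in absolute value
   as [a] tends to [0], so that the convolution tends to [1] pointwise. *)
Lemma cvg_box_conv l r (x : V) : box l r x -> (forall i, l i < r i) ->
  \prod_(i < N) (pi^-1 * atan (2 * pi / n.+1%:R^-1 * (r i - tnth x i)) -
    pi^-1 * atan (2 * pi / n.+1%:R^-1 * (l i - tnth x i))) @[n --> \oo] --> (1 : R).
Proof.
move=> xB lr.
have H (s : R) : 0 < s ->
    pi^-1 * atan (2 * pi / n.+1%:R^-1 * s) @[n --> \oo] --> (2^-1 : R).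
  move=> s0; rewrite [X in _ --> X](_ : _ = pi^-1 * (pi / 2)); last first.
    by rewrite mulrA mulVf ?mul1r// gt_eqF// pi_gt0.
  have h0 : (n.+1%:R : R) @[n --> \oo] --> +oo.
    have := @cvgr_idn R; rewrite -(cvg_shiftS (fun n => n%:R : R)); exact.
  have h1 : 2 * pi / n.+1%:R^-1 * s @[n --> \oo] --> +oo.
    have p0 : 0 < 2 * pi :> R by rewrite mulr_gt0// pi_gt0.
    under eq_fun do rewrite invrK.
    exact: (cvg_comp _ _ h0 (gt0_cvgMly s0 (gt0_cvgMry p0 cvg_id))).
  apply: cvgMr; exact: (cvg_comp _ _ h1 (@cvgy_atan R)).
rewrite [X in _ --> X](_ : 1 = \prod_(i < N) (2^-1 - - 2^-1)); last first.
  by rewrite big1// => i _; lra.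
apply: (@cvg_big R 'I_N *%R); first exact: mul_continuous.
move=> i _; apply: cvgB.
  by apply: H; rewrite subr_gt0; case/andP: (xB i).
have lx : 0 < tnth x i - l i by rewrite subr_gt0; case/andP: (xB i).
rewrite (_ : (fun n => _) = (fun n =>
    - (pi^-1 * atan (2 * pi / n.+1%:R^-1 * (tnth x i - l i))))); last first.
  by apply/funext => n; rewrite -mulrN -atanN -mulrN opprB.
exact: (cvgN (H _ lx)).
Qed.

End boxes.

Lemma cvg_le_cst (R : realType) (u : nat -> R) (l M : R) :
  u n @[n --> \oo] --> l -> (forall n, u n <= M) -> l <= M.
Proof.
move=> ul uM; rewrite -(cvg_lim _ ul)//; apply: limr_le; first exact/cvg_ex/(ex_intro _ l).
exact: nearW.
Qed.

Section isometry.
Context {R : realType} {N : nat}.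
Local Notation V := (Rn R N).
Local Notation mu := (lebesgueN R N).
Implicit Types (u v g z : V -> R[i]) (l r : 'I_N -> R).
Variable c : R.
Hypothesis c2 : c ^+ 2 = (2 * pi) ^+ 2.

Lemma L12_ind_box l r : L12 mu (ind (box l r)).
Proof. by apply: L12_ind; [exact: measurable_box|exact: box_lty]. Qed.

(** Preservation of inner products is required, and not just of the norm of [g], because this
    condition is linear in [g]. *)
Definition isometric_at (g : V -> R[i]) := L12 mu g /\
  forall z, L12 mu z -> ip mu (ker c z) (ker c g) = ip mu z g.

Lemma L12D u v : L12 mu u -> L12 mu v -> L12 mu (fun x => u x + v x).
Proof. by move=> [su iu] [sv iv]; split; [exact: sqiD|exact: cint1D]. Qed.

Lemma L12Z (t : R[i]) v : L12 mu v -> L12 mu (fun x => t * v x).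
Proof.
move=> [sv iv]; split; first exact: sqiZ.
by apply: (cint1M (cmeas_cst _ t) _ iv) => x; exact: lexx.
Qed.

Lemma L12B u v : L12 mu u -> L12 mu v -> L12 mu (fun x => u x - v x).
Proof.
move=> lu /(L12Z (-1)) lv; have := L12D lu lv.
by under eq_fun do rewrite mulN1r.
Qed.

Lemma sqi_ker v : L12 mu v -> sqi mu (ker c v).
Proof. by move=> lv; have [] := ker_contraction c2 lv. Qed.

Lemma ker_ip_le v : L12 mu v -> ip mu (ker c v) (ker c v) <= ip mu v v.
Proof. by move=> lv; have [] := ker_contraction c2 lv. Qed.

Lemma kerB u v : L12 mu u -> L12 mu v ->
  ker c (fun x => u x - v x) = (fun xi => ker c u xi - ker c v xi).
Proof.
move=> lu lv; have := kerD c lu.2 (L12Z (-1) lv).2; rewrite (kerZ _ _ lv.2).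
under eq_fun do rewrite mulN1r.
by move=> ->; apply/funext => xi; rewrite mulN1r.
Qed.

Lemma nrm_ker_le v : L12 mu v -> nrm mu (ker c v) <= nrm mu v.
Proof. by move=> lv; apply: ler_wsqrtr; exact: ker_ip_le. Qed.

(* A contraction preserves the inner products with every vector whose norm it
   preserves: expand [|K (z + s g)|^2 <= |z + s g|^2] and let [s] vary. *)
Lemma isometric_at_norm g : L12 mu g ->
  ip mu (ker c g) (ker c g) = ip mu g g -> isometric_at g.
Proof.
move=> lg gg; split=> // z lz; apply/eqP; rewrite -subr_eq0; apply/eqP.
set D := _ - _; have [//|D0] := eqVneq D 0.
(* With this [s] the defect [2 s D] exceeds by one what the contraction property of [z + s g]
   allows. *)
pose s := (ip mu z z - ip mu (ker c z) (ker c z) + 1) / (2 * D).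
have := ker_ip_le (L12D lz (L12Z s%:C lg)).
rewrite (kerD _ lz.2 (L12Z s%:C lg).2) (kerZ _ _ lg.2).
rewrite (ip_comb s (sqi_ker lz) (sqi_ker lg)) (ip_comb s lz.1 lg.1) gg.
have -> : ip mu (ker c z) (ker c g) = D + ip mu z g by rewrite /D subrK.
have sD : 2 * s * D = ip mu z z - ip mu (ker c z) (ker c z) + 1.
  by rewrite /s; field.
by rewrite mulrDr sD => h; exfalso; lra.
Qed.

Lemma isometric_atD g h : isometric_at g -> isometric_at h ->
  isometric_at (fun x => g x + h x).
Proof.
move=> [lg Hg] [lh Hh]; split; first exact: L12D.
move=> z lz; rewrite (kerD _ lg.2 lh.2) !ipDr ?Hg ?Hh//; try exact: sqi_ker.
- exact: lg.1.
- exact: lh.1.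
- exact: lz.1.
Qed.

Lemma ip_conj (t : R[i]) (f h : V -> R[i]) :
  ip mu f (fun x => t * h x) = ip mu (fun x => (Re t -i* Im t) * f x) h.
Proof.
by apply: eq_Rintegral => x _; case: t => a b; rewrite /rdot !RIE /=; ring.
Qed.

Lemma isometric_atZ (t : R[i]) g : isometric_at g -> isometric_at (fun x => t * g x).
Proof.
move=> [lg Hg]; split; first exact: L12Z.
move=> z lz; rewrite (kerZ _ _ lg.2) !ip_conj -(kerZ _ _ lz.2) Hg//.
exact: L12Z.
Qed.

Lemma isometric_at0 : isometric_at (fun=> 0).
Proof.
have l0 : L12 mu (fun=> 0) by split; [exact: sqi0|split; exact: integrable0].
split=> // z lz; have -> : ker c (fun=> 0) = (fun xi : V => 0 * ker c (fun=> 0) xi).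
  rewrite -[RHS](kerZ c 0 l0.2); congr ker.
  by apply/funext => x; rewrite mul0r.
have r0 (w h : V -> R[i]) : (forall x, h x = 0) -> ip mu w h = 0.
  move=> h0; rewrite /ip /Rintegral integral0_eq// => x _.
  by rewrite /rdot h0 /= !mulr0 addr0.
by rewrite !r0// => x; rewrite mul0r.
Qed.

(** The contraction property carries the convergence of the [g_ n] over to their transforms, and
    inner products are continuous. *)
Lemma isometric_at_cvg (g_ : nat -> V -> R[i]) g : (forall n, isometric_at (g_ n)) ->
  L12 mu g -> nrm mu (fun x => g_ n x - g x) @[n --> \oo] --> 0 ->
  isometric_at g.
Proof.
move=> Mg lg gg; split=> // z lz.
have Kg : nrm mu (fun x => ker c (g_ n) x - ker c g x) @[n --> \oo] --> 0.
  apply: (cvg_bound_dist _ gg); apply: nearW => n.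
  rewrite subr0 ger0_norm ?nrm_ge0// -kerB//; last by case: (Mg n).
  by apply: nrm_ker_le; apply: L12B => //; case: (Mg n).
have sg n : sqi mu (g_ n) by case: (Mg n) => -[].
have lgn n : L12 mu (g_ n) by case: (Mg n).
have h1 := ip_cvg (fun n => sqi_ker (lgn n)) (sqi_ker lg) (sqi_ker lz) Kg.
have h2 := ip_cvg sg lg.1 lz.1 gg.
have e : (fun n => ip mu (ker c (g_ n)) (ker c z)) = (fun n => ip mu (g_ n) z).
  by apply/funext => n; rewrite ipC (ipC _ (g_ n)); case: (Mg n) => _; apply.
rewrite e in h1; rewrite ipC (ipC _ z).
exact: (cvg_unique (@Rhausdorff R) h1 h2).
Qed.

Lemma isometric_at_box l r : isometric_at (ind (box l r)).
Proof.
have lB := L12_ind_box l r; have mB := measurable_box l r.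
have [lr|/existsNP[i /negP]] := pselect (forall i, l i < r i); last first.
  rewrite -leNgt => rl; rewrite (_ : ind _ = fun=> 0); first exact: isometric_at0.
  apply/funext => x; rewrite /ind indicE memNset//= => /(_ i)/andP[h1 h2].
  by have := lt_trans h1 h2; rewrite ltNge rl.
apply: isometric_at_norm => //; apply/eqP; rewrite eq_le ker_ip_le//=.
pose a n : R := n.+1%:R^-1.
have a0 n : 0 < a n by rewrite invr_gt0.
(* The value at [x] of the Poisson kernel convolved with the indicator of the box, for the parameter
   [a n]. *)
pose J n (x : V) := \prod_(i < N) (pi^-1 * atan (2 * pi / a n * (r i - tnth x i)) -
  pi^-1 * atan (2 * pi / a n * (l i - tnth x i))).
have JE n x : (\int[mu]_y (\1_(box l r) y * pk (a n) x y)%:E = (J n x)%:E)%E.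
  under eq_integral do rewrite indic_box -big_split /=.
  rewrite (@integral_tensor _ _ (fun i t =>
    \1_(`]l i, r i[%classic : set R) t * pois1 (a n) (tnth x i - t)) (fun i =>
    pi^-1 * atan (2 * pi / a n * (r i - tnth x i)) -
    pi^-1 * atan (2 * pi / a n * (l i - tnth x i))))//.
  - move=> i; apply: measurable_funM; first exact: measurable_indic.
    by apply: continuous_measurable_fun; exact: continuous_pois1B.
  - by move=> i t; rewrite mulr_ge0 ?pois1_ge0.
  - by move=> i; exact: integral_indic_itv_pois1.
(* The upper bound is the mass one of the kernel; it provides the dominating function for the limit
   below. *)
have J01 n x : 0 <= J n x <= 1.
  rewrite -!lee_fin -JE integral_ge0/=; last first.
    by move=> y _; rewrite lee_fin mulr_ge0 ?pk_ge0.
  rewrite -(integral_pk x (a0 n)); apply: ge0_le_integral => //.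
  - by move=> y _; rewrite lee_fin mulr_ge0 ?pk_ge0.
  - apply/measurable_EFinP; apply: measurable_funM; first exact: measurable_indic.
    exact: measurable_pk.
  - by apply/measurable_EFinP; exact: measurable_pk.
  - by move=> y _; rewrite lee_fin ler_piMl ?pk_ge0// indicE.
have crossE n x : Rintegral mu setT (cross (a n) (ind (box l r)) x) =
    \1_(box l r) x * J n x.
  rewrite (_ : J n x = Rintegral mu setT (fun y => \1_(box l r) y * pk (a n) x y)).
    rewrite -RintegralZl//.
      apply: eq_Rintegral => y _.
      by rewrite /cross /ind /= mulr0 addr0 mulrA.
    apply/integrableP; split.
      apply/measurable_EFinP; apply: measurable_funM; first exact: measurable_indic.
      exact: measurable_pk.
    under eq_integral do rewrite gee0_abs ?lee_fin ?mulr_ge0 ?pk_ge0//.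
    by rewrite JE ltry.
  by rewrite /Rintegral JE.
have mJ n : measurable_fun setT (fun x => \1_(box l r) x * J n x).
  under eq_fun do rewrite -crossE.
  exact: (measurable_Rintegral_section mu (measurable_cross (a0 n) lB.1.1)).
have iB := integrable_indic_fin mB (box_lty l r).
have H : Rintegral mu setT (fun x => \1_(box l r) x * J n x) @[n --> \oo] -->
    Rintegral mu setT \1_(box l r).
  have mE n : measurable_fun setT (fun x => (\1_(box l r) x * J n x)%:E).
    by apply/measurable_EFinP; exact: mJ.
  have cv : {ae mu, forall x, setT x ->
      (\1_(box l r) x * J n x)%:E @[n --> \oo] --> (\1_(box l r) x)%:E}.
    apply: nearW => x _; apply: cvg_EFin; first exact: nearW.
    rewrite indicE; case: (boolP (x \in box l r)) => xB.
      under eq_fun do rewrite /= mul1r.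
      by apply: cvg_box_conv => //; move: xB; rewrite inE.
    by under eq_fun do rewrite /= mul0r; exact: cvg_cst.
  have dom : {ae mu, forall x n, setT x ->
      (`|(\1_(box l r) x * J n x)%:E| <= (\1_(box l r) x)%:E)%E}.
    apply: nearW => x n _; have /andP[J0 J1] := J01 n x.
    by rewrite lee_fin normrM (ger0_norm J0) ger0_norm// ler_piMr.
  have [_ _ H] := dominated_convergence measurableT mE (measurable_int _ iB)
    cv iB dom.
  apply: fine_cvg; rewrite /Rintegral fineK; first exact: H.
  exact: (integrable_fin_num measurableT iB).
(* The measure of the box is the limit of these integrals. By [energy] each is the squared norm of
   the transform weighted by [phiN], hence at most the unweighted one. *)
rewrite ip_ind//; apply: (cvg_le_cst H) => n.
under eq_Rintegral do rewrite -crossE.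
rewrite -(energy (a0 n) c2 lB.2).
have sk := sqi_ker lB.
have sg : sqi mu (gauged (a n) (ker c (ind (box l r)))).
  apply: (@sqiM _ _ _ mu _ 1) => //; first exact: cmeas_phiN.
  move=> x; rewrite sqr_normcR -[leRHS](expr1n _ 2) ler_pXn2r ?nnegrE ?phiN_ge0//.
  by rewrite phiN_le1// ltW.
move: (ker c _) sk sg => w sk sg.
apply: le_Rintegral => //; try exact: integrable_rdot.
move=> x _; rewrite /rdot /gauged !RIE /= !mul0r subr0 addr0.
have := phiN_le1 x (ltW (a0 n)); have := phiN_ge0 (a n) x.
move: (phiN _ _) (Re (w x)) (Im (w x)) => p q s p0 p1.
rewrite ![_ * (p * _)]mulrCA -mulrDr ler_piMl//.
by rewrite -!expr2 addr_ge0// sqr_ge0.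
Qed.

End isometry.

(** * From boxes to all functions in L1 and L2 *)

Section box_generation.
Context {R : realType} {N : nat}.
Local Notation V := (Rn R N).

Definition boxes : set (set V) := [set B | exists l r, B = box l r].

Definition cube (k : nat) : set V := box (fun=> - k%:R) (fun=> k%:R).

Lemma cube_cover (x : V) : exists k, forall n, (k <= n)%N -> cube n x.
Proof.
pose M := \sum_(i < N) `|tnth x i|.
have [k kM] : exists k : nat, M < k%:R.
  exists (Num.truncn M).+1; rewrite -[X in X < _]ger0_norm ?sumr_ge0//.
  by rewrite ger0_norm ?sumr_ge0// truncnS_gt.
exists k => n kn i; rewrite -ltr_norml.
apply: (@le_lt_trans _ _ M).
  by rewrite /M (bigD1 i)//= lerDl sumr_ge0.
by rewrite (lt_le_trans kM)// ler_nat.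
Qed.

(** The product sigma-algebra is generated by the preimages of open intervals under the coordinates,
    and each such preimage is a union of boxes whose other sides grow. *)
Lemma measurable_boxes : @measurable _ V = <<s boxes >>.
Proof.
apply/seteqP; split; last first.
  apply: smallest_sub; first exact: sigma_algebra_measurable.
  by move=> _ [l [r ->]]; exact: measurable_box.
apply: smallest_sub; first exact: smallest_sigma_algebra.
rewrite -bigcup_seq => A [i _ [B mB <-]].
have {}mB : (@RGenOpens.G R).-sigma.-measurable B.
  by rewrite -RGenOpens.measurableE.
have : preimage_set_system setT (fun x : V => tnth x i)
    (@RGenOpens.G R).-sigma.-measurable (setT `&` (fun x : V => tnth x i) @^-1` B).
  by exists B.
rewrite -g_sigma_preimageE; apply: smallest_sub; first exact: smallest_sigma_algebra.
move=> _ [_ [p [q ->]] <-]; rewrite setTI.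
pose F k := box (fun j => if j == i then p else - (k%:R : R))
  (fun j => if j == i then q else k%:R).
rewrite (_ : _ @^-1` _ = \bigcup_k F k).
  apply: sigma_algebra_bigcup => k.
  by apply: sub_sigma_algebra; eexists; eexists.
apply/seteqP; split => x /=; rewrite in_itv/=.
  move=> xpq; have [k xk] := cube_cover x; exists k => // j.
  by case: eqVneq => [->//|_]; exact: xk.
by move=> [k _ /(_ i)]; rewrite eqxx.
Qed.

Lemma boxes_setI_closed : setI_closed boxes.
Proof.
by move=> _ _ [l [r ->]] [l' [r' ->]]; rewrite box_setI; eexists; eexists.
Qed.

End box_generation.

Section plancherel.
Context {R : realType} {N : nat}.
Local Notation V := (Rn R N).
Local Notation mu := (lebesgueN R N).
Implicit Types (u v g z : V -> R[i]) (E : set V).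
Variable c : R.
Hypothesis c2 : c ^+ 2 = (2 * pi) ^+ 2.

(** Dynkin's theorem. Intersecting with a cube keeps complements and countable unions at finite
    measure, so that their indicators stay in [L12]. Complements become differences of indicators,
    disjoint unions become limits of sums. *)
Lemma isometric_at_measurable k E : measurable E ->
  isometric_at c (ind (E `&` cube k)).
Proof.
have mC := @measurable_box R N (fun=> - k%:R) (fun=> k%:R).
have lC := @L12_ind_box R N (fun=> - k%:R) (fun=> k%:R).
have lI A : measurable A -> L12 mu (ind (A `&` cube k)).
  move=> mA; apply: L12_ind; first exact: measurableI.
  apply: le_lt_trans (box_lty (fun=> - k%:R) (fun=> k%:R)).
  by apply: le_measure; rewrite ?inE//; exact: measurableI.
move=> mE; move: E {mE}(eq_ind _ (fun G => G E) mE _ measurable_boxes).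
apply: (dynkin_induction measurable_boxes boxes_setI_closed).
- by rewrite setTI; exact: isometric_at_box.
- move=> _ [l [r ->]]; rewrite /cube box_setI; exact: isometric_at_box.
- move=> S mS IS.
  have := isometric_atD c2 (isometric_at_box c2 (fun=> - k%:R) (fun=> k%:R))
    (isometric_atZ (-1) IS).
  rewrite (_ : (fun _ => _) = ind (~` S `&` cube k))//.
  apply/funext => x; rewrite /ind !indicE !in_setI in_setC mulN1r /cube.
  by case: (x \in S); case: (x \in box _ _); rewrite /= ?subrr ?subr0.
- move=> F mF tF IF.
  pose G n := \big[setU/set0]_(j < n) F j.
  have mG n : measurable (G n) by exact: bigsetU_measurable.
  have mU : measurable (\bigcup_j F j) by exact: bigcup_measurable.
  have IG n : isometric_at c (ind (G n `&` cube k)).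
    elim: n => [|n IHn].
      rewrite /G big_ord0 set0I (_ : ind _ = fun=> 0); first exact: isometric_at0.
      by apply/funext => x; rewrite /ind indic0.
    have := isometric_atD c2 IHn (IF n).
    rewrite (_ : (fun _ => _) = ind (G n.+1 `&` cube k))//.
    apply/funext => x; rewrite /ind /G big_ord_recr/= -/(G n).
    have : ~~ ((x \in G n) && (x \in F n)).
      apply/negP => /andP[]; rewrite !inE /G -bigcup_mkord => -[j /= jn Fj] Fn.
      have := tF j n Logic.I Logic.I (ex_intro _ x (conj Fj Fn)).
      by move=> jn'; rewrite jn' ltnn in jn.
    rewrite !indicE !in_setI in_setU; case: (x \in G n); case: (x \in F n) => //= _;
      by apply/eqP; rewrite eq_complex /= ?(add0r, addr0) !eqxx.
  apply: (isometric_at_cvg c2 IG); first exact: lI.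
  have eG n : ind (G n `&` cube k) = restr (G n) (ind (\bigcup_j F j `&` cube k)).
    apply/funext => x; rewrite /restr /ind !indicE !in_setI.
    case: (boolP (x \in G n)) => xG /=; last by rewrite mul0r.
    rewrite mul1r (_ : x \in \bigcup_j F j)//; move: xG; rewrite !inE /G.
    by rewrite -bigcup_mkord => -[j _ Fj]; exists j.
  under eq_fun do rewrite eG.
  apply: (nrm_restrC_cvg0 mG (lI _ mU).1); apply: nearW => x.
  rewrite /ind indicE; case: (boolP (x \in _)) => [|_]; last by rewrite eqxx.
  rewrite inE => -[[j _ Fj] _] _; exists j.+1 => // n /= jn.
  by rewrite /G -bigcup_mkord; exists j.
Qed.

End plancherel.

Section plancherel_L12.
Import HBNNSimple.
Context {R : realType} {N : nat}.
Local Notation V := (Rn R N).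
Local Notation mu := (lebesgueN R N).
Implicit Types (u v w f g h z : V -> R[i]) (E : set V).
Variable c : R.
Hypothesis c2 : c ^+ 2 = (2 * pi) ^+ 2.

Lemma isometric_at_sum n (F : 'I_n -> V -> R[i]) :
  (forall i, isometric_at c (F i)) ->
  isometric_at c (fun x => \sum_(i < n) F i x).
Proof.
elim: n F => [|n IH] F HF.
  under eq_fun do rewrite big_ord0; exact: isometric_at0.
under eq_fun do rewrite big_ord_recl; apply: isometric_atD => //.
exact: IH.
Qed.

(** The alternative in the bound lets one lemma serve the positive and negative parts of both
    components of [f]. *)
Lemma L12_dominated (b : V -> R) f : measurable_fun setT b -> L12 mu f ->
  (forall x, `|b x| <= `|Re (f x)| \/ `|b x| <= `|Im (f x)|) ->
  L12 mu (fun x => (b x)%:C).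
Proof.
move=> mb [sf jf] bf; have iB := integrable_abs1 jf; split.
  apply: (@sqi_le _ _ _ mu _ f 1) => //.
  move=> x; rewrite mul1r sqr_normcR sqr_normc -(real_normK (num_real (b x))).
  rewrite -[X in _ <= X + _]real_normK ?num_real// -[X in _ <= _ + X]real_normK ?num_real//.
  have := sqr_ge0 `|Re (f x)|; have := sqr_ge0 `|Im (f x)|.
  by case: (bf x) => h; have := lerXn2r 2 _ _ h;
    rewrite ?nnegrE ?normr_ge0 => /(_ isT isT) ? ? ?; lra.
split; last exact: integrable0.
apply: le_integrable iB => //; first exact/measurable_EFinP.
move=> x _ /=; rewrite lee_fin (le_trans _ (ler_norm _))// /abs1.
by case: (bf x) => h; rewrite (le_trans h)// ?lerDl ?lerDr.
Qed.

(** Simple functions below [b], cut off to growing cubes, are finite combinations of the indicators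
    already treated, and converge to [b] in norm by domination. *)
Lemma isometric_at_ge0 (b : V -> R) : measurable_fun setT b ->
  (forall x, 0 <= b x) -> L12 mu (fun x => (b x)%:C) ->
  isometric_at c (fun x => (b x)%:C).
Proof.
move=> mb b0 lb; have mB : measurable_fun setT (EFin \o b) by apply/measurable_EFinP.
have B0 x : setT x -> (0 <= (EFin \o b) x)%E by rewrite lee_fin.
pose s n := nnsfun_approx measurableT mB n.
have s0 n x : 0 <= s n x by exact: fun_ge0.
have sb n x : s n x <= b x by rewrite -lee_fin /s nnsfun_approxE; exact: le_approx.
have scvg x : s n x @[n --> \oo] --> b x.
  exact: (fine_cvg (cvg_nnsfun_approx measurableT mB B0 (Logic.I : setT x))).
pose g n x : R[i] := (\1_(cube n) x * s n x)%:C.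
have gM n : isometric_at c (g n).
  have E x : g n x = \sum_(i < #|`fset_set (range (s n))|)
      ((fset_set (range (s n)))`_i)%:C *
      ind ((s n) @^-1` [set (fset_set (range (s n)))`_i] `&` cube n) x.
    rewrite /g (fimfunEord (s n)) mulr_sumr rmorph_sum; apply: eq_bigr => i _.
    by rewrite /ind indicI /= -rmorphM; congr (_%:C); ring.
  rewrite (funext E); apply: isometric_at_sum => i; apply: isometric_atZ.
  by apply: isometric_at_measurable.
have g01 n x : 0 <= \1_(cube n) x * s n x <= b x.
  by rewrite mulr_ge0//= (le_trans _ (sb n x))// ler_piMl// indicE.
apply: (isometric_at_cvg c2 gM lb); apply: (nrm_dominated (g := fun x => (b x)%:C)).
- by move=> n; apply: (sqiB (gM n).1.1 lb.1).1.
- exact: lb.1.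
- move=> n x; rewrite /g -rmorphB !sqr_normcR.
  have /andP[] := g01 n x; move: (\1_(cube n) x * s n x) (b x) => p q p0 pq.
  by rewrite -subr_ge0 in pq; have := mulr_ge0 p0 pq; nra.
- apply: nearW => x; have [k xk] := cube_cover x.
  have H : (s n x - b x) ^+ 2 @[n --> \oo] --> (0 : R).
    have h : s n x - b x @[n --> \oo] --> (0 : R).
      by rewrite -(subrr (b x)); apply: cvgB => //; exact: cvg_cst.
    rewrite -[X in _ --> X](mulr0 (0 : R)).
    by under eq_fun do rewrite expr2; exact: cvgM.
  apply: cvg_trans H; apply: near_eq_cvg; exists k => // n /= kn.
  rewrite /g indicE mem_set ?mul1r; last exact: xk.
  by rewrite /= subrr expr0n addr0 sqr_sqrtr ?sqr_ge0.
Qed.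

Lemma plancherel_L12 f : L12 mu f -> isometric_at c f.
Proof.
move=> lf; have [m1 m2] := lf.1.1.
have pos (b : V -> R) : measurable_fun setT b ->
    (forall x, `|b x| <= `|Re (f x)| \/ `|b x| <= `|Im (f x)|) ->
    isometric_at c (fun x => (b x)%:C).
  move=> mb bf.
  have mp : measurable_fun setT (fun x => Num.max (b x) 0) by exact: measurable_maxr.
  have mn : measurable_fun setT (fun x => Num.max (- b x) 0).
    by apply: measurable_maxr => //; exact: measurableT_comp.
  have ip1 : isometric_at c (fun x => (Num.max (b x) 0)%:C).
    apply: isometric_at_ge0 => //; first by move=> x; rewrite le_max lexx orbT.
    apply: (L12_dominated mp lf) => x.
    have le : `|Num.max (b x) 0| <= `|b x| by case: (leP (b x) 0); rewrite ?normr0.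
    by case: (bf x) => h; [left|right]; exact: le_trans h.
  have in1 : isometric_at c (fun x => (Num.max (- b x) 0)%:C).
    apply: isometric_at_ge0 => //; first by move=> x; rewrite le_max lexx orbT.
    apply: (L12_dominated mn lf) => x.
    have le : `|Num.max (- b x) 0| <= `|b x|.
      by case: (leP (- b x) 0); rewrite ?normr0// normrN.
    by case: (bf x) => h; [left|right]; exact: le_trans h.
  have := isometric_atD c2 ip1 (isometric_atZ (-1) in1).
  rewrite (_ : (fun _ => _) = (fun x => (b x)%:C))//; apply/funext => x.
  rewrite mulN1r -rmorphB /=; congr (_%:C).
  by case: (leP (b x) 0); case: (leP (- b x) 0); lra.
have := isometric_atD c2 (pos _ m1 (fun x => or_introl (lexx _)))
  (isometric_atZ 'i (pos _ m2 (fun x => or_intror (lexx _)))).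
rewrite (_ : (fun _ => _) = f)//; apply/funext => x.
by case: (f x) => a b; apply/eqP; rewrite eq_complex /=; apply/andP; split; apply/eqP; ring.
Qed.

End plancherel_L12.

(** * Extension to L2 and Fourier inversion *)

Section plancherel_L2.
Context {R : realType} {N : nat}.
Local Notation V := (Rn R N).
Local Notation mu := (lebesgueN R N).
Implicit Types (u v w f g h z : V -> R[i]) (c : R).

(** The working form of [L2_extension], for Borel square integrable functions, where the extended
    norm becomes the real number [nrm]. *)
Definition ext c u w := exists u_ : nat -> V -> R[i],
  [/\ forall n, L12 mu (u_ n),
      nrm mu (fun x => u_ n x - u x) @[n --> \oo] --> 0 &
      nrm mu (fun x => ker c (u_ n) x - w x) @[n --> \oo] --> 0].

(** Both signs of [2 * pi] qualify, so each result covers the transform and its inverse. *)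
Definition tau_sqr c := c ^+ 2 = (2 * pi) ^+ 2.

Lemma tau_sqrN c : tau_sqr c -> tau_sqr (- c).
Proof. by rewrite /tau_sqr sqrrN. Qed.

Lemma L2_extension_ext c K u w u' w' : tau_sqr c -> (forall v, K v = ker c v) ->
  L2_extension K u w -> sqi mu u' -> sqi mu w' ->
  (\forall x \ae mu, u x = u' x) -> (\forall x \ae mu, w x = w' x) ->
  ext c u' w'.
Proof.
move=> c2 KE [_ _ [u_ [iu uu uw]]] su sw eu ew.
have lu n : L12 mu (u_ n).
  have [i1 l1] := iu n; split=> //.
  have [g sg ug] := L2_version l1.
  by apply: (sqi_version (cint1_cmeas i1) sg).
exists u_; split=> //.
  apply: L2_cvg_version uu => //; by move=> n; case: (lu n).
apply: (L2_cvg_version (fun n => sqi_ker c2 (lu n)) sw ew).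
by under eq_fun do rewrite -KE.
Qed.

(** True for the approximants by [ker_duality]; the left side passes to the limit by convergence of
    their transforms, the right side by their own. *)
Lemma ext_duality c u w g : tau_sqr c -> sqi mu u -> sqi mu w -> ext c u w ->
  L12 mu g -> ip mu w g = ip mu u (ker (- c) g).
Proof.
move=> c2 su sw [u_ [lu uu uw]] lg.
have h1 := ip_cvg (fun n => sqi_ker c2 (lu n)) sw lg.1 uw.
have h2 := ip_cvg (fun n => (lu n).1) su (sqi_ker (tau_sqrN c2) lg) uu.
have e : (fun n => ip mu (ker c (u_ n)) g) = (fun n => ip mu (u_ n) (ker (- c) g)).
  by apply/funext => n; rewrite ker_duality//; [case: (lu n)|case: lg].
rewrite e in h1; exact: (cvg_unique (@Rhausdorff R) h1 h2).
Qed.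

Lemma ext_isometric c u w g : tau_sqr c -> sqi mu u -> sqi mu w -> ext c u w ->
  L12 mu g -> ip mu w (ker c g) = ip mu u g.
Proof.
move=> c2 su sw [u_ [lu uu uw]] lg.
have h1 := ip_cvg (fun n => sqi_ker c2 (lu n)) sw (sqi_ker c2 lg) uw.
have h2 := ip_cvg (fun n => (lu n).1) su lg.1 uu.
have e : (fun n => ip mu (ker c (u_ n)) (ker c g)) = (fun n => ip mu (u_ n) g).
  by apply/funext => n; case: (plancherel_L12 c2 lg) => _; apply.
rewrite e in h1; exact: (cvg_unique (@Rhausdorff R) h1 h2).
Qed.

Lemma ext_nrm c u w : tau_sqr c -> sqi mu u -> sqi mu w -> ext c u w ->
  nrm mu w = nrm mu u.
Proof.
move=> c2 su sw [u_ [lu uu uw]].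
have h1 := nrm_cvg (fun n => sqi_ker c2 (lu n)) sw uw.
have h2 := nrm_cvg (fun n => (lu n).1) su uu.
have e : (fun n => nrm mu (ker c (u_ n))) = (fun n => nrm mu (u_ n)).
  apply/funext => n; congr Num.sqrt.
  by case: (plancherel_L12 c2 (lu n)) => _; apply.
rewrite e in h1; exact: (cvg_unique (@Rhausdorff R) h1 h2).
Qed.

Lemma measurable_cube k : measurable (@cube R N k).
Proof. exact: measurable_box. Qed.

Lemma nrm_restr_cube w : sqi mu w ->
  nrm mu (fun x => restr (cube n) w x - w x) @[n --> \oo] --> 0.
Proof.
move=> sw; apply: nrm_restrC_cvg0 => //; first exact: measurable_cube.
apply: nearW => x _; by have [k xk] := cube_cover x; exists k.
Qed.

Lemma L12_restr_cube k w : sqi mu w -> L12 mu (restr (cube k) w).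
Proof. by apply: L12_restr; [exact: measurable_cube|exact: box_lty]. Qed.

(** Testing with the restriction of [v - w] to a cube shows that [v - w] has norm zero there, and
    the cubes exhaust the space. *)
Lemma ae_eq_tested v w : sqi mu v -> sqi mu w ->
  (forall g, L12 mu g -> ip mu v g = ip mu w g) -> \forall x \ae mu, v x = w x.
Proof.
move=> sv sw H; have sB := sqiB sv sw; set z := fun x => v x - w x in sB.
have z0 : nrm mu z = 0.
  have sr n : sqi mu (restr (cube n) z) by apply: sqi_restr => //; exact: measurable_cube.
  have := nrm_cvg sr sB (nrm_restr_cube sB).
  rewrite (_ : (fun n => _) = cst 0); last first.
    apply/funext => n; rewrite /nrm ip_restrl restrK /z ipBl//.
    by rewrite (H _ (L12_restr_cube n sB)) subrr sqrtr0.
  by move=> h; apply: (cvg_unique (@Rhausdorff R) h); exact: cvg_cst.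
by apply: filterS (nrm_eq0 sB z0) => x /eqP; rewrite subr_eq0 => /eqP.
Qed.

(** Tested with [g], inversion is duality followed by isometry: [w] against [g] equals [f] against
    [ker c g], which equals [v] against [g]. No inversion integral is evaluated. *)
Lemma ext_inversion c v f w : tau_sqr c -> sqi mu v -> sqi mu f -> sqi mu w ->
  ext c v f -> ext (- c) f w -> \forall x \ae mu, w x = v x.
Proof.
move=> c2 sv sf sw vf fw; apply: ae_eq_tested => // g lg.
rewrite (ext_duality (tau_sqrN c2) sf sw fw lg) opprK.
exact: ext_isometric.
Qed.

Lemma extB c u w u' w' : tau_sqr c -> sqi mu u -> sqi mu w -> sqi mu u' ->
  sqi mu w' -> ext c u w -> ext c u' w' ->
  ext c (fun x => u x - u' x) (fun x => w x - w' x).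
Proof.
move=> c2 su sw su' sw' [a [la au aw]] [b [lb bu bw]].
exists (fun n x => a n x - b n x); split.
- by move=> n; exact: L12B.
- apply: (@cvg_bound_dist _ _ _ _ _ (fun n => nrm mu (fun x => a n x - u x) +
    nrm mu (fun x => b n x - u' x))); last by rewrite -(addr0 0); exact: cvgD.
  apply: nearW => n; rewrite subr0 ger0_norm ?nrm_ge0//.
  rewrite (nrmB mu _ u') (_ : (fun x => _) =
    (fun x => (a n x - u x) + (u' x - b n x))); last first.
    by apply/funext => x; ring.
  by apply: nrmD; apply: sqiB => //; [case: (la n)|case: (lb n)].
- apply: (@cvg_bound_dist _ _ _ _ _ (fun n => nrm mu (fun x => ker c (a n) x - w x) +
    nrm mu (fun x => ker c (b n) x - w' x))); last by rewrite -(addr0 0); exact: cvgD.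
  apply: nearW => n; rewrite subr0 ger0_norm ?nrm_ge0//.
  rewrite kerB// (nrmB mu _ w') (_ : (fun x => _) =
    (fun x => (ker c (a n) x - w x) + (w' x - ker c (b n) x))); last first.
    by apply/funext => x; ring.
  by apply: nrmD; apply: sqiB => //; exact: sqi_ker.
Qed.

Lemma nrmZ (t : R[i]) v : sqi mu v -> nrm mu (fun x => t * v x) = normc t * nrm mu v.
Proof.
move=> sv; rewrite /nrm -[normc t]ger0_norm ?normc_ge0// -sqrtr_sqr -sqrtrM ?sqr_ge0//.
congr Num.sqrt; rewrite /ip -RintegralZl//; last exact: integrable_rdot.
apply: eq_Rintegral => x _; rewrite /rdot sqr_normc !RIE; ring.
Qed.

Lemma extZ c (t : R[i]) u w : tau_sqr c -> sqi mu u -> sqi mu w -> ext c u w ->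
  ext c (fun x => t * u x) (fun x => t * w x).
Proof.
move=> c2 su sw [a [la au aw]]; exists (fun n x => t * a n x); split.
- by move=> n; exact: L12Z.
- under eq_fun do under [X in nrm _ X]eq_fun do rewrite -mulrBr.
  under eq_fun => n do rewrite (nrmZ t (sqiB (la n).1 su)).
  by rewrite -(mulr0 (normc t)); exact: cvgMr.
- rewrite (_ : (fun n => _) =
    (fun n => normc t * nrm mu (fun x => ker c (a n) x - w x))).
    by rewrite -(mulr0 (normc t)); exact: cvgMr.
  apply/funext => n; rewrite (kerZ _ _ (la n).2) -nrmZ.
    by congr nrm; apply/funext => x; rewrite mulrBr.
  by apply: sqiB => //; exact: sqi_ker.
Qed.

End plancherel_L2.

(** * Derivatives on [0, T] *)

Section time.
Context {R : realType}.
Variable T : R.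
Hypothesis T0 : 0 < T.
Implicit Types (f : R -> R) (s t a b e l : R).

Lemma near_within_dnbhs t (P : R -> Prop) :
  (\forall s \near within `[0, T] t^', P s) <->
  exists2 e, 0 < e &
    forall s, s \in `[0, T] -> s != t -> `|s - t| < e -> P s.
Proof.
split.
  rewrite near_withinE => /nbhs_ballP[e /= e0 H]; exists e => // s sT st se.
  by apply: (H s) => //; rewrite /ball/= distrC.
move=> [e e0 H]; rewrite near_withinE; apply/nbhs_ballP; exists e => // s.
by rewrite /ball/= distrC => se st sT; exact: H.
Qed.

Lemma derive_in_approx f t e : derivable_in T f t -> 0 < e ->
  exists2 d, 0 < d & forall s, s \in `[0, T] -> s != t -> `|s - t| < d ->
    `|difference_quotient f t s - derive_in T f t| <= e.
Proof.
move=> df e0; apply/near_within_dnbhs.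
move: df; rewrite /derivable_in => /cvgrPdist_le /(_ _ e0).
by apply: filterS => s; rewrite distrC.
Qed.

Lemma is_derive_in f t : t \in `]0, T[ -> derivable_in T f t ->
  is_derive t 1 f (derive_in T f t).
Proof.
rewrite in_itv/= => /andP[t0 tT] df.
suff H : h^-1 *: ((f \o shift t) (h *: (1 : R)) - f t) @[h --> (0 : R)^'] --> derive_in T f t.
  by split; [apply/cvg_ex; eexists; exact: H|exact: (cvg_lim _ H)].
apply/cvgrPdist_le => e e0; have [d d0 H] := derive_in_approx df e0.
near=> h; rewrite distrC /=.
have h0 : h != 0 by near: h; exact: nbhs_dnbhs_neq.
have hd : `|h| < d by near: h; exact: dnbhs0_lt.
have ht : `|h| < t by near: h; exact: dnbhs0_lt.
have hT : `|h| < T - t by near: h; apply: dnbhs0_lt; rewrite subr_gt0.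
have := H (h + t); rewrite /difference_quotient addrK [_^-1 *: _]mulrC.
rewrite /GRing.scale/= mulr1; apply => //.
- rewrite in_itv/=; move: ht hT; rewrite !ltr_norml => /andP[h1 _] /andP[_ h2].
  by apply/andP; split; lra.
- by rewrite -subr_eq0 addrK.
Unshelve. all: by end_near. Qed.

Lemma continuous_in f t : derivable_in T f t -> f s @[s --> within `[0, T] (nbhs t)] --> f t.
Proof.
move=> df; apply/cvgrPdist_le => e e0.
have [d d0 H] := derive_in_approx df (@ltr01 R).
pose D := `|derive_in T f t| + 1.
have D0 : 0 < D by rewrite ltr_wpDl.
rewrite near_withinE; near=> s => /= sT; rewrite distrC.
have [->|st] := eqVneq s t; first by rewrite subrr normr0 ltW.
have sd : `|s - t| < d by near: s; exact: cvgr_distC_lt.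
have se : `|s - t| < e / D by near: s; apply: cvgr_distC_lt; rewrite // divr_gt0.
have st0 : s - t != 0 by rewrite subr_eq0.
have := H s sT st sd; rewrite /difference_quotient => h.
have h2 : `|(f s - f t) / (s - t)| <= D.
  by rewrite -[X in `|X|](subrK (derive_in T f t)) (le_trans (ler_normD _ _))// addrC lerD2l.
rewrite -[f s - f t](divfK st0) normrM.
by rewrite (le_trans (ler_pM _ _ h2 (ltW se)))// mulrC divfK// gt_eqF.
Unshelve. all: by end_near. Qed.

Lemma MVT_in f a b : (forall t, t \in `[0, T] -> derivable_in T f t) ->
  a \in `[0, T] -> b \in `[0, T] -> a < b ->
  exists2 c, c \in `]a, b[ & f b - f a = derive_in T f c * (b - a).
Proof.
rewrite !in_itv/= => df /andP[a0 aT] /andP[b0 bT] ab; apply: MVT => //.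
  move=> x; rewrite in_itv/= => /andP[ax xb]; apply: is_derive_in.
    by rewrite in_itv/= (le_lt_trans a0 ax) (lt_le_trans xb bT).
  by apply: df; rewrite in_itv/= (ltW (le_lt_trans a0 ax)) (ltW (lt_le_trans xb bT)).
apply/subspace_continuousP => x /=; rewrite in_itv/= => /andP[ax xb].
have xT : x \in `[0, T] by rewrite in_itv/= (le_trans a0 ax) (le_trans xb bT).
apply: cvg_trans (continuous_in (df x xT)); apply: cvg_app.
apply: within_subset => z /=; rewrite !in_itv/= => /andP[az zb].
by rewrite (le_trans a0 az) (le_trans zb bT).
Qed.

(** Heine's theorem, from compactness in its covering form: a radius valid locally near each point
    can be taken uniform. *)
Lemma unif_continuous_in (g : R -> R) e : {within `[0, T], continuous g} -> 0 < e ->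
  exists2 d, 0 < d & forall x y, x \in `[0, T] -> y \in `[0, T] ->
    `|x - y| < d -> `|g x - g y| <= e.
Proof.
move=> /subspace_continuousP cg e0.
have cK : compact `[0, T]%classic by exact: segment_compact.
pose P (d x : R) := forall y, y \in `[0, T] -> `|x - y| < d -> `|g x - g y| <= e.
have cov := (near_covering_withinP _).2 ((compact_near_coveringP _).1 cK).
have H : \forall d \near (0 : R)^'+, `[0, T]%classic `<=` P d.
  apply: cov => x0 /= x0T.
  have /cvgrPdist_le /(_ (e / 2)) := cg x0 x0T.
  rewrite divr_gt0// => /(_ isT); rewrite near_withinE => /nbhs_ballP[r /= r0 H].
  near=> x d => /= xT y yT xyd.
  have xr : `|x0 - x| < r / 2 by near: x; apply: cvgr_dist_lt; rewrite // divr_gt0.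
  have dr : d < r / 2 by near: d; apply: nbhs_right_lt; rewrite divr_gt0.
  have h1 : `|g x0 - g x| <= e / 2.
    by apply: H => //; rewrite /ball/= (lt_trans xr)// ltr_pdivrMr// ltr_pMr// ltr1n.
  have h2 : `|g x0 - g y| <= e / 2.
    apply: H => //; rewrite /ball/= -(subrK x x0) -addrA (le_lt_trans (ler_normD _ _))//.
    rewrite [ltRHS](splitr r) ltrD//.
    exact: lt_trans dr.
  rewrite -(subrK (g x0) (g x)) -addrA (le_trans (ler_normD _ _))// [leRHS](splitr e).
  by rewrite lerD// distrC.
have [d [d0 dP]] : exists d, 0 < d /\ `[0, T]%classic `<=` P d.
  near (0 : R)^'+ => d; exists d; split; first by near: d; exact: nbhs_right_gt.
  by near: d.
by exists d => // x y xT yT; exact: dP.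
Unshelve. all: by end_near. Qed.

(* On each piece of the subdivision the mean value theorem replaces the value of
   the derivative at the left end by a difference quotient. *)
Lemma riemann_sum f a b e : C1_in T f -> a \in `[0, T] -> b \in `[0, T] -> a < b ->
  0 < e -> \forall n \near \oo,
  `|(f b - f a) / (b - a) -
    n.+1%:R^-1 * \sum_(k < n.+1) derive_in T f (a + (b - a) * (k%:R / n.+1%:R))| <= e.
Proof.
move=> [df cf] aT bT ab e0; have [d d0 dP] := unif_continuous_in cf e0.
have ba0 : 0 < b - a by rewrite subr_gt0.
near=> n; pose x (k : nat) := a + (b - a) * (k%:R / n.+1%:R).
have n0 : 0 < n.+1%:R :> R by [].
have nn0 : n.+1%:R != 0 :> R by [].
have stepE k : x k.+1 - x k = (b - a) / n.+1%:R.
  by rewrite /x -natr1; field.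
have step0 : 0 < (b - a) / n.+1%:R by rewrite divr_gt0.
have stepd : (b - a) / n.+1%:R < d.
  (* Any [n] with [n + 1] larger than [(b - a) / d] makes the mesh finer than the modulus [d]. *)
  rewrite ltr_pdivrMr// mulrC -ltr_pdivrMr//; near: n.
  exists (Num.truncn ((b - a) / d)) => // m /= km.
  by rewrite (lt_le_trans (truncnS_gt _))// ler_nat.
have xT k : (k <= n.+1)%N -> x k \in `[0, T].
  move=> kn; move: aT bT; rewrite !in_itv/= => /andP[a0 _] /andP[_ bT].
  have k1 : 0 <= (k%:R / n.+1%:R : R) <= 1.
    by rewrite divr_ge0//= ler_pdivrMr// mul1r ler_nat.
  rewrite /x; apply/andP; split.
    by rewrite addr_ge0// mulr_ge0 ?(ltW ba0)//; case/andP: k1.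
  rewrite (le_trans _ bT)// -lerBrDl ler_piMr ?(ltW ba0)//; by case/andP: k1.
have x0 : x 0%N = a by rewrite /x mul0r mulr0 addr0.
have xn : x n.+1 = b by rewrite /x divff// mulr1 addrC subrK.
have fE : f b - f a = \sum_(k < n.+1) (f (x k.+1) - f (x k)).
  by rewrite -x0 -xn -(telescope_sumr (fun k => f (x k)))// big_mkord.
have bE : (f b - f a) / (b - a) =
    n.+1%:R^-1 * \sum_(k < n.+1) ((f (x k.+1) - f (x k)) / (x k.+1 - x k)).
  under eq_bigr do rewrite stepE.
  rewrite -mulr_suml -fE; move: (n.+1%:R : R) nn0 => m m0.
  by field; rewrite m0 gt_eqF.
rewrite bE -mulrBr -sumrB normrM ger0_norm ?invr_ge0//.
rewrite ler_pdivrMl// (le_trans (ler_norm_sum _ _ _))//.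
apply: (@le_trans _ _ (\sum_(k < n.+1) e)); last first.
  by rewrite sumr_const card_ord mulr_natl.
apply: ler_sum => k _.
have xx : x k < x k.+1 by rewrite -subr_gt0 stepE.
have [c cx ->] := MVT_in df (xT k (ltnW (ltn_ord k))) (xT k.+1 (ltn_ord k)) xx.
have xk0 : x k.+1 - x k != 0 by rewrite gt_eqF// subr_gt0.
rewrite mulfK//; move: cx; rewrite in_itv/= => /andP[c1 c2].
apply: dP; last 2 first.
- exact: xT (ltnW (ltn_ord k)).
- rewrite ger0_norm ?subr_ge0 1?ltW// (lt_trans _ stepd)// -(stepE k).
  by rewrite ltrD2r.
have := xT k (ltnW (ltn_ord k)); have := xT k.+1 (ltn_ord k); rewrite !in_itv/=.
move=> /andP[_ h1] /andP[h2 _].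
by rewrite (le_trans h2 (ltW c1)) (le_trans (ltW c2) h1).
Unshelve. all: by end_near. Qed.

(** The interval is nondegenerate, so it has an end point [b] other than [t]; the sequence moves
    from [b] to [t] along the segment. It also shows that the filter of one-sided limits is
    proper. *)
Lemma within_dnbhs_seq t : t \in `[0, T] ->
  exists s_ : nat -> R, [/\ forall n, s_ n \in `[0, T], forall n, s_ n != t &
    s_ n @[n --> \oo] --> t].
Proof.
rewrite in_itv/= => /andP[t0 tT].
have [b [bT bt]] : exists b, b \in `[0, T] /\ b != t.
  have [->|] := eqVneq t 0; first by exists T; rewrite in_itv/= lexx (ltW T0) (gt_eqF T0).
  by rewrite eq_sym => h; exists 0; rewrite in_itv/= lexx (ltW T0).
exists (fun n => t + (b - t) * n.+1%:R^-1); split.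
- move=> n; move: bT; rewrite !in_itv/= => /andP[b0 bT].
  have h0 : 0 <= n.+1%:R^-1 :> R by rewrite invr_ge0.
  have h1 : n.+1%:R^-1 <= 1 :> R by rewrite invf_le1// ler1n.
  move: (n.+1%:R^-1) h0 h1 => r r0 r1; apply/andP; split; nra.
- move=> n; rewrite -subr_eq0 addrAC subrr add0r mulf_neq0 ?subr_eq0//.
- rewrite -[X in _ --> X](addr0 t) -(mulr0 (b - t)); apply: cvgD; first exact: cvg_cst.
  by apply: cvgMr; exact: cvg_harmonic.
Qed.

Lemma within_dnbhs_proper t : t \in `[0, T] -> ProperFilter (within `[0, T] t^').
Proof.
move=> tT; apply: Build_ProperFilter_ex => P /near_within_dnbhs[e e0 H].
have [s_ [sT st s0]] := within_dnbhs_seq tT.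
have /cvgrPdist_lt /(_ _ e0) [n _ nP] := s0.
by exists (s_ n); apply: H => //; rewrite distrC; exact: nP (leqnn n).
Qed.

(** Almost everywhere statements survive only countable intersections, and dominated convergence is
    sequential; this criterion returns to the full limit in [s]. *)
Lemma cvg_within_seq (phi : R -> R) t l :
  (forall s_ : nat -> R, (forall n, s_ n \in `[0, T]) -> (forall n, s_ n != t) ->
    s_ n @[n --> \oo] --> t -> phi (s_ n) @[n --> \oo] --> l) ->
  phi s @[s --> within `[0, T] t^'] --> l.
Proof.
move=> H; apply/cvgrPdist_le => e e0; apply/near_within_dnbhs.
apply: contrapT => nH.
have {nH} /choice[s_ sP] : forall n : nat, exists s, [/\ s \in `[0, T], s != t,
    `|s - t| < n.+1%:R^-1 & ~ `|l - phi s| <= e].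
  move=> n; apply: contrapT => nE; apply: nH; exists n.+1%:R^-1 => // s sT st sn.
  by apply: contrapT => h; apply: nE; exists s.
have st : s_ n @[n --> \oo] --> t.
  apply: (cvg_bound_dist _ (@cvg_harmonic R)); apply: nearW => n.
  by case: (sP n) => _ _ h _; exact: ltW.
have := H s_ (fun n => let: And4 h _ _ _ := sP n in h)
  (fun n => let: And4 _ h _ _ := sP n in h) st.
move=> /cvgrPdist_le /(_ _ e0) [n _ nP].
by case: (sP n) => _ _ _; apply; exact: nP (leqnn n).
Qed.

Lemma derive_in_cvg f t l : t \in `[0, T] ->
  difference_quotient f t s @[s --> within `[0, T] t^'] --> l ->
  derivable_in T f t /\ derive_in T f t = l.
Proof.
move=> tT H; have FF := within_dnbhs_proper tT.
by split; [apply/cvg_ex; exists l|exact: (cvg_lim _ H)].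
Qed.

Lemma derive_in_seq f t (s_ : nat -> R) : derivable_in T f t ->
  (forall n, s_ n \in `[0, T]) -> (forall n, s_ n != t) ->
  s_ n @[n --> \oo] --> t ->
  difference_quotient f t (s_ n) @[n --> \oo] --> derive_in T f t.
Proof.
move=> df sT sne st; apply/cvgrPdist_le => e e0.
have [d d0 H] := derive_in_approx df e0.
have /cvgrPdist_lt /(_ _ d0) := st; apply: filterS => n h.
by rewrite distrC; apply: H => //; rewrite distrC.
Qed.

End time.

(** * Weak and pointwise limits *)

Section weak_convergence.
Context d (T : measurableType d) (R : realType).
Implicit Types (E : set T).

Section bounded.
Variable mu : {measure set T -> \bar R}.
Implicit Types (f g h z : T -> R[i]).

Lemma restr_setC E f (x : T) : f x = restr E f x + restr (~` E) f x.
Proof.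
rewrite /restr !indicE in_setC; case: (_ \in _) => /=.
  by rewrite mul1r mul0r addr0.
by rewrite mul1r mul0r add0r.
Qed.

(* Off the set where [|z_ n - z| <= e |H|] for all large [n], the test function
   [H] is small in norm. *)
Lemma bounded_ptwise_weak_cvg (z_ : nat -> T -> R[i]) z H (M : R) :
  (forall n, sqi mu (z_ n)) -> sqi mu z -> sqi mu H ->
  (forall n, nrm mu (z_ n) <= M) ->
  (\forall x \ae mu, normc (z_ n x - z x) ^+ 2 @[n --> \oo] --> 0) ->
  ip mu (z_ n) H @[n --> \oo] --> ip mu z H.
Proof.
move=> sz_ sz sH zM zz; pose D n x := z_ n x - z x.
have sD n : sqi mu (D n) by exact: sqiB.
pose B := M + nrm mu z.
have DB n : nrm mu (D n) <= B.
  rewrite /D; under [X in nrm _ X]eq_fun do rewrite -mulN1r.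
  have := nrmD (sz_ n) (sqiZ (-1) sz).
  have -> : nrm mu (fun x => -1 * z x) = nrm mu z.
    by congr Num.sqrt; apply: eq_Rintegral => x _; rewrite /rdot mulN1r !RIE; ring.
  by move=> h; apply: le_trans h _; rewrite lerD2r.
have B0 : 0 <= B by exact: le_trans (nrm_ge0 _ _) (DB 0%N).
apply/cvgrPdist_le => e e0.
(* The added 1 keeps [b] positive when [H] has norm zero; the choice of [r] then makes [r] times the
   squared norm of [H] at most [e / 2]. *)
pose b := nrm mu H ^+ 2 + 1.
have b0 : 0 < b by rewrite ltr_wpDl ?sqr_ge0.
pose r := e / 2 / b.
have rE : r = e / 2 / b by [].
have r0 : 0 < r by rewrite !divr_gt0.
clearbody r.
pose E m := \bigcap_(n in [set n | (m <= n)%N])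
  [set x | normc (D n x) ^+ 2 <= r ^+ 2 * normc (H x) ^+ 2].
have mE m : measurable (E m).
  apply: bigcap_measurable; first by exists m => /=.
  move=> n _; rewrite -[X in measurable X]setTI.
  apply: (@measurable_fun_ler _ _ _ _ (fun x => normc (D n x) ^+ 2)
    (fun x => r ^+ 2 * normc (H x) ^+ 2)) => //.
    by apply: measurable_sqr_normc; exact: (sD n).1.
  by apply: measurable_funM => //; apply: measurable_sqr_normc; exact: sH.1.
have HE : nrm mu (restr (~` E m) H) @[m --> \oo] --> 0.
  apply: nrm_restr_cvg0 => //; first by move=> m; exact: measurableC.
  apply: filterS zz => x zx Hx.
  have p0 : 0 < r ^+ 2 * normc (H x) ^+ 2.
    rewrite mulr_gt0// exprn_gt0// lt_neqAle normc_ge0 andbT eq_sym.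
    by apply: contra Hx => /eqP/eq0_normc ->.
  move/cvgrPdist_le : zx => /(_ _ p0) [m _ mP]; exists m => // k /= mk.
  apply; move=> n /= kn; have := mP n (leq_trans mk kn).
  by rewrite /= sub0r normrN ger0_norm ?sqr_ge0.
have [m Hm] : exists m, B * nrm mu (restr (~` E m) H) <= e / 2.
  have : B * nrm mu (restr (~` E m) H) @[m --> \oo] --> 0.
    by rewrite -(mulr0 B); exact: cvgMr.
  move/cvgrPdist_le => /(_ (e / 2)); rewrite divr_gt0// => /(_ isT) [m _ mP].
  exists m; have := mP m (leqnn m); rewrite /= sub0r normrN; apply: le_trans.
  exact: ler_norm.
exists m => // n /= mn; rewrite distrC -ipBl// -/(D n).
have sr1 := sqi_restr (mE m) sH; have sr2 := sqi_restr (measurableC (mE m)) sH.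
rewrite (_ : H = (fun x => restr (E m) H x + restr (~` E m) H x)); last first.
  by apply/funext => x; rewrite -restr_setC.
rewrite ipDr// (le_trans (ler_normD _ _))// [leRHS](splitr e); apply: lerD; last first.
  apply: le_trans (ler_ip (sD n) sr2) _; apply: le_trans Hm.
  by rewrite ler_wpM2r ?nrm_ge0.
have sDr := sqi_restr (mE m) (sD n).
rewrite -ip_restrl (le_trans (ler_ip sDr sH))//.
have h : nrm mu (restr (E m) (D n)) <= r * nrm mu H.
  rewrite -(@ler_pXn2r _ 2) ?nnegrE ?mulr_ge0 ?nrm_ge0 ?(ltW r0)//.
  rewrite exprMn !sqr_nrm -lee_fin EFinM -!sqintE//; apply: le_sqint => //.
  - exact: sqr_ge0.
  - exact: sDr.1.
  - exact: sH.1.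
  move=> x; rewrite /restr sqr_normcM sqr_normcR indicE.
  case: (boolP (x \in E m)) => [|_].
    by rewrite inE expr1n mul1r => /(_ n mn).
  by rewrite expr0n mul0r mulr_ge0// sqr_ge0.
rewrite (le_trans (ler_wpM2r (nrm_ge0 _ _) h))// -mulrA -expr2.
rewrite rE -[X in X <= _]mulrA ler_piMr ?divr_ge0 ?(ltW e0)//.
by rewrite ler_pdivrMl// mulr1 /b lerDl.
Qed.

End bounded.

Variable mu : {sigma_finite_measure set T -> \bar R}.

(* Otherwise some set [{x | h n x >= 1 / j for all n >= m}] has positive measure,
   and the integrals over it do not tend to zero. *)
Lemma weak_ptwise_le0 (h : nat -> T -> R) :
  (forall n, measurable_fun setT (h n)) ->
  (forall E, measurable E -> (mu E < +oo)%E ->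
    (forall n, mu.-integrable setT (fun x => (h n x * \1_E x)%:E)) /\
    Rintegral mu setT (fun x => h n x * \1_E x) @[n --> \oo] --> 0) ->
  \forall x \ae mu, forall l, h n x @[n --> \oo] --> l -> l <= 0.
Proof.
move=> mh H; have [F FT FP] := sigma_finiteT mu.
pose E k m j := F k `&` \bigcap_(n in [set n | (m <= n)%N])
  [set x | j.+1%:R^-1 <= h n x].
have mE k m j : measurable (E k m j).
  apply: measurableI; first by case: (FP k).
  apply: bigcap_measurable; first by exists m => /=.
  move=> n _; rewrite -[X in measurable X]setTI.
  exact: (@measurable_fun_ler _ _ _ _ (cst j.+1%:R^-1) (h n)).
have E0 k m j : mu (E k m j) = 0%E.
  have Efin : (mu (E k m j) < +oo)%E.
    case: (FP k) => mF Ffin; apply: le_lt_trans Ffin.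
    by apply: le_measure; rewrite ?inE//; exact: subIsetl.
  have [ih H0] := H _ (mE k m j) Efin.
  have iE := integrable_indic_fin (mE k m j) Efin.
  have muE : Rintegral mu setT \1_(E k m j) = fine (mu (E k m j)).
    by rewrite /Rintegral integral_indic// setIT.
  have le n : (m <= n)%N -> j.+1%:R^-1 * fine (mu (E k m j)) <=
      Rintegral mu setT (fun x => h n x * \1_(E k m j) x).
    move=> mn; rewrite -muE -RintegralZl//.
    apply: le_Rintegral => //.
    - exact: (integrableZl measurableT j.+1%:R^-1 iE).
    - exact: ih.
    move=> x _; rewrite indicE; case: (boolP (x \in E k m j)) => [|_].
      by rewrite inE !mulr1 => -[_ /(_ n mn)].
    by rewrite !mulr0.
  have c0 : j.+1%:R^-1 * fine (mu (E k m j)) <= 0.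
    rewrite -(cvg_lim _ H0)//; apply: limr_ge; first by apply/cvg_ex; exists 0.
    by exists m => // n /= mn; exact: le.
  have /eqP : fine (mu (E k m j)) == 0.
    rewrite eq_le fine_ge0// andbT; move: c0; rewrite pmulr_rle0//.
  by move=> f0; rewrite -[LHS]fineK ?f0// ge0_fin_numE.
have : \forall x \ae mu, forall k m j, ~ E k m j x.
  apply: ae_foralln => k; apply: ae_foralln => m; apply: ae_foralln => j.
  by exists (E k m j); split; [exact: mE|exact: E0|move=> x /= /contrapT].
apply: filterS => x nE l hl; rewrite leNgt; apply/negP => l0.
have [k _ Fk] : (\bigcup_k F k) x by rewrite -FT.
have [j jl] : exists j : nat, j.+1%:R^-1 < l.
  exists (Num.truncn l^-1); rewrite invf_plt ?posrE//; exact: truncnS_gt.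
have lj : 0 < l - j.+1%:R^-1 by rewrite subr_gt0.
move/cvgrPdist_le : hl => /(_ _ lj) [m _ mP].
apply: (nE k m j); split=> // n /= mn.
have := mP n mn; rewrite /= ler_norml => /andP[_].
by rewrite lerD2l lerN2.
Qed.

(** Obtained from [weak_ptwise_le0] for [h - k] and [k - h]. The null set is fixed before [l], and
    no pointwise limit is assumed to exist: the conclusion applies wherever there is one. *)
Lemma weak_ptwise_eq (h : nat -> T -> R) (k : T -> R) :
  (forall n, measurable_fun setT (h n)) -> measurable_fun setT k ->
  (forall E, measurable E -> (mu E < +oo)%E ->
    [/\ forall n, mu.-integrable setT (fun x => (h n x * \1_E x)%:E),
    mu.-integrable setT (fun x => (k x * \1_E x)%:E) &
    Rintegral mu setT (fun x => h n x * \1_E x) @[n --> \oo] -->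
    Rintegral mu setT (fun x => k x * \1_E x)]) ->
  \forall x \ae mu, forall l, h n x @[n --> \oo] --> l -> l = k x.
Proof.
move=> mh mk H.
have iB (a b : T -> R) E : mu.-integrable setT (fun x => (a x * \1_E x)%:E) ->
    mu.-integrable setT (fun x => (b x * \1_E x)%:E) ->
    mu.-integrable setT (fun x => ((a x - b x) * \1_E x)%:E).
  move=> ia ib; under eq_fun do rewrite mulrBl.
  exact: (integrableB measurableT ia ib).
have RB (a b : T -> R) E : mu.-integrable setT (fun x => (a x * \1_E x)%:E) ->
    mu.-integrable setT (fun x => (b x * \1_E x)%:E) ->
    Rintegral mu setT (fun x => (a x - b x) * \1_E x) =
    Rintegral mu setT (fun x => a x * \1_E x) - Rintegral mu setT (fun x => b x * \1_E x).
  by move=> ia ib; rewrite -RintegralB//; apply: eq_Rintegral => x _; rewrite mulrBl.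
have H1 := @weak_ptwise_le0 (fun n x => h n x - k x) _ _.
have H2 := @weak_ptwise_le0 (fun n x => k x - h n x) _ _.
apply: filterS2 (H1 _ _) (H2 _ _).
- move=> x h1 h2 l hl; apply/eqP; rewrite eq_le -subr_le0 -[X in _ && X]subr_le0.
  apply/andP; split; [apply: h1|apply: h2]; apply: cvgB => //; exact: cvg_cst.
- by move=> n; exact: measurable_funB.
- move=> E mE Ef; have [i1 i2 H3] := H E mE Ef; split=> [n|]; first exact: iB.
  by under eq_fun do rewrite RB//; rewrite -(subrr (Rintegral mu setT
    (fun x => k x * \1_E x))); apply: cvgB => //; exact: cvg_cst.
- by move=> n; exact: measurable_funB.
- move=> E mE Ef; have [i1 i2 H3] := H E mE Ef; split=> [n|]; first exact: iB.
  by under eq_fun do rewrite RB//; rewrite -(subrr (Rintegral mu setT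
    (fun x => k x * \1_E x))); apply: cvgB => //; exact: cvg_cst.
Qed.

End weak_convergence.

(** * Difference quotients along a sequence *)

Section difference_quotients.
Context {R : realType}.
Variables (t : R) (s_ : nat -> R).
Hypothesis st : forall n, s_ n != t.
Hypothesis s_t : s_ n @[n --> \oo] --> t.
Implicit Types (a b F : R -> R) (da db : R).

Lemma dq_cvg a da : difference_quotient a t (s_ n) @[n --> \oo] --> da ->
  a (s_ n) @[n --> \oo] --> a t.
Proof.
move=> ha; rewrite (_ : (fun n => _) =
    (fun n => a t + difference_quotient a t (s_ n) * (s_ n - t))); last first.
  by apply/funext => n; rewrite /difference_quotient divfK ?subr_eq0// addrC subrK.
rewrite -[X in _ --> X]addr0 -[X in _ --> _ + X](mulr0 da) -(subrr t).
apply: cvgD; first exact: cvg_cst.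
by apply: cvgM => //; apply: cvgB => //; exact: cvg_cst.
Qed.

Lemma dqM a b da db : difference_quotient a t (s_ n) @[n --> \oo] --> da ->
  difference_quotient b t (s_ n) @[n --> \oo] --> db ->
  difference_quotient (fun s => a s * b s) t (s_ n) @[n --> \oo] --> da * b t + a t * db.
Proof.
move=> ha hb; rewrite (_ : (fun n => _) = (fun n =>
    difference_quotient a t (s_ n) * b (s_ n) +
    a t * difference_quotient b t (s_ n))); last first.
  by apply/funext => n; rewrite /difference_quotient; ring.
apply: cvgD; last exact: cvgMr.
by apply: cvgM => //; exact: dq_cvg hb.
Qed.

Lemma dq_comp F a dF da : is_derive (a t) 1 F dF ->
  difference_quotient a t (s_ n) @[n --> \oo] --> da ->
  difference_quotient (F \o a) t (s_ n) @[n --> \oo] --> dF * da.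
Proof.
move=> /is_derive1_caratheodory[g [gE gc <-]] ha.
rewrite (_ : (fun n => _) = (fun n =>
    g (a (s_ n)) * difference_quotient a t (s_ n))); last first.
  by apply/funext => n; rewrite /difference_quotient /= gE mulrA.
apply: cvgM => //; exact: (cvg_comp _ _ (dq_cvg ha) gc).
Qed.

End difference_quotients.

Section complex_sequences.
Context {R : realType}.

Lemma cvg_normc (z_ : nat -> R[i]) (z : R[i]) :
  Re (z_ n) @[n --> \oo] --> Re z -> Im (z_ n) @[n --> \oo] --> Im z ->
  normc (z_ n - z) ^+ 2 @[n --> \oo] --> 0.
Proof.
move=> hr hi.
have h (a_ : nat -> R) (a : R) : a_ n @[n --> \oo] --> a ->
    (a_ n - a) * (a_ n - a) @[n --> \oo] --> (0 : R).
  move=> ha; have h0 : a_ n - a @[n --> \oo] --> (0 : R).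
    by rewrite -(subrr a); apply: cvgB => //; exact: cvg_cst.
  by rewrite -[X in _ --> X](mulr0 (0 : R)); exact: cvgM.
have H : (Re (z_ n) - Re z) * (Re (z_ n) - Re z) +
    (Im (z_ n) - Im z) * (Im (z_ n) - Im z) @[n --> \oo] --> (0 : R).
  by rewrite -[X in _ --> X](addr0 (0 : R)); apply: cvgD; exact: h.
apply: cvg_trans H; apply: near_eq_cvg; apply: nearW => n.
by rewrite sqr_normc !RIE !expr2.
Qed.

(** A chord is at most its arc. The mean value theorem is applied to the projection of the unit
    circle onto the chord [(p, q)]: the increment of [g] is the squared chord, while its derivative
    is at most the chord by Cauchy-Schwarz. *)
Lemma normc_expiB (a b : R) : normc (expi a - expi b) ^+ 2 <= (a - b) ^+ 2.
Proof.
rewrite sqr_normc !RIE /=.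
wlog ba : a b / b <= a => [H|].
  have [/H//|/ltW/H] := leP b a.
  by rewrite -(sqrrN (cos a - _)) -(sqrrN (sin a - _)) -(sqrrN (a - b)) !opprB.
set p := cos a - cos b; set q := sin a - sin b.
pose g (x : R) := p * cos x + q * sin x.
have dg (x : R) : is_derive x 1 g (q * cos x - p * sin x).
  by apply: is_derive_eq; rewrite /GRing.scale/=; ring.
have [x _] : exists2 c, c \in `[b, a] & g a - g b = (q * cos c - p * sin c) * (a - b).
  apply: (MVT_segment ba (fun x _ => dg x)).
  apply: continuous_subspaceT => x.
  by apply: differentiable_continuous; apply/derivable1_diffP; case: (dg x).
rewrite (_ : g a - g b = p ^+ 2 + q ^+ 2); last by rewrite /g /p /q; ring.
move: (cos2Dsin2 x); move: (cos x) (sin x) => C S CS.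
set L := p ^+ 2 + q ^+ 2 => LE.
have L0 : 0 <= L by rewrite addr_ge0// sqr_ge0.
have D : (q * C - p * S) ^+ 2 <= L.
  rewrite -[leRHS]mulr1 -CS -subr_ge0 /L.
  rewrite (_ : _ - _ = (q * S + p * C) ^+ 2) ?sqr_ge0//; ring.
have [->|Ln0] := eqVneq L 0; first exact: sqr_ge0.
have Lp : 0 < L by rewrite lt_neqAle eq_sym Ln0.
rewrite -(ler_pM2l Lp) -expr2 LE exprMn -LE.
by rewrite ler_wpM2r// sqr_ge0.
Qed.

(** The sum of squared deviations from the mean is nonnegative. *)
Lemma jensen_sqr n (a : 'I_n.+1 -> R) :
  (n.+1%:R^-1 * \sum_(k < n.+1) a k) ^+ 2 <= n.+1%:R^-1 * \sum_(k < n.+1) a k ^+ 2.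
Proof.
set m := n.+1%:R^-1 * _.
have n0 : n.+1%:R != 0 :> R by [].
have sE : \sum_(k < n.+1) a k = n.+1%:R * m by rewrite /m mulrA divff// mul1r.
have : 0 <= \sum_(k < n.+1) (a k - m) ^+ 2 by apply: sumr_ge0 => k _; exact: sqr_ge0.
rewrite (_ : \sum_(k < n.+1) (a k - m) ^+ 2 =
  \sum_(k < n.+1) a k ^+ 2 - n.+1%:R * m ^+ 2); last first.
  rewrite (eq_bigr (fun k => a k ^+ 2 + (m ^+ 2 - 2 * m * a k))); last first.
    by move=> k _; ring.
  rewrite big_split/= sumrB sumr_const card_ord -mulr_sumr sE -[m ^+ 2 *+ _]mulr_natl.
  ring.
by rewrite subr_ge0 ler_pdivlMl.
Qed.

End complex_sequences.

Lemma cvg_ext (R : realType) (v_ u_ : nat -> R) (l l' : R) :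
  v_ n @[n --> \oo] --> l -> (forall n, u_ n = v_ n) -> l' = l ->
  u_ n @[n --> \oo] --> l'.
Proof. by move=> vl /funext -> ->. Qed.

(** * Evolution under a phase multiplier *)

Section multiplier.
Context {R : realType} {N : nat}.
Local Notation V := (Rn R N).
Local Notation mu := (lebesgueN R N).
Local Notation tau := (2 * pi : R).
Implicit Types (u v w f g h z : V -> R[i]).

Lemma is_ifourier_ext v f v' f' : is_ifourier v f -> sqi mu v' -> sqi mu f' ->
  (\forall x \ae mu, v x = v' x) -> (\forall x \ae mu, f x = f' x) -> ext tau v' f'.
Proof. exact: L2_extension_ext. Qed.

Lemma is_fourier_ext v f v' f' : is_fourier v f -> sqi mu v' -> sqi mu f' ->
  (\forall x \ae mu, v x = v' x) -> (\forall x \ae mu, f x = f' x) ->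
  ext (- tau) v' f'.
Proof.
apply: L2_extension_ext; last exact: fourier_intE.
by rewrite /tau_sqr sqrrN.
Qed.

(* By Fourier inversion [F h = v], so that [g = F^-1 (m v)]. *)
Lemma multiplier_version (m : V -> R) v f h g v' f' : is_ifourier v f ->
  sqi mu v' -> sqi mu f' ->
  (\forall x \ae mu, v x = v' x) -> (\forall x \ae mu, f x = f' x) ->
  (\forall x \ae mu, h x = f x) -> is_multiplier m h g ->
  exists d' g', [/\ sqi mu d', sqi mu g',
    \forall x \ae mu, (m x)%:C * v x = d' x, \forall x \ae mu, g x = g' x &
    ext tau d' g'].
Proof.
move=> vf sv sf vv ff hf [w hw wg].
have [w' sw' ww'] : exists2 w', sqi mu w' & \forall x \ae mu, w x = w' x.
  by case: hw => _ /L2_version.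
have [d' sd' dd'] := L2_version (let: And3 l _ _ := wg in l).
have [g' sg' gg'] := L2_version (let: And3 _ l _ := wg in l).
exists d', g'; split=> //; last exact: is_ifourier_ext wg sd' sg' dd' gg'.
have hf' : \forall x \ae mu, h x = f' x by apply: filterS2 hf ff => x -> ->.
have wv := ext_inversion (erefl : tau_sqr tau) sv sf sw'
  (is_ifourier_ext vf sv sf vv ff) (is_fourier_ext hw sf sw' hf' ww').
have vw : \forall x \ae mu, v x = w x.
  by apply: filterS3 vv wv ww' => x -> <- ->.
by apply: filterS2 vw dd' => x -> .
Qed.

End multiplier.

Section evolution.
Context {R : realType} {N : nat}.
Local Notation V := (Rn R N).
Local Notation mu := (lebesgueN R N).
Variables (T : R) (u : V -> R[i]) (psi : V -> R -> R).
Hypothesis T0 : 0 < T.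
Hypothesis cpsi : forall xi, C1_in T (psi xi).

Definition evolved (s : R) (xi : V) : R[i] := expi (psi xi s) * u xi.

Variables (vv dd : R -> V -> R[i]) (M : R).
Hypothesis svv : forall s, s \in `[0, T] -> sqi mu (vv s).
Hypothesis sdd : forall s, s \in `[0, T] -> sqi mu (dd s).
Hypothesis vvE : forall s, s \in `[0, T] -> \forall x \ae mu, evolved s x = vv s x.
Hypothesis ddE : forall s, s \in `[0, T] ->
  \forall x \ae mu, (derive_in T (psi x) s)%:C * evolved s x = dd s x.
Hypothesis ddM : forall s, s \in `[0, T] -> nrm mu (dd s) <= M.

Definition quot (t s : R) (w : R -> V -> R[i]) (x : V) : R[i] :=
  ((s - t)^-1)%:C * (w s x - w t x).

Lemma sqi_quot t s w : sqi mu (w s) -> sqi mu (w t) -> sqi mu (quot t s w).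
Proof. by move=> ss s1; apply: sqiZ; exact: sqiB. Qed.

(* [|psi b - psi a| / (b - a)] is the limit of averages of [psi'], and the
   average of functions of norm at most [M] has norm at most [M]. *)
Lemma nrm_quot_le a b : a \in `[0, T] -> b \in `[0, T] -> a < b ->
  nrm mu (quot a b vv) <= M.
Proof.
move=> aT bT ab; have ba0 : 0 < b - a by rewrite subr_gt0.
have M0 : 0 <= M by exact: le_trans (nrm_ge0 _ _) (ddM aT).
have sq := sqi_quot (svv bT) (svv aT).
rewrite -(@ler_pXn2r _ 2) ?nnegrE ?nrm_ge0// sqr_nrm -lee_fin -sqintE//.
pose p n (k : nat) := a + (b - a) * (k%:R / n.+1%:R).
have pT n (k : 'I_n.+1) : p n k \in `[0, T].
  move: aT bT; rewrite !in_itv/= => /andP[a0 _] /andP[_ bT].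
  have /andP[k0 k1] : 0 <= (k%:R / n.+1%:R : R) <= 1.
    by rewrite divr_ge0//= ler_pdivrMr// mul1r ler_nat ltnW.
  apply/andP; split; first by rewrite addr_ge0// mulr_ge0// ltW.
  by rewrite (le_trans _ bT)// -lerBrDl ler_piMr// ltW.
pose F n x := n.+1%:R^-1 * \sum_(k < n.+1) normc (dd (p n k) x) ^+ 2.
have mn n (k : 'I_n.+1) : measurable_fun setT (fun x => normc (dd (p n k) x) ^+ 2).
  by apply: measurable_sqr_normc; case: (sdd (pT n k)).
apply: (@fatou_bound _ _ _ mu F).
- by move=> n; apply: measurable_funM => //; exact: measurable_sum.
- by move=> n x; rewrite mulr_ge0 ?invr_ge0// sumr_ge0// => k _; exact: sqr_ge0.
- exact: measurable_sqr_normc sq.1.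
- by move=> x; exact: sqr_ge0.
(* The nodes of all subdivisions are countable in number, so a single null set serves them all. *)
- have all_dd : \forall x \ae mu, forall n (k : nat) (kn : (k < n.+1)%N),
      (derive_in T (psi x) (p n k))%:C * evolved (p n k) x = dd (p n k) x.
    apply: ae_foralln => n; apply: ae_foralln => k.
    have [kn|kn] := boolP (k < n.+1)%N; last exact: nearW.
    by apply: filterS (ddE (pT n (Ordinal kn))) => x.
  apply: filterS3 all_dd (vvE aT) (vvE bT) => x Hd Ha Hb e e0.
  pose q := (psi x b - psi x a) / (b - a).
  pose U := normc (u x) ^+ 2.
  have U0 : 0 <= U by exact: sqr_ge0.
  pose r n := n.+1%:R^-1 * \sum_(k < n.+1) derive_in T (psi x) (p n k).
  have rq : r n @[n --> \oo] --> q.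
    apply/cvgrPdist_le => e1 e10.
    exact: (riemann_sum (cpsi x) aT bT ab e10).
  have rF n : r n ^+ 2 * U <= F n x.
    rewrite /F (eq_bigr (fun k : 'I_n.+1 => derive_in T (psi x) (p n k) ^+ 2 * U)).
      by rewrite -mulr_suml [leRHS]mulrA ler_wpM2r// jensen_sqr.
    move=> k _; rewrite -Hd// !sqr_normcM sqr_normcR.
    by rewrite sqr_normc_expi mul1r.
  have le : normc (quot a b vv x) ^+ 2 <= q ^+ 2 * U.
    rewrite /quot -Ha -Hb /evolved -mulrBl !sqr_normcM sqr_normcR mulrA.
    rewrite ler_wpM2r// /q exprMn mulrC ler_wpM2r ?sqr_ge0//.
    exact: normc_expiB.
  have rU : r n ^+ 2 * U @[n --> \oo] --> q ^+ 2 * U.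
    by apply: cvgMl; rewrite expr2; under eq_fun do rewrite expr2; exact: cvgM.
  move/cvgrPdist_le : rU => /(_ _ e0); apply: filterS => n.
  rewrite ler_norml => /andP[_ h]; apply: le_trans (rF n).
  by rewrite lerBlDr (le_trans le)// -lerBlDl.
- move=> n; rewrite /F; under eq_integral do rewrite EFinM -sumEFin.
  rewrite ge0_integralZl//; last 2 first.
  + by apply: emeasurable_sum => k; apply/measurable_EFinP.
  + by move=> x _; apply: sume_ge0 => k _; rewrite lee_fin sqr_ge0.
  rewrite ge0_integral_sum//; last 2 first.
  + by move=> k; apply/measurable_EFinP.
  + by move=> k x _; rewrite lee_fin sqr_ge0.
  rewrite (eq_bigr (fun k : 'I_n.+1 => (ip mu (dd (p n k)) (dd (p n k)))%:E)); last first.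
    by move=> k _; rewrite -sqintE//; exact: sdd (pT n k).
  rewrite sumEFin -EFinM lee_fin ler_pdivrMl//.
  apply: (@le_trans _ _ (\sum_(k < n.+1) M ^+ 2)); last first.
    by rewrite sumr_const card_ord mulr_natl.
  apply: ler_sum => k _; rewrite -sqr_nrm ler_pXn2r ?nnegrE ?nrm_ge0//.
  exact: ddM (pT n k).
Qed.

Lemma nrm_quot t s : t \in `[0, T] -> s \in `[0, T] -> s != t ->
  nrm mu (quot t s vv) <= M.
Proof.
move=> tT sT; rewrite neq_lt => /orP[st|ts]; last exact: nrm_quot_le.
rewrite (_ : quot t s vv = quot s t vv); first exact: nrm_quot_le.
by apply/funext => x; rewrite /quot -(opprB t s) invrN rmorphN mulNr -mulrN opprB.
Qed.

(** The chain rule for cosine and sine of [psi] at each frequency. Only the sequence and its limit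
    are involved, so the exceptional sets have a null union. *)
Lemma quot_cvg t (s_ : nat -> R) : t \in `[0, T] -> (forall n, s_ n \in `[0, T]) ->
  (forall n, s_ n != t) -> s_ n @[n --> \oo] --> t ->
  \forall x \ae mu, normc (quot t (s_ n) vv x - 'i * dd t x) ^+ 2 @[n --> \oo] --> 0.
Proof.
move=> tT sT sne st.
have all_vv : \forall x \ae mu, forall n, evolved (s_ n) x = vv (s_ n) x.
  by apply: ae_foralln => n; exact: vvE.
apply: filterS3 all_vv (vvE tT) (ddE tT) => x Hs Ht Hd.
have dpsi := derive_in_seq ((cpsi x).1 _ tT) sT sne st.
have hc := dq_comp sne st (is_derive_cos (psi x t)) dpsi.
have hs := dq_comp sne st (is_derive_sin (psi x t)) dpsi.
have E n : quot t (s_ n) vv x =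
    (difference_quotient (cos \o psi x) t (s_ n) +i*
     difference_quotient (sin \o psi x) t (s_ n)) * u x.
  rewrite /quot -Hs -Ht /evolved -mulrBl mulrA; congr (_ * _).
  apply/eqP; rewrite eq_complex /difference_quotient /= !mul0r subr0 addr0.
  by rewrite ![_^-1 * _]mulrC !eqxx.
under eq_fun do rewrite E.
rewrite -Hd /evolved; apply: cvg_normc.
- have h : difference_quotient (cos \o psi x) t (s_ n) * Re (u x) -
      difference_quotient (sin \o psi x) t (s_ n) * Im (u x) @[n --> \oo] -->
      (- sin (psi x t) * derive_in T (psi x) t * Re (u x) -
       cos (psi x t) * derive_in T (psi x) t * Im (u x) : R).
    by apply: cvgB; exact: cvgMl.
  apply: (cvg_ext h) => [n|]; first by rewrite cReM.
  by rewrite !RIE /=; ring.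
- have h : difference_quotient (cos \o psi x) t (s_ n) * Im (u x) +
      difference_quotient (sin \o psi x) t (s_ n) * Re (u x) @[n --> \oo] -->
      (- sin (psi x t) * derive_in T (psi x) t * Im (u x) +
       cos (psi x t) * derive_in T (psi x) t * Re (u x) : R).
    by apply: cvgD; exact: cvgMl.
  apply: (cvg_ext h) => [n|]; first by rewrite cImM.
  by rewrite !RIE /=; ring.
Qed.

End evolution.

(** * Weak limits of the quotients and derivative of the intensity *)

Section weak_limit.
Context {R : realType} {N : nat}.
Local Notation V := (Rn R N).
Local Notation mu := (lebesgueN R N).
Implicit Types (f g h z : V -> R[i]).

(** The error of replacing [h] by its restriction to a large cube is controlled uniformly in [n]
    through the bound [M], so the cube can be chosen before [n]. *)
Lemma weak_cvg_dense (z_ : nat -> V -> R[i]) z (M : R) :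
  (forall n, sqi mu (z_ n)) -> sqi mu z -> (forall n, nrm mu (z_ n) <= M) ->
  (forall h, L12 mu h -> ip mu (z_ n) h @[n --> \oo] --> ip mu z h) ->
  forall h, sqi mu h -> ip mu (z_ n) h @[n --> \oo] --> ip mu z h.
Proof.
move=> sz_ sz zM H h sh; apply/cvgrPdist_le => e e0.
pose B := nrm mu z + M.
have [k Hk] : exists k, nrm mu (fun x => restr (cube k) h x - h x) * B <= e / 2.
  have := nrm_restr_cube sh; rewrite -[X in X @ _ --> _]/(_) => h0.
  have : nrm mu (fun x => restr (cube n) h x - h x) * B @[n --> \oo] --> 0.
    by rewrite -(mul0r B); exact: cvgMl.
  move/cvgrPdist_le => /(_ (e / 2)); rewrite divr_gt0// => /(_ isT) [k _ kP].
  exists k; have := kP k (leqnn k); rewrite /= sub0r normrN; apply: le_trans.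
  exact: ler_norm.
have lk := L12_restr_cube k sh.
have /cvgrPdist_le /(_ (e / 2)) := H _ lk.
rewrite divr_gt0// => /(_ isT); apply: filterS => n Hn.
have sd := sqiB lk.1 sh.
have sub w : sqi mu w -> ip mu w h =
    ip mu w (restr (cube k) h) - ip mu w (fun x => restr (cube k) h x - h x).
  by move=> sw; rewrite ipBr//; [ring|exact: lk.1].
rewrite (sub _ sz) (sub _ (sz_ n)).
rewrite (_ : _ - _ - (_ - _) = (ip mu z (restr (cube k) h) - ip mu (z_ n) (restr (cube k) h)) -
  (ip mu z (fun x => restr (cube k) h x - h x) -
   ip mu (z_ n) (fun x => restr (cube k) h x - h x))); last by ring.
rewrite (le_trans (ler_normB _ _))// [leRHS](splitr e) lerD//.
rewrite (le_trans (ler_normB _ _))// (le_trans _ Hk)//.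
rewrite mulrC /B mulrDl; apply: lerD.
  exact: ler_ip.
apply: le_trans (ler_ip (sz_ n) sd) _.
by rewrite ler_wpM2r ?nrm_ge0.
Qed.

Lemma ip_mulR (theta : V -> R) f h :
  ip mu f (fun x => (theta x)%:C * h x) = ip mu (fun x => (theta x)%:C * f x) h.
Proof. by apply: eq_Rintegral => x _; rewrite /rdot !RIE /=; ring. Qed.

Lemma sqi_mulR (theta : V -> R) (B : R) f : measurable_fun setT theta ->
  (forall x, `|theta x| <= B) -> sqi mu f -> sqi mu (fun x => (theta x)%:C * f x).
Proof.
move=> mt tB; apply: (@sqiM _ _ _ mu _ (B ^+ 2)); first exact: cmeasR.
move=> x; rewrite sqr_normcR -real_normK ?num_real// lerXn2r ?nnegrE//.
exact: le_trans (tB x).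
Qed.

Lemma nrm_mulR (theta : V -> R) (B : R) f : measurable_fun setT theta ->
  (forall x, `|theta x| <= B) -> sqi mu f ->
  nrm mu (fun x => (theta x)%:C * f x) <= B * nrm mu f.
Proof.
(* The bound [B] is nonnegative because the space has a point, the zero tuple. *)
move=> mt tB sf; have B0 : 0 <= B by exact: le_trans (tB [tuple of nseq N 0]).
have st := sqi_mulR mt tB sf.
rewrite -(@ler_pXn2r _ 2) ?nnegrE ?mulr_ge0 ?nrm_ge0// exprMn !sqr_nrm.
rewrite -lee_fin EFinM -!sqintE//; apply: le_sqint => //.
- exact: sqr_ge0.
- exact: st.1.
- exact: sf.1.
move=> x; rewrite sqr_normcM sqr_normcR ler_wpM2r ?sqr_ge0//.
by rewrite -real_normK ?num_real// lerXn2r ?nnegrE.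
Qed.

End weak_limit.

Section intensity_derivative.
Context {R : realType} {N : nat}.
Local Notation V := (Rn R N).
Local Notation mu := (lebesgueN R N).
Local Notation tau := (2 * pi : R).
Variables (T : R) (u : V -> R[i]) (psi : V -> R -> R).
Hypothesis T0 : 0 < T.
Hypothesis cpsi : forall xi, C1_in T (psi xi).
Variables (vv dd ff : R -> V -> R[i]) (M : R).
Hypothesis svv : forall s, s \in `[0, T] -> sqi mu (vv s).
Hypothesis sdd : forall s, s \in `[0, T] -> sqi mu (dd s).
Hypothesis sff : forall s, s \in `[0, T] -> sqi mu (ff s).
Hypothesis vvE : forall s, s \in `[0, T] -> \forall x \ae mu, evolved u psi s x = vv s x.
Hypothesis ddE : forall s, s \in `[0, T] ->
  \forall x \ae mu, (derive_in T (psi x) s)%:C * evolved u psi s x = dd s x.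
Hypothesis ddM : forall s, s \in `[0, T] -> nrm mu (dd s) <= M.
Hypothesis vf : forall s, s \in `[0, T] -> ext tau (vv s) (ff s).
Variables (t : R) (gg : V -> R[i]).
Hypothesis tT : t \in `[0, T].
Hypothesis sgg : sqi mu gg.
Hypothesis dg : ext tau (dd t) gg.

Let tau2 : tau_sqr tau := erefl.

Lemma ext_quot s : s \in `[0, T] -> ext tau (quot t s vv) (quot t s ff).
Proof.
move=> sT; apply: extZ => //; [exact: sqiB (svv sT) (svv tT)|
  exact: sqiB (sff sT) (sff tT)|].
by apply: extB => //; [exact: svv|exact: sff|exact: svv|exact: sff|exact: vf|exact: vf].
Qed.

Lemma nrm_quot_ff s : s \in `[0, T] -> s != t -> nrm mu (quot t s ff) <= M.
Proof.
move=> sT st; rewrite (ext_nrm tau2 (sqi_quot _ _) (sqi_quot _ _) (ext_quot sT)).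
- exact: (nrm_quot cpsi svv sdd vvE ddE ddM tT sT st).
- exact: svv.
- exact: svv.
- exact: sff.
- exact: sff.
Qed.

Section along_a_sequence.
Variable s_ : nat -> R.
Hypothesis sT : forall n, s_ n \in `[0, T].
Hypothesis sne : forall n, s_ n != t.
Hypothesis st : s_ n @[n --> \oo] --> t.

(** By duality the transform is moved onto a test function in [L12], leaving the quotients on the
    frequency side. Those are bounded in norm and converge pointwise, hence weakly. *)
Lemma quot_weak_cvg h : sqi mu h ->
  ip mu (quot t (s_ n) ff) h @[n --> \oo] --> ip mu (fun x => 'i * gg x) h.
Proof.
have sQ n : sqi mu (quot t (s_ n) ff) by apply: sqi_quot; exact: sff.
have sq n : sqi mu (quot t (s_ n) vv) by apply: sqi_quot; exact: svv.
have sig := sqiZ 'i sgg; have sid := sqiZ 'i (sdd tT).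
apply: (weak_cvg_dense (M := M)) => // [n|{}h lh]; first exact: nrm_quot_ff.
have sk := sqi_ker (tau_sqrN tau2) lh.
have eQ n : ip mu (quot t (s_ n) ff) h = ip mu (quot t (s_ n) vv) (ker (- tau) h).
  by apply: ext_duality => //; exact: ext_quot.
under eq_fun do rewrite eQ.
rewrite (ext_duality tau2 sid sig (extZ 'i tau2 (sdd tT) sgg dg) lh).
apply: (bounded_ptwise_weak_cvg (M := M)) => // [n|].
  exact: (nrm_quot cpsi svv sdd vvE ddE ddM tT (sT n) (sne n)).
exact: (quot_cvg cpsi vvE ddE tT sT sne st).
Qed.

Lemma intensity_dq_cvg (theta : V -> R) (B : R) : measurable_fun setT theta ->
  (forall x, `|theta x| <= B) ->
  difference_quotient (fun s => ip mu (ff s) (fun x => (theta x)%:C * ff s x))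
    t (s_ n) @[n --> \oo] -->
  2 * ip mu (fun x => 'i * gg x) (fun x => (theta x)%:C * ff t x).
Proof.
move=> mth thB; have sft := sff tT; have sth := sqi_mulR mth thB sft.
pose Q n := quot t (s_ n) ff; pose d n := s_ n - t.
have sQ n : sqi mu (Q n) by apply: sqi_quot; exact: sff.
have d0 n : d n != 0 by rewrite subr_eq0.
have sQth n := sqi_mulR mth thB (sQ n).
have fE n : ff (s_ n) = (fun x => ff t x + (d n)%:C * Q n x).
  apply/funext => x; rewrite /Q /quot mulrA -rmorphM /= divff ?d0//.
  by rewrite mul1r addrC subrK.
have pE n : difference_quotient (fun s => ip mu (ff s) (fun x => (theta x)%:C * ff s x))
    t (s_ n) = 2 * ip mu (Q n) (fun x => (theta x)%:C * ff t x) +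
    d n * ip mu (Q n) (fun x => (theta x)%:C * Q n x).
  rewrite /difference_quotient fE -/(d n).
  move: (Q n) (sQ n) (sQth n) (d n) (d0 n) => q sq sqth e e0.
  rewrite (_ : (fun x => _ * (_ + _)) = (fun x => (theta x)%:C * ff t x +
    e%:C * ((theta x)%:C * q x))); last by apply/funext => x; ring.
  have seq := sqiZ e%:C sq; have seqth := sqiZ e%:C sqth.
  rewrite ipDl ?ipDr//; try exact: sqiD.
  rewrite !ipZl ?ipZr//.
  by rewrite (ip_mulR theta (ff t) q) (ipC mu _ q); field.
apply: (cvg_ext _ pE erefl); rewrite -[X in _ --> X]addr0; apply: cvgD.
  by apply: cvgMr; exact: quot_weak_cvg.
have dc : d n @[n --> \oo] --> (0 : R).
  by rewrite -(subrr t); apply: cvgB => //; exact: cvg_cst.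
(* Cauchy-Schwarz bounds the quadratic term: both factors contain the quotient, of norm at most [M],
   and [theta] costs a factor [B]. *)
apply: (@cvg_bound_dist _ _ _ _ _ (fun n => `|d n| * (M * (B * M)))).
  apply: nearW => n; rewrite subr0 normrM ler_wpM2l//.
  apply: le_trans (ler_ip (sQ n) (sQth n)) _.
  have QM : nrm mu (Q n) <= M by exact: nrm_quot_ff.
  have B0 : 0 <= B by exact: le_trans (thB [tuple of nseq N 0]).
  apply: ler_pM => //; try exact: nrm_ge0.
  apply: le_trans (nrm_mulR mth thB (sQ n)) _.
  by rewrite ler_wpM2l.
rewrite -(mul0r (M * (B * M))); apply: cvgMl.
by rewrite -(normr0 R); apply: cvg_norm.
Qed.

(** The weak limit is tested with indicators of sets of finite measure, which are admissible bounded
    weights [theta] with [B = 1]. *)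
Lemma intensity_ptwise : \forall x \ae mu, forall l : R,
  difference_quotient (fun s => normc (ff s x) ^+ 2) t (s_ n) @[n --> \oo] --> l ->
  l = 2 * rdot (fun x => 'i * gg x) (ff t) x.
Proof.
have sig := sqiZ 'i sgg; have sft := sff tT.
pose h n x := difference_quotient (fun s => normc (ff s x) ^+ 2) t (s_ n).
have mh n : measurable_fun setT (h n).
  apply: measurable_funM => //; apply: measurable_funB; apply: measurable_sqr_normc.
    exact: (sff (sT n)).1.
  exact: sft.1.
have mk : measurable_fun setT (fun x => 2 * rdot (fun x => 'i * gg x) (ff t) x).
  by apply: measurable_funM => //; apply: measurable_rdot; [exact: sig.1|exact: sft.1].
apply: (weak_ptwise_eq mh mk) => E mE Efin.
pose th (x : V) : R := \1_E x.
have mth : measurable_fun setT th by exact: measurable_indic.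
have th1 x : `|th x| <= 1 by rewrite /th indicE; case: (_ \in _); rewrite ?normr1 ?normr0.
have ii s : s \in `[0, T] -> mu.-integrable setT
    (EFin \o rdot (ff s) (fun x => (th x)%:C * ff s x)).
  move=> s0; apply: integrable_rdot; first exact: sff.
  exact: (sqi_mulR mth th1 (sff s0)).
have hE n x : h n x * th x = (s_ n - t)^-1 *
    (rdot (ff (s_ n)) (fun x => (th x)%:C * ff (s_ n) x) x -
     rdot (ff t) (fun x => (th x)%:C * ff t x) x).
  by rewrite /h /difference_quotient !sqr_normc /rdot !RIE /=; ring.
have kE x : 2 * rdot (fun x => 'i * gg x) (ff t) x * th x =
    2 * rdot (fun x => 'i * gg x) (fun x => (th x)%:C * ff t x) x.
  by rewrite /rdot !RIE /=; ring.
have ik : mu.-integrable setT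
    (EFin \o rdot (fun x => 'i * gg x) (fun x => (th x)%:C * ff t x)).
  by apply: integrable_rdot => //; exact: (sqi_mulR mth th1 sft).
have iB n := integrableB measurableT (ii _ (sT n)) (ii _ tT).
split.
- move=> n; under eq_fun do rewrite -/(th _) hE.
  exact: (integrableZl measurableT (s_ n - t)^-1 (iB n)).
- under eq_fun do rewrite -/(th _) kE.
  exact: (integrableZl measurableT 2 ik).
- apply: (cvg_ext (intensity_dq_cvg mth th1)) => [n|].
    under eq_Rintegral do rewrite -/(th _) hE.
    rewrite RintegralZl//; last exact: iB.
    rewrite RintegralB//; [|exact: ii|exact: ii].
    by rewrite mulrC.
  under eq_Rintegral do rewrite -/(th _) kE.
  by rewrite RintegralZl.
Qed.

(** The two parts are compared separately: a real inner product with the indicator of [E] integrates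
    the real part over [E], and one with ['i] times it the imaginary part. *)
Lemma quot_ptwise : \forall x \ae mu, forall z : R[i],
  Re (quot t (s_ n) ff x) @[n --> \oo] --> Re z ->
  Im (quot t (s_ n) ff x) @[n --> \oo] --> Im z -> z = 'i * gg x.
Proof.
have sig := sqiZ 'i sgg.
have sQ n : sqi mu (quot t (s_ n) ff) by apply: sqi_quot; exact: sff.
have hr : \forall x \ae mu, forall l, Re (quot t (s_ n) ff x) @[n --> \oo] --> l ->
    l = Re ('i * gg x).
  apply: weak_ptwise_eq => [n||E mE Efin]; first exact: (sQ n).1.1.
    exact: sig.1.1.
  have sE := (L12_ind mE Efin).1.
  have e w x : Re (w x) * \1_E x = rdot w (ind E) x.
    by rewrite /rdot /ind /= mulr0 addr0.
  split.
  - by move=> n; under eq_fun do rewrite e; exact: integrable_rdot.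
  - by under eq_fun do rewrite (e (fun x => 'i * gg x)); exact: integrable_rdot.
  - apply: (cvg_ext (quot_weak_cvg sE)) => [n|]; apply: eq_Rintegral => x _.
      exact: e.
    exact: (e (fun x => 'i * gg x)).
have hi : \forall x \ae mu, forall l, Im (quot t (s_ n) ff x) @[n --> \oo] --> l ->
    l = Im ('i * gg x).
  apply: weak_ptwise_eq => [n||E mE Efin]; first exact: (sQ n).1.2.
    exact: sig.1.2.
  have sE := sqiZ 'i (L12_ind mE Efin).1.
  have e w x : Im (w x) * \1_E x = rdot w (fun x => 'i * ind E x) x.
    by rewrite /rdot /ind !RIE /=; ring.
  split.
  - by move=> n; under eq_fun do rewrite e; exact: integrable_rdot.
  - by under eq_fun do rewrite (e (fun x => 'i * gg x)); exact: integrable_rdot.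
  - apply: (cvg_ext (quot_weak_cvg sE)) => [n|]; apply: eq_Rintegral => x _.
      exact: e.
    exact: (e (fun x => 'i * gg x)).
apply: filterS2 hr hi => x h1 h2 z /h1 z1 /h2 z2.
by apply/eqP; rewrite eq_complex z1 z2 !eqxx.
Qed.

End along_a_sequence.

Variables (f : V -> R -> R[i]) (k : V -> R).
Hypothesis fE : forall s, s \in `[0, T] -> \forall x \ae mu, f x s = ff s x.
Hypothesis kE : \forall x \ae mu, k x = 2 * rdot (fun x => 'i * gg x) (ff t) x.

Lemma intensity_weak_derive : is_weak_derive_in T (intensity f) t k.
Proof.
have sig := sqiZ 'i sgg; have sft := sff tT.
split.
- move=> s sT; exists (fun x => normc (ff s x) ^+ 2).
    exact: sqi_integrable (sff sT).
  by apply: filterS (fE sT) => x fx; rewrite /intensity fx.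
- exists (fun x => 2 * rdot (fun x => 'i * gg x) (ff t) x) => //.
  have i1 := integrable_rdot sig sft.
  exact: (integrableZl measurableT 2 i1).
move=> theta mth [B thB] p.
have sth s : s \in `[0, T] -> sqi mu (fun x => (theta x)%:C * ff s x).
  by move=> sT; exact: (sqi_mulR mth thB (sff sT)).
have pE s : s \in `[0, T] -> p s = ip mu (ff s) (fun x => (theta x)%:C * ff s x).
  move=> sT; apply: Rintegral_version.
    by apply: measurable_rdot; [exact: (sff sT).1|exact: (sth _ sT).1].
  apply: filterS (fE sT) => x fx.
  by rewrite /intensity fx sqr_normc /rdot !RIE /=; ring.
have -> : Rintegral mu setT (fun x => k x * theta x) =
    2 * ip mu (fun x => 'i * gg x) (fun x => (theta x)%:C * ff t x).
  rewrite /ip -RintegralZl//; last by apply: integrable_rdot => //; exact: sth.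
  apply: Rintegral_version.
    apply: measurable_funM => //; apply: measurable_rdot; first exact: sig.1.
    exact: (sth _ tT).1.
  by apply: filterS kE => x ->; rewrite /rdot !RIE /=; ring.
apply: derive_in_cvg => //; apply: cvg_within_seq => s_ sT sne st.
apply: (cvg_ext (intensity_dq_cvg sT sne st mth thB)) => // n.
by rewrite /difference_quotient !pE.
Qed.

(** Where the derivative exists it is the limit along any sequence, so one fixed sequence, with one
    null set, suffices. *)
Lemma intensity_derive : \forall x \ae mu, derivable_in T (intensity f x) t ->
  derive_in T (intensity f x) t = k x.
Proof.
have [s_ [sT sne st]] := within_dnbhs_seq T0 tT.
have fs : \forall x \ae mu, forall n, f x (s_ n) = ff (s_ n) x.
  by apply: ae_foralln => n; exact: fE.
apply: filterS2 (filterI fs (fE tT)) (filterI (intensity_ptwise sT sne st) kE).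
move=> x [fs_x ft_x] [H ->] dI.
apply: H; apply: (cvg_ext (derive_in_seq dI sT sne st)) => // n.
by rewrite /difference_quotient /intensity fs_x ft_x.
Qed.

Variables (A phi : V -> R -> R).
Hypothesis fpolar : forall s, s \in `[0, T] ->
  \forall x \ae mu, f x s = polar (A ^~ s) (phi ^~ s) x.

(** The product and chain rules give the pointwise limit of the quotients of [A cos phi] and
    [A sin phi]; by [quot_ptwise] it can only be the weak limit ['i * gg]. *)
Lemma polar_derive : \forall x \ae mu,
  derivable_in T (A x) t -> derivable_in T (phi x) t ->
  'i * gg x = expi (phi x t) *
    (derive_in T (A x) t +i* (A x t * derive_in T (phi x) t)).
Proof.
have [s_ [sT sne st]] := within_dnbhs_seq T0 tT.
have fs : \forall x \ae mu, forall n,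
    ff (s_ n) x = polar (A ^~ (s_ n)) (phi ^~ (s_ n)) x.
  by apply: ae_foralln => n; apply: filterS2 (fE (sT n)) (fpolar (sT n)) => x <-.
have ft : \forall x \ae mu, ff t x = polar (A ^~ t) (phi ^~ t) x.
  by apply: filterS2 (fE tT) (fpolar tT) => x <-.
apply: filterS3 fs ft (quot_ptwise sT sne st) => x fsx ftx H dA dphi.
have hA := derive_in_seq dA sT sne st; have hp := derive_in_seq dphi sT sne st.
have hc := dqM sne st hA (dq_comp sne st (is_derive_cos (phi x t)) hp).
have hs := dqM sne st hA (dq_comp sne st (is_derive_sin (phi x t)) hp).
apply/esym/H; rewrite ?cReM ?cImM.
- apply: (cvg_ext hc) => [n|]; last by rewrite /=; ring.
  by rewrite /quot fsx ftx /polar !RIE /difference_quotient /=; ring.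
- apply: (cvg_ext hs) => [n|]; last by rewrite /=; ring.
  by rewrite /quot fsx ftx /polar !RIE /difference_quotient /=; ring.
Qed.

End intensity_derivative.

(** * Choice of versions and conclusion *)

Section versions.
Context {R : realType} {N : nat}.
Local Notation V := (Rn R N).
Local Notation mu := (lebesgueN R N).
Local Notation tau := (2 * pi : R).
Implicit Types (u w : V -> R[i]).

Lemma ext_ae c u u' w : sqi mu u' -> (\forall x \ae mu, u x = u' x) ->
  ext c u w -> ext c u' w.
Proof.
move=> su uu' [u_ [lu uu uw]]; exists u_; split=> //.
apply: (cvg_ext uu) => // n; apply/esym/nrm_version.
  exact: (sqiB (lu n).1 su).1.
by apply: filterS uu' => x ->.
Qed.

Lemma nrm_evolved (u : V -> R[i]) psi s : nrm mu (evolved u psi s) = nrm mu u.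
Proof.
congr Num.sqrt; apply: eq_Rintegral => x _.
rewrite /rdot /evolved -!expr2 -!sqr_normc sqr_normcM sqr_normc_expi mul1r.
by [].
Qed.

(** The bound on [d] travels through the isometry: the norm of [d] is that of its image, at most [K]
    times that of [f], which is that of the evolved data and hence of [u]. The triple exists for
    every real [s], with its properties under an implication, so that the axiom of choice yields
    functions of [s]. *)
Lemma evolution_versions (T K : R) (u : V -> R[i]) (psi : V -> R -> R)
    (X : set (V -> R[i])) (f : V -> R -> R[i]) :
  let G (t : R) := is_multiplier (fun xi => derive_in T (psi xi) t) in
  (forall (t : R) v, t \in `[0, T] -> X v -> exists g, G t v g) ->
  (forall (t : R) v g, t \in `[0, T] -> X v -> G t v g ->
    (L2norm g <= K%:E * L2norm v)%E) ->
  (forall t : R, t \in `[0, T] ->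
    is_ifourier (evolved u psi t) (f ^~ t) /\ X (f ^~ t)) ->
  forall s : R, exists y : (V -> R[i]) * (V -> R[i]) * (V -> R[i]),
    let: (v, d, h) := y in s \in `[0, T] ->
    [/\ sqi mu v /\ \forall x \ae mu, evolved u psi s x = v x,
        sqi mu h /\ \forall x \ae mu, f x s = h x, ext tau v h,
        sqi mu d /\ nrm mu d <= K * nrm mu u &
        \forall x \ae mu, (derive_in T (psi x) s)%:C * evolved u psi s x = d x].
Proof.
move=> G Gex GK F s; have [sT|sT] := boolP (s \in `[0, T]); last first.
  (* Outside the time interval nothing is claimed, and any triple will do. *)
  by exists (u, u, u).
have [vf Xf] := F _ sT; have [g gG] := Gex _ _ sT Xf.
have [v sv vE] := L2_version (let: And3 l _ _ := vf in l).
have [h sh hE] := L2_version (let: And3 _ l _ := vf in l).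
have [d [g' [sd sg dE gE dg]]] :=
  multiplier_version vf sv sh vE hE (aeW _ (fun=> erefl)) gG.
exists (v, d, h) => _; have vh := is_ifourier_ext vf sv sh vE hE.
split=> //; split=> //.
have := GK _ _ _ sT Xf gG.
rewrite (L2norm_version sg.1 gE) (L2norm_version sh.1 hE) !L2norm_sqi// lee_fin.
have tau2 : tau_sqr tau by [].
rewrite (ext_nrm tau2 sd sg dg) (ext_nrm tau2 sv sh vh).
by rewrite -(nrm_version sv.1 vE) nrm_evolved.
Qed.

End versions.

Unset Implicit Arguments.

Theorem theorem3p8 (R : realType) (N : nat) (T : R)
  (u : Rn R N -> R[i]) (psi : Rn R N -> R -> R)
  (X : set (Rn R N -> R[i])) (f : Rn R N -> R -> R[i])
  (Z1 Z2 : set (Rn R N -> R))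
  (Lpsi Spsi : R -> (Rn R N -> R) -> (Rn R N -> R) -> Rn R N -> R)
  (phi : Rn R N -> R -> R) :
  let mu := lebesgueN R N in
  let G (t : R) := is_multiplier (fun xi => derive_in T (psi xi) t) in
  let I := intensity f in
  let A := amplitude f in
  0 < T ->
  L2 u ->
  (forall xi, C1_in T (psi xi)) ->
  closed_subspace X ->
  (* the operator G t is well defined on X and bounded, uniformly in t *)
  (forall (t : R) v, t \in `[0, T] -> X v -> exists g, G t v g) ->
  (exists K : R, forall (t : R) v g, t \in `[0, T] -> X v -> G t v g ->
    (L2norm g <= K%:E * L2norm v)%E) ->
  (* f ^~ t is a version of F^-1 (e^(i psi(t)) u) *)
  (forall t : R, t \in `[0, T] ->
    is_ifourier (fun xi => expi (psi xi t) * u xi) (f ^~ t) /\ X (f ^~ t)) ->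
  (forall a, Z1 a -> realL2 a) ->
  (forall p, Z2 p -> realL2 p) ->
  (forall (t : R) a p, t \in `[0, T] -> Z1 a -> Z2 p ->
    realL2 (Lpsi t a p) /\ realL2 (Spsi t a p)) ->
  (forall (t : R) a p, t \in `[0, T] -> Z1 a -> Z2 p ->
    X (polar a p) /\
    forall g, G t (polar a p) g ->
      \forall x \ae mu,
        'i%C * g x = expi (p x) * ((Lpsi t a p x)%:C + 'i%C * (Spsi t a p x)%:C)) ->
  (* polar form; A is the square root of I by definition *)
  (forall t : R, t \in `[0, T] -> \forall x \ae mu,
    f x t = polar (A ^~ t) (phi ^~ t) x) ->
  (forall t : R, t \in `[0, T] -> Z1 (A ^~ t) /\ Z2 (phi ^~ t)) ->
  forall t : R, t \in `[0, T] ->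
    [/\ is_weak_derive_in T I t
          (fun x => 2 * A x t * Lpsi t (A ^~ t) (phi ^~ t) x),
        (\forall x \ae mu, derivable_in T (I x) t ->
          derive_in T (I x) t = 2 * A x t * Lpsi t (A ^~ t) (phi ^~ t) x) &
        (\forall x \ae mu,
          derivable_in T (A x) t -> derivable_in T (phi x) t ->
          2 * I x t * derive_in T (phi x) t =
          2 * A x t * Spsi t (A ^~ t) (phi ^~ t) x)].
Proof.
move=> mu G I A T0 _ cpsi _ Gex [K GK] F _ _ _ GLS fpolar ZA t tT.
have /choice[y yP] := evolution_versions Gex GK F.
pose vv s := (y s).1.1; pose dd s := (y s).1.2; pose ff s := (y s).2.
have {}yP s : s \in `[0, T] ->
    [/\ sqi mu (vv s) /\ \forall x \ae mu, evolved u psi s x = vv s x,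
        sqi mu (ff s) /\ \forall x \ae mu, f x s = ff s x, ext (2 * pi) (vv s) (ff s),
        sqi mu (dd s) /\ nrm mu (dd s) <= K * nrm mu u &
        \forall x \ae mu, (derive_in T (psi x) s)%:C * evolved u psi s x = dd s x].
  by move=> sT; have := yP s; rewrite /vv /dd /ff; case: (y s) => -[v d] h; exact.
have svv s : s \in `[0, T] -> sqi mu (vv s) by case/yP => -[].
have vvE s : s \in `[0, T] -> \forall x \ae mu, evolved u psi s x = vv s x.
  by case/yP => -[].
have sff s : s \in `[0, T] -> sqi mu (ff s) by case/yP => _ [].
have ffE s : s \in `[0, T] -> \forall x \ae mu, f x s = ff s x.
  by case/yP => _ [].
have vf s : s \in `[0, T] -> ext (2 * pi) (vv s) (ff s) by case/yP.
have sdd s : s \in `[0, T] -> sqi mu (dd s) by case/yP => _ _ _ [].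
have ddM s : s \in `[0, T] -> nrm mu (dd s) <= K * nrm mu u by case/yP => _ _ _ [].
have ddE s : s \in `[0, T] ->
  \forall x \ae mu, (derive_in T (psi x) s)%:C * evolved u psi s x = dd s x.
  by case/yP.
(* The decomposition into [Lpsi] and [Spsi] concerns the polar form, which agrees with [f ^~ t] only
   almost everywhere; the image under [G t] of the former is therefore related to the versions
   chosen for the latter. *)
have [ZAt Zpt] := ZA _ tT; have [Xp GP] := GLS _ _ _ tT ZAt Zpt.
have [g gG] := Gex _ _ tT Xp; have gE := GP _ gG.
have pf : \forall x \ae mu, polar (A ^~ t) (phi ^~ t) x = f x t.
  by apply: filterS (fpolar _ tT) => x ->.
have [d' [gg [sd' sgg dE' ggE dg']]] := multiplier_version (F _ tT).1 (svv _ tT)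
  (sff _ tT) (vvE _ tT) (ffE _ tT) pf gG.
(* [d'] and [dd t] were chosen independently, but are versions of the same product of [psi'] with
   the evolved data. *)
have dg : ext (2 * pi) (dd t) gg.
  apply: ext_ae (sdd _ tT) _ dg'.
  by apply: filterS2 dE' (ddE _ tT) => x <-.
set L := Lpsi t (A ^~ t) (phi ^~ t) in gE *.
set S := Spsi t (A ^~ t) (phi ^~ t) in gE *.
have iggE : \forall x \ae mu, 'i * gg x = expi (phi x t) * (L x +i* S x).
  apply: filterS2 gE ggE => x; rewrite -complexiE => h <-; rewrite h.
  by rewrite [in RHS](complexE (_ +i* _)).
have kE : \forall x \ae mu, 2 * A x t * L x = 2 * rdot (fun x => 'i * gg x) (ff t) x.
  apply: filterS3 iggE (ffE _ tT) pf => x h fx px.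
  rewrite /rdot h -fx -px /polar !RIE /=.
  have := cos2Dsin2 (phi x t).
  move: (cos _) (sin _) (L x) (S x) (A x t) => c s l m a cs.
  (* The phase factors of the two arguments combine to [c ^+ 2 + s ^+ 2], and the terms in [m]
     cancel. *)
  by transitivity (2 * (a * l * (c ^+ 2 + s ^+ 2))); [rewrite cs|]; ring.
split.
- exact: (intensity_weak_derive T0 cpsi svv sdd sff vvE ddE ddM vf tT sgg dg ffE kE).
- exact: (intensity_derive T0 cpsi svv sdd sff vvE ddE ddM vf tT sgg dg ffE kE).
have H := polar_derive T0 cpsi svv sdd sff vvE ddE ddM vf tT sgg dg ffE fpolar.
apply: filterS2 H iggE => x H h dA dp; have := H dA dp; rewrite {H dA dp} h.
have e0 : expi (phi x t) != 0.
  apply/eqP => e; have := sqr_normc_expi (phi x t).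
  by rewrite e normc0 expr0n => /eqP; rewrite eq_sym oner_eq0.
(* Cancelling the phase and comparing imaginary parts gives [S = A phi']. The claim is this identity
   times [2 A], so zeros of the amplitude need no separate treatment. *)
move/(mulfI e0) => -[_ ->].
have -> : I x t = A x t ^+ 2 by rewrite /A /amplitude sqr_sqrtr// sqr_ge0.
by ring.
Qed.
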